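(* Assume that $\alpha\in\,]1,3[\,\cup\,]3,+\infty[$. Let $\mathcal{H}_{p,\alpha}$ (respectively $\mathcal{H}_p$) be the subspace of $\mathcal{H}$ associated to $\Sigma_{p,\alpha}$ (respectively to $\Sigma_p$). Then: (1) The generalized eigenfunctions of $\mathcal{A}_\alpha$ associated to the eigenvalues in $\Sigma_{p,\alpha}$ form a Riesz basis of $\mathcal{H}_{p,\alpha}$. (2) $\mathcal{H}_{p,\alpha}$ is orthogonal to $\mathcal{H}_p$. (3) Let $(u_0,u_1)\in\mathcal{H}_{p,\alpha}\oplus\mathcal{H}_p$ be the initial condition of the Cauchy problem $U'(t)=\mathcal{A}_\alpha U(t)$, $t>0$, $U(0)=(u_0,u_1)$, and let $(u_0^p,u_1^p)$ be its orthogonal projection onto $\mathcal{H}_p$. Then the solution $U(t)=(u(t),u'(t))$ decreases exponentially, in $\mathcal{H}$, to $(u_0^p,u_1^p)$ when $t$ tends to $+\infty$, with decay rate given by the spectral abscissa $\sup_{\lambda\in\Sigma_{p,\alpha}}\Re(\lambda)<0$.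
   Context: Fix $L>0$. The tadpole graph $\mathcal{R}$ is the union of the closures of $R_1=(0,+\infty)$ and $R_2=(0,L)$, where both endpoints $0$ and $L$ of $R_2$ are glued to the endpoint $0$ of the half-line $R_1$ at a single vertex. Functions on $\mathcal{R}$ are pairs $f=(f_1,f_2)$ of complex-valued functions, $f_k$ defined on $R_k$. For $m\in\mathbb{N}$, $\dot H^m(R_k)$ is the set of $u\in L^2_{\rm loc}(R_k)$ with $u^{(m)}\in L^2(R_k)$. Put $L^2(\mathcal{R})=L^2(R_1)\oplus L^2(R_2)$, $\dot H^1(\mathcal{R})=\{f\in\dot H^1(R_1)\oplus\dot H^1(R_2):\ f_1(0)=f_2(0)=f_2(L)\}$, and $\widehat H^1(\mathcal{R})=\dot H^1(\mathcal{R})/\mathcal{P}_0$, the quotient by constants, with inner product $\langle f,g\rangle_{\widehat H^1(\mathcal R)}=\sum_{k=1}^2\langle f_k',g_k'\rangle_{L^2(R_k)}$. The energy space is $\mathcal{H}=\widehat H^1(\mathcal{R})\times L^2(\mathcal{R})$ with $\langle(f,u),(g,v)\rangle_{\mathcal{H}}=\sum_{k=1}^2\left(\langle f_k',g_k'\rangle_{L^2(R_k)}+\langle u_k,v_k\rangle_{L^2(R_k)}\right)$. For $\alpha\in\mathbb{R}$, $\mathcal{A}_\alpha$ is the unbounded operator on $\mathcal{H}$, $\mathcal{A}_\alpha(u,v)=(v,\partial^2u)$ with $\partial^2u=(u_1'',u_2'')$, with domain $\mathcal{D}(\mathcal{A}_\alpha)$ consisting of all $(u,v)\in\mathcal{H}$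 with $u,v\in\widehat H^1(\mathcal{R})$ (so $v$, being also in $L^2(\mathcal R)$, has a well-defined vertex value), $u_k\in\dot H^2(R_k)$ for $k=1,2$, and $u_1'(0^+)+u_2'(0^+)-u_2'(L^-)=\alpha v_1(0)$. For $\alpha\ge0$, $\mathcal{A}_\alpha$ generates a $C_0$-semigroup of contractions $(e^{t\mathcal{A}_\alpha})_{t\ge0}$ on $\mathcal{H}$. Eigenvalue sets: $\Sigma_p=\{\frac{2\pi n}{L}i;\ n\in\mathbb{Z}\setminus\{0\}\}$; $\Sigma_{p,\alpha}=\{\frac1L\ln(\frac{3-\alpha}{1+\alpha})+\frac{2\pi n}{L}i;\ n\in\mathbb{Z}\}$ if $\alpha\in\,]1,3[$; $\Sigma_{p,\alpha}=\{\frac1L\ln(\frac{\alpha-3}{1+\alpha})+\frac{(2n+1)\pi}{L}i;\ n\in\mathbb{Z}\}$ if $\alpha>3$. The subspaces $\mathcal{H}_{p,\alpha}$ and $\mathcal{H}_p$ are the closed subspaces of $\mathcal{H}$ spanned by the (generalized) eigenfunctions of $\mathcal{A}_\alpha$ associated to the eigenvalues in $\Sigma_{p,\alpha}$ and $\Sigma_p$ respectively; eigenfunctions are taken normalized in $\mathcal{H}$. A sequence $(\Psi_n)_{n\in\mathbb{Z}}$ is a Riesz basis of a Hilbert space $V$ if there exist a Hilbert space $\tilde V$, an orthonormal basis $(e_n)_{n\in\mathbb{Z}}$ of $\tilde V$ and an isomorphism $\Theta:\tilde V\to V$ with $\Theta e_n=\Psi_n$ for all $n\in\mathbb{Z}$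.
   Formalization: In (3), U(t) approaches the solution issued from the projection (u_0^p,u_1^p), not that fixed vector: for an eigenfunction of an eigenvalue in Σ_p the projection is the initial state itself and U(t) oscillates without converging. *)

(* Defs.v *)
From HB Require Import structures.
From mathcomp Require Import all_boot all_order all_algebra complex.
From mathcomp Require Import all_classical all_reals all_analysis measurable_realfun.
From mathcomp Require Import ring lra.

Set Implicit Arguments.
Unset Strict Implicit.
Unset Printing Implicit Defensive.
Import Order.TTheory GRing.Theory Num.Theory.
Import numFieldNormedType.Exports.
Import Quotient.
Local Open Scope classical_set_scope.
Local Open Scope ring_scope.
Local Open Scope quotient_scope.

Section QuotientLmodule.
Context (K : pzRingType) (V : lmodType K) (N : zmodClosed V).
Hypothesis NZ : GRing.scaler_closed N.

Definition scaleq (a : K) (x : {quot N}) : {quot N} := \pi_{quot N} (a *: repr x).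

Lemma pi_scaleq a (v : V) : scaleq a (\pi_{quot N} v) = \pi_{quot N} (a *: v).
Proof.
apply/eqP; rewrite /scaleq -Quotient.idealrBE -scalerBr; apply: NZ.
by rewrite Quotient.idealrBE reprK.
Qed.

Lemma scaleqA a b x : scaleq a (scaleq b x) = scaleq (a * b) x.
Proof. by elim/quotW: x => x; rewrite (pi_scaleq b) !pi_scaleq scalerA. Qed.

Lemma scale1q : left_id 1 scaleq.
Proof. by elim/quotW => x; rewrite !pi_scaleq scale1r. Qed.

Lemma scaleqDr : right_distributive scaleq +%R.
Proof.
move=> a; elim/quotW => x; elim/quotW => y.
by rewrite -raddfD !pi_scaleq -raddfD scalerDr.
Qed.

Lemma scaleqDl x : {morph scaleq^~ x : a b / a + b}.
Proof.
by elim/quotW: x => x a b; rewrite !pi_scaleq -raddfD scalerDl.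
Qed.

End QuotientLmodule.

Section HilbertNotions.
Context {R : realType}.
Local Notation C := R[i].

Section Dot.
Context {V : lmodType C} (dot : V -> V -> C).

Definition hnorm (x : V) : R := Num.sqrt (complex.Re (dot x x)).

Definition lin_span (A : set V) : set V :=
  [set x | exists n (c : 'I_n -> C) (a : 'I_n -> V),
     (forall i, A (a i)) /\ x = \sum_i c i *: a i].

Definition closed_span (A : set V) : set V :=
  [set x | forall e : R, 0 < e -> exists2 y, lin_span A y & hnorm (x - y) < e].

Definition orthogonal_sets (A B : set V) : Prop :=
  forall a b, A a -> B b -> dot a b = 0.

Definition sum_set (A B : set V) : set V :=
  [set x | exists a b, [/\ A a, B b & x = a + b]].

Definition is_orth_proj (W : set V) (x p : V) : Prop :=
  W p /\ forall w, W w -> dot (x - p) w = 0.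

Definition complete_dot : Prop :=
  forall u : nat -> V,
    (forall e : R, 0 < e -> exists N, forall m n, (N <= m)%N -> (N <= n)%N ->
       hnorm (u m - u n) < e) ->
    exists l, hnorm (u n - l) @[n --> \oo] --> (0 : R).

Definition orthonormal_basis (e : int -> V) : Prop :=
  (forall m n, dot (e m) (e n) = (m == n)%:R) /\ closed_span (range e) = setT.

(* Unbounded operators are given by their graph: [A x y] means that x is in
   the domain of A and A x = y. *)
Fixpoint in_ker_power (A : V -> V -> Prop) (l : C) (k : nat) (x : V) : Prop :=
  if k is k'.+1 then exists y, A x y /\ in_ker_power A l k' (y - l *: x)
  else x = 0.

Definition gen_eigenvector (A : V -> V -> Prop) (l : C) (x : V) : Prop :=
  x != 0 /\ exists k, in_ker_power A l k x.

Definition spectral_subspace (A : V -> V -> Prop) (Sigma : set C) : set V :=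
  closed_span [set x | exists2 l, Sigma l & gen_eigenvector A l x].

Record contraction_semigroup (S : R -> V -> V) : Prop := {
  csg_linear : forall t, 0 <= t -> linear (S t) ;
  csg_contr : forall t, 0 <= t -> forall x, hnorm (S t x) <= hnorm x ;
  csg0 : forall x, S 0 x = x ;
  csgD : forall s t, 0 <= s -> 0 <= t -> forall x, S (s + t) x = S s (S t x) ;
  csg_cvg : forall x, hnorm (S h x - x) @[h --> 0^'+] --> (0 : R) }.

Definition is_generator (S : R -> V -> V) (A : V -> V -> Prop) : Prop :=
  forall x y, A x y <->
    hnorm ((h^-1)%:C%C *: (S h x - x) - y) @[h --> 0^'+] --> (0 : R).

(* When V1 and V0 are orthogonal and invariant under S, S t p is both the
   projection onto V0 of the solution S t x and the solution issued from the
   projection p of x. *)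
Definition decays_at_rate (S : R -> V -> V) (V1 V0 : set V) (omega : R) : Prop :=
  exists2 M : R, 0 < M & forall x p, sum_set V1 V0 x -> is_orth_proj V0 x p ->
    forall t, 0 <= t ->
      hnorm (S t x - S t p) <= M * expR (omega * t) * hnorm (x - p).

End Dot.

Record hilbertSpace := HilbertSpace {
  hilbert_sort :> lmodType C ;
  hilbert_dot : {dot hilbert_sort for Num.Def.conjC} ;
  hilbert_complete : complete_dot hilbert_dot }.

(* W is a subspace of V, with the induced inner product. *)
Definition riesz_basis (V : lmodType C) (dot : V -> V -> C) (W : set V)
    (Psi : int -> V) : Prop :=
  exists (E : hilbertSpace) (e : int -> E) (Theta : {linear E -> V}),
  [/\ orthonormal_basis (hilbert_dot E) e,
      injective Theta /\ range Theta = W,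
      exists M : R, forall x, hnorm dot (Theta x) <= M * hnorm (hilbert_dot E) x,
      exists M : R, forall x, hnorm (hilbert_dot E) x <= M * hnorm dot (Theta x) &
      forall n, Theta (e n) = Psi n].

End HilbertNotions.

Section OneEdge.
Context {R : realType}.
Local Notation C := R[i].
Local Notation T := (measurableTypeR R).
Local Notation mu := (@lebesgue_measure R).
Implicit Types (I : set R) (f g u : R -> C).

Definition sqabs (z : C) : R := complex.Re z ^+ 2 + complex.Im z ^+ 2.

Definition cintegral I f : C :=
  Complex (\int[mu]_(x in I) complex.Re (f x)) (\int[mu]_(x in I) complex.Im (f x)).

Definition L2 I : set (R -> C) := [set f |
  [/\ measurable_fun (I : set T) (fun x => complex.Re (f x)),
      measurable_fun (I : set T) (fun x => complex.Im (f x)) &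
      (\int[mu]_(x in I) (sqabs (f x))%:E < +oo)%E]].

Definition L2loc I : set (R -> C) := [set f |
  forall a b, `[a, b] `<=` I -> L2 `[a, b] f].

Definition L2dot I f g : C := cintegral I (fun x => f x * (g x)^*).

Definition test_function I (phi : R -> R) : Prop :=
  (forall n x, derivable (derive1n n phi) x 1) /\
  exists a b, `[a, b] `<=` I /\ forall x, x \notin `[a, b] -> phi x = 0.

(* [g] is the m-th derivative of [u] on the open set [I] in the sense of
   distributions; real test functions suffice, both sides being linear. *)
Definition weak_deriv (m : nat) I u g : Prop :=
  forall phi, test_function I phi ->
    cintegral I (fun x => u x * (derive1n m phi x)%:C%C) =
    (-1) ^+ m * cintegral I (fun x => g x * (phi x)%:C%C).

Definition Hdot (m : nat) I : set (R -> C) := [set u |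
  L2loc I u /\ exists2 g, L2 I g & weak_deriv m I u g].

(* The L^2 derivative of u : Hdot 1 I, which is unique almost everywhere. *)
Definition wderiv I u : R -> C := xget 0 [set g | L2 I g /\ weak_deriv 1 I u g].

Definition has_limit I (a : R) f (c : C) : Prop :=
  complex.Re (f x) @[x --> within I (nbhs a)] --> complex.Re c /\
  complex.Im (f x) @[x --> within I (nbhs a)] --> complex.Im c.

Definition ccontinuous I f : Prop := forall x, I x -> has_limit setT x f (f x).

(* [I] is open and [a] is one of its endpoints; [g] is the continuous
   representative of [f] on [I]. *)
Definition endpoint_value I (a : R) f (c : C) : Prop :=
  exists g, [/\ ccontinuous I g, {ae mu, forall x, I x -> f x = g x} &
                has_limit I a g c].

Definition endpoint_deriv I (a : R) u (d : C) : Prop :=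
  exists g, [/\ L2 I g, weak_deriv 1 I u g & endpoint_value I a g d].


Lemma ReD_lin (c z w : C) : complex.Re (c * z + w) =
  complex.Re c * complex.Re z - complex.Im c * complex.Im z + complex.Re w.
Proof. by case: c z w => [? ?] [? ?] [? ?]. Qed.

Lemma ImD_lin (c z w : C) : complex.Im (c * z + w) =
  complex.Re c * complex.Im z + complex.Im c * complex.Re z + complex.Im w.
Proof. by case: c z w => [? ?] [? ?] [? ?]. Qed.

Lemma sqabs_ge0 (z : C) : 0 <= sqabs z.
Proof. by rewrite addr_ge0 ?sqr_ge0. Qed.

Lemma sqabs_lin (c z w : C) :
  sqabs (c * z + w) <= (2 * sqabs c) * sqabs z + 2 * sqabs w.
Proof.
case: c z w => [a b] [x y] [u v]; rewrite /sqabs /=.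
have := sqr_ge0 (a * x - b * y - u); have := sqr_ge0 (a * y + b * x - v).
nra.
Qed.

Lemma L2P I f : measurable (I : set T) -> L2 I f <->
  [/\ measurable_fun (I : set T) (fun x => complex.Re (f x)),
      measurable_fun (I : set T) (fun x => complex.Im (f x)) &
      mu.-integrable I (EFin \o (fun x => sqabs (f x)))].
Proof.
move=> mI; split=> [[mr mi fin]|[mr mi /integrableP[_ fin]]]; split=> //.
  apply/integrableP; split.
    by apply/measurable_EFinP/measurable_funD; exact: measurable_funX.
  by under eq_integral do rewrite /= ger0_norm ?sqabs_ge0//.
by under eq_integral do rewrite -[X in X%:E]ger0_norm ?sqabs_ge0//.
Qed.

Lemma L2_lin I (c : C) f g : measurable (I : set T) -> L2 I f -> L2 I g ->
  L2 I (fun x => c * f x + g x).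
Proof.
move=> mI /(L2P _ mI)[fr fi fL] /(L2P _ mI)[gr gi gL].
have mr : measurable_fun (I : set T) (fun x => complex.Re (c * f x + g x)).
  under eq_fun do rewrite ReD_lin.
  by apply: measurable_funD => //; apply: measurable_funB; exact: measurable_funM.
have mi : measurable_fun (I : set T) (fun x => complex.Im (c * f x + g x)).
  under eq_fun do rewrite ImD_lin.
  by apply: measurable_funD => //; apply: measurable_funD; exact: measurable_funM.
apply/(L2P _ mI); split => //.
have /(le_integrable mI) := integrableD mI
  (integrableZl mI (2 * sqabs c) fL) (integrableZl mI 2 gL).
apply; first by apply/measurable_EFinP/measurable_funD; exact: measurable_funX.
move=> x _ /=; rewrite lee_fin ger0_norm ?sqabs_ge0// ger0_norm ?sqabs_lin//.
by rewrite addr_ge0 ?mulr_ge0 ?sqabs_ge0.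
Qed.

Lemma L2_0 I : measurable (I : set T) -> L2 I 0.
Proof.
move=> mI; apply/L2P => //; split; [exact: measurable_cst..|].
rewrite (_ : _ \o _ = cst 0%E); first exact: integrable0.
by apply/funext => x /=; rewrite /sqabs /= expr0n addr0.
Qed.

Lemma L2S I J f : measurable (I : set T) -> measurable (J : set T) -> J `<=` I -> L2 I f -> L2 J f.
Proof.
move=> mI mJ JI /(L2P _ mI)[fr fi fL]; apply/(L2P _ mJ).
by split; [exact: measurable_funS fr|exact: measurable_funS fi|exact: integrableS fL].
Qed.

Lemma L2_L2loc I f : measurable (I : set T) -> L2 I f -> L2loc I f.
Proof. by move=> mI fL a b abI; exact: L2S fL. Qed.

Lemma L2loc_lin I (c : C) f g : L2loc I f -> L2loc I g ->
  L2loc I (fun x => c * f x + g x).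
Proof. by move=> fL gL a b abI; apply: L2_lin; [|exact: fL|exact: gL]. Qed.

Lemma cintegral_lin I (c : C) f g : measurable (I : set T) ->
  mu.-integrable I (EFin \o (fun x => complex.Re (f x))) ->
  mu.-integrable I (EFin \o (fun x => complex.Im (f x))) ->
  mu.-integrable I (EFin \o (fun x => complex.Re (g x))) ->
  mu.-integrable I (EFin \o (fun x => complex.Im (g x))) ->
  cintegral I (fun x => c * f x + g x) = c * cintegral I f + cintegral I g.
Proof.
move=> mI fr fi gr gi.
have Z (k : R) h (hi : mu.-integrable I (EFin \o h)) :
  mu.-integrable I (EFin \o (fun x => k * h x)) := integrableZl mI k hi.
rewrite /cintegral.
under eq_Rintegral do rewrite ReD_lin.
under [X in Complex _ X]eq_Rintegral do rewrite ImD_lin.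
rewrite RintegralD//; last exact: (integrableB mI (Z _ _ fr) (Z _ _ fi)).
rewrite RintegralB//; [|exact: Z..].
rewrite RintegralD//; last exact: (integrableD mI (Z _ _ fi) (Z _ _ fr)).
rewrite RintegralD//; [|exact: Z..].
by rewrite !RintegralZl//; case: c => ? ?.
Qed.

Lemma test_derivS I phi n : test_function I phi -> test_function I (derive1n n phi).
Proof.
move=> [phiD [a [b [abI phi0]]]]; split.
  by move=> m x; rewrite /derive1n -iterD; exact: phiD.
exists a, b; split=> //; elim: n => [//|n IH] x xab.
rewrite derive1nS derive1E.
have : \forall y \near x, derive1n n phi y = cst 0 y.
  have : open (~` `[a, b]) by apply: closed_openC; exact: itv_closed.
  rewrite openE => /(_ x); rewrite /interior; move/negP : xab => xab /(_ xab).
  by apply: filterS => y /negP/IH ->.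
move=> /(near_eq_derive (f := derive1n n phi) (g := cst 0)).
by move=> /(_ 1) -> //; rewrite ?derive_cst ?oner_neq0.
Qed.

Lemma test_integrable I (h : R -> C) phi : measurable (I : set T) -> L2loc I h ->
  test_function I phi ->
  mu.-integrable I (EFin \o (fun x => complex.Re (h x * (phi x)%:C%C))) /\
  mu.-integrable I (EFin \o (fun x => complex.Im (h x * (phi x)%:C%C))).
Proof.
move=> mI hL [phiD [a [b [abI phi0]]]].
have /L2P[//|hr hi hab] := hL a b abI.
have phic : continuous phi.
  by move=> x; apply: differentiable_continuous; apply/derivable1_diffP; exact: (phiD 0).
have phim : measurable_fun (`[a, b] : set T) phi.
  by apply: measurable_funTS; exact: continuous_measurable_fun.
have phi2 : mu.-integrable `[a, b] (EFin \o (fun x => phi x ^+ 2)).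
  apply: continuous_compact_integrable; first exact: segment_compact.
  by apply: continuous_subspaceT => x; apply: cvgM; exact: phic.
have mab : measurable (`[a, b] : set T) by [].
have aux (k : R -> R) : measurable_fun (`[a, b] : set T) k ->
    (forall x, k x ^+ 2 <= sqabs (h x)) ->
    mu.-integrable I (EFin \o (fun x => k x * phi x)).
  move=> mk kh.
  have kab : mu.-integrable `[a, b] (EFin \o (fun x => k x * phi x)).
    apply: le_integrable (integrableD mab hab phi2) => //.
      by apply/measurable_EFinP; exact: measurable_funM.
    move=> x _ /=; rewrite lee_fin [leRHS]ger0_norm ?addr_ge0 ?sqabs_ge0 ?sqr_ge0//.
    apply: (@le_trans _ _ (k x ^+ 2 + phi x ^+ 2)); last by rewrite lerD2r.
    by rewrite ler_norml; apply/andP; split; nra.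
  apply/(integrable_mkcond _ mI); move/(integrable_mkcond _ mab): kab.
  congr (integrable _ _ _); apply/funext => x; rewrite !patchE.
  case: ifPn => [xab|]; first by rewrite ifT// inE; apply: abI; rewrite inE in xab.
  rewrite notin_setE => /negP xab; case: ifPn => //= _.
  by rewrite phi0 ?mulr0.
split.
  rewrite (_ : (fun x => _) = (fun x => complex.Re (h x) * phi x)).
    by apply: aux => // x; rewrite lerDl sqr_ge0.
  by apply/funext => x; case: (h x) => ? ? /=; rewrite mulr0 subr0.
rewrite (_ : (fun x => _) = (fun x => complex.Im (h x) * phi x)).
  by apply: aux => // x; rewrite lerDr sqr_ge0.
by apply/funext => x; case: (h x) => ? ? /=; rewrite mulr0 add0r.
Qed.

Lemma weak_deriv_lin m I (c : C) (u1 u2 g1 g2 : R -> C) : measurable (I : set T) ->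
  L2loc I u1 -> L2loc I u2 -> L2loc I g1 -> L2loc I g2 ->
  weak_deriv m I u1 g1 -> weak_deriv m I u2 g2 ->
  weak_deriv m I (fun x => c * u1 x + u2 x) (fun x => c * g1 x + g2 x).
Proof.
move=> mI U1 U2 G1 G2 D1 D2 phi Tphi.
have Tm := test_derivS m Tphi.
under [in LHS]eq_fun do rewrite mulrDl -mulrA.
under [in RHS]eq_fun do rewrite mulrDl -mulrA.
have [? ?] := test_integrable mI U1 Tm; have [? ?] := test_integrable mI U2 Tm.
have [? ?] := test_integrable mI G1 Tphi; have [? ?] := test_integrable mI G2 Tphi.
rewrite !cintegral_lin// D1// D2//.
by rewrite mulrDr mulrCA.
Qed.

Lemma cintegral0 I : cintegral I (fun=> 0 : C) = 0.
Proof. by rewrite /cintegral /= /Rintegral integral0. Qed.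

Lemma weak_deriv0 m I : weak_deriv m I 0 0.
Proof.
move=> phi _; under eq_fun do rewrite mul0r.
by under [in RHS]eq_fun do rewrite mul0r; rewrite cintegral0 mulr0.
Qed.

Lemma Hdot_lin m I (c : C) f g : measurable (I : set T) -> Hdot m I f -> Hdot m I g ->
  Hdot m I (fun x => c * f x + g x).
Proof.
move=> mI [fL [f' f'L fD]] [gL [g' g'L gD]]; split; first exact: L2loc_lin.
exists (fun x => c * f' x + g' x); first exact: L2_lin.
by apply: weak_deriv_lin => //; exact: L2_L2loc.
Qed.

Lemma Hdot0 m I : measurable (I : set T) -> Hdot m I 0.
Proof.
move=> mI; split; first by move=> a b _; exact: L2_0.
by exists 0; [exact: L2_0|exact: weak_deriv0].
Qed.

Lemma has_limit_lin I (a : R) (k : C) f g (c d : C) :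
  has_limit I a f c -> has_limit I a g d ->
  has_limit I a (fun x => k * f x + g x) (k * c + d).
Proof.
move=> [fr fi] [gr gi]; split.
  rewrite ReD_lin; under eq_fun do rewrite ReD_lin.
  by apply: cvgD => //; apply: cvgB; apply: cvgMl_tmp.
rewrite ImD_lin; under eq_fun do rewrite ImD_lin.
by apply: cvgD => //; apply: cvgD; apply: cvgMl_tmp.
Qed.

#[local] Instance ae_mu_filter : Filter (nbhs (almost_everywhere mu)).
Proof. exact: (ae_filter_ringOfSetsType mu). Qed.

Lemma endpoint_value_lin I (a : R) (k : C) f g (c d : C) :
  endpoint_value I a f c -> endpoint_value I a g d ->
  endpoint_value I a (fun x => k * f x + g x) (k * c + d).
Proof.
move=> [f' [f'c ff' f'l]] [g' [g'c gg' g'l]].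
exists (fun x => k * f' x + g' x); split.
- by move=> x Ix; apply: has_limit_lin; [exact: f'c|exact: g'c].
- by apply: filterS2 ff' gg' => x fx gx Ix; rewrite fx// gx.
- exact: has_limit_lin.
Qed.

Lemma endpoint_value0 I (a : R) : endpoint_value I a 0 0.
Proof.
exists 0; split; [|by apply: nearW|by split; exact: cvg_cst].
by move=> x _; split; exact: cvg_cst.
Qed.

End OneEdge.

Section Tadpole.
Context {R : realType} (L : R).
Local Notation C := R[i].
Local Notation mu := (@lebesgue_measure R).

#[local] Instance ae_mu_filter3 : Filter (nbhs (almost_everywhere mu)).
Proof. exact: (ae_filter_ringOfSetsType mu). Qed.

Definition edge1 : set R := `]0, +oo[.
Definition edge2 : set R := `]0, L[.

(* Only the restrictions of f.1 to edge1 and of f.2 to edge2 are relevant. *)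
Local Notation graph_fun := ((R -> C) * (R -> C))%type.

Definition L2_pred : {pred graph_fun} :=
  fun f => `[< L2 edge1 f.1 /\ L2 edge2 f.2 >].

Definition vertex_value (f : graph_fun) (c : C) : Prop :=
  [/\ endpoint_value edge1 0 f.1 c, endpoint_value edge2 0 f.2 c &
      endpoint_value edge2 L f.2 c].

Definition Hdot1_pred : {pred graph_fun} := fun f =>
  `[< [/\ Hdot 1 edge1 f.1, Hdot 1 edge2 f.2 & exists c, vertex_value f c] >].

Lemma measurable_edge1 : measurable (edge1 : set (measurableTypeR R)).
Proof. exact: measurable_itv. Qed.

Lemma measurable_edge2 : measurable (edge2 : set (measurableTypeR R)).
Proof. exact: measurable_itv. Qed.

Lemma L2_pred_closed : GRing.submod_closed L2_pred.
Proof.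
split; first by apply/asboolP; split; apply: L2_0; [exact: measurable_edge1|exact: measurable_edge2].
move=> c f g /asboolP[f1 f2] /asboolP[g1 g2]; apply/asboolP; split.
  by apply: L2_lin => //; exact: measurable_edge1.
by apply: L2_lin => //; exact: measurable_edge2.
Qed.
HB.instance Definition _ := GRing.isSubmodClosed.Build C graph_fun L2_pred L2_pred_closed.

Lemma Hdot1_pred_closed : GRing.submod_closed Hdot1_pred.
Proof.
split.
  apply/asboolP; split; [apply: Hdot0; exact: measurable_edge1|
    apply: Hdot0; exact: measurable_edge2|].
  by exists 0; split; exact: endpoint_value0.
move=> k f g /asboolP[f1 f2 [c [fc1 fc2 fc3]]] /asboolP[g1 g2 [d [gd1 gd2 gd3]]].
apply/asboolP; split.
- by apply: Hdot_lin => //; exact: measurable_edge1.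
- by apply: Hdot_lin => //; exact: measurable_edge2.
- by exists (k * c + d); split; exact: endpoint_value_lin.
Qed.
HB.instance Definition _ := GRing.isSubmodClosed.Build C graph_fun Hdot1_pred Hdot1_pred_closed.

Record L2_fun := L2Fun { L2_val :> graph_fun ; _ : L2_val \in L2_pred }.
HB.instance Definition _ := [isSub for L2_val].
HB.instance Definition _ := [Choice of L2_fun by <:].
HB.instance Definition _ := [SubChoice_isSubLmodule of L2_fun by <:].

Record Hdot1 := Hdot1Fun { Hdot1_val :> graph_fun ; _ : Hdot1_val \in Hdot1_pred }.
HB.instance Definition _ := [isSub for Hdot1_val].
HB.instance Definition _ := [Choice of Hdot1 by <:].
HB.instance Definition _ := [SubChoice_isSubLmodule of Hdot1 by <:].

Definition ae_cst (f : graph_fun) (c : C) : Prop :=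
  {ae mu, forall x, edge1 x -> f.1 x = c} /\ {ae mu, forall x, edge2 x -> f.2 x = c}.

Lemma ae_cst_lin (k : C) f g c d : ae_cst f c -> ae_cst g d ->
  ae_cst (k *: f + g) (k * c + d).
Proof.
move=> [f1 f2] [g1 g2]; split.
  by apply: filterS2 f1 g1 => x fx gx Ix; rewrite -fx// -gx.
by apply: filterS2 f2 g2 => x fx gx Ix; rewrite -fx// -gx.
Qed.

Lemma ae_cst0 : ae_cst 0 0.
Proof. by split; apply: nearW. Qed.

Definition L2_null : {pred L2_fun} := fun f => `[< ae_cst f 0 >].

Lemma L2_null_closed : GRing.submod_closed L2_null.
Proof.
split; first by apply/asboolP; exact: ae_cst0.
move=> k f g /asboolP f0 /asboolP g0; apply/asboolP.
by have := ae_cst_lin k f0 g0; rewrite mulr0 addr0.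
Qed.
HB.instance Definition _ := GRing.isSubmodClosed.Build C L2_fun L2_null L2_null_closed.

Definition P0 : {pred Hdot1} := fun f => `[< exists c, ae_cst f c >].

Lemma P0_closed : GRing.submod_closed P0.
Proof.
split; first by apply/asboolP; exists 0; exact: ae_cst0.
move=> k f g /asboolP[c fc] /asboolP[d gd]; apply/asboolP.
by exists (k * c + d); exact: ae_cst_lin.
Qed.
HB.instance Definition _ := GRing.isSubmodClosed.Build C Hdot1 P0 P0_closed.

Lemma L2_null_scale : GRing.scaler_closed L2_null.
Proof. by move=> a f; exact: rpredZ. Qed.

Definition L2_graph : Type := {quot L2_null}.
HB.instance Definition _ := GRing.Zmodule.on L2_graph.
HB.instance Definition _ := GRing.Zmodule_isLmodule.Build C L2_graph
  (scaleqA L2_null_scale) (scale1q L2_null_scale) (scaleqDr L2_null_scale) (scaleqDl L2_null_scale).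

Lemma P0_scale : GRing.scaler_closed P0.
Proof. by move=> a f; exact: rpredZ. Qed.

Definition Hhat1 : Type := {quot P0}.
HB.instance Definition _ := GRing.Zmodule.on Hhat1.
HB.instance Definition _ := GRing.Zmodule_isLmodule.Build C Hhat1
  (scaleqA P0_scale) (scale1q P0_scale) (scaleqDr P0_scale) (scaleqDl P0_scale).

Definition L2_class (f : L2_fun) : L2_graph := \pi_{quot L2_null} f.
Definition Hhat1_class (f : Hdot1) : Hhat1 := \pi_{quot P0} f.

Definition L2_graph_dot (f g : L2_graph) : C :=
  let f : L2_fun := repr f in let g : L2_fun := repr g in
  L2dot edge1 f.1 g.1 + L2dot edge2 f.2 g.2.

Definition Hhat1_dot (f g : Hhat1) : C :=
  let f : Hdot1 := repr f in let g : Hdot1 := repr g in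
  L2dot edge1 (wderiv edge1 f.1) (wderiv edge1 g.1) +
  L2dot edge2 (wderiv edge2 f.2) (wderiv edge2 g.2).

Definition energy : lmodType C := (Hhat1 * L2_graph)%type.

Definition energy_dot (U V : energy) : C :=
  Hhat1_dot U.1 V.1 + L2_graph_dot U.2 V.2.

(* The graph of the operator A_alpha: U = (u, v) and W = (v, u''). *)
Definition wave_op (alpha : R) (U W : energy) : Prop :=
  exists (u v : Hdot1) (v' w : L2_fun),
  [/\ L2_val v' = Hdot1_val v,
      U = (Hhat1_class u, L2_class v') /\ W = (Hhat1_class v, L2_class w),
      weak_deriv 2 edge1 u.1 w.1 /\ weak_deriv 2 edge2 u.2 w.2 &
      exists d1 d0 dL c : C,
      [/\ endpoint_deriv edge1 0 u.1 d1, endpoint_deriv edge2 0 u.2 d0,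
          endpoint_deriv edge2 L u.2 dL, vertex_value v c &
          d1 + d0 - dL = alpha%:C%C * c]].

Definition Sigma_p : set C :=
  [set Complex 0 (2 * pi * n%:~R / L) | n in [set n : int | n != 0]].

Definition eig_pa (alpha : R) (n : int) : C :=
  if alpha < 3 then
    Complex (ln ((3 - alpha) / (1 + alpha)) / L) (2 * pi * n%:~R / L)
  else
    Complex (ln ((alpha - 3) / (1 + alpha)) / L) ((2 * n%:~R + 1) * pi / L).

Definition Sigma_pa (alpha : R) : set C := range (eig_pa alpha).

Definition H_pa (alpha : R) : set energy :=
  spectral_subspace energy_dot (wave_op alpha) (Sigma_pa alpha).

Definition H_p (alpha : R) : set energy :=
  spectral_subspace energy_dot (wave_op alpha) Sigma_p.

End Tadpole.

Arguments energy_dot {R} L.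
Arguments wave_op {R} L alpha.
Arguments H_pa {R} L alpha.
Arguments H_p {R} L alpha.

(* Main.v *)
Require Import Defs.
From HB Require Import structures.
From mathcomp Require Import all_boot all_order all_algebra complex.
From mathcomp Require Import all_classical all_reals all_analysis measurable_realfun.
From mathcomp Require Import ring lra.

Set Implicit Arguments.
Unset Strict Implicit.
Unset Printing Implicit Defensive.
Import Order.TTheory GRing.Theory Num.Theory.
Import numFieldNormedType.Exports.
Local Open Scope classical_set_scope.
Local Open Scope ring_scope.

(* Put z = (3 - alpha) / (1 + alpha), so that |z| < 1. For lambda in Sigma_pa one
   has e^{lambda L} = z, and the unknowns u' and v of A U = lambda U are, up to a
   factor, (1 + z) e^{lambda x} on the half-line and e^{lambda x} -+ z e^{- lambda x}
   on the loop. In the variables v +- u' the equation (A - lambda) U = W decouples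
   into first-order equations, and the vertex conditions exclude Jordan chains.
   For lambda in Sigma_p the same forms hold with z replaced by -1 and a zero
   half-line component; this gives the orthogonality.

   On the loop v + u' = 2 e^{lambda x}. Since all lambda in Sigma_pa have the same
   real part s, multiplying by e^{-sx} produces a Fourier basis of L^2(0, L): the
   form N(U, V) = int_0^L e^{-2sx} (v + u')(U) conj((v + u')(V)) dx is diagonal on
   the eigenfunctions. The energy product itself is a constant multiple of the
   unweighted version of N on their span, because both are explicit multiples of
   (z^2 - 1) / (lambda + conj lambda'). Hence the energy norm and the norm of N are
   equivalent on H_pa, which gives the Riesz basis. The semigroup multiplies N by
   e^{2st} there, which gives the decay rate and its optimality. *)

(** The value z comes from the vertex. Write w = e^{lambda L} and v = a e^{lambda x} + b e^{- lambda
    x} on the loop. Continuity reads (1 - w) (a - b / w) = 0. The root w = 1 is Sigma_p; otherwise b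
    = w a, and the derivative condition becomes 3 - w = alpha (1 + w), that is w = z. At alpha = 1
    the two roots collide, and at alpha = 3 the second one is 0, which no exponential attains.
    Elements of the energy space are classes with arbitrarily chosen representatives, so every
    identity is read almost everywhere on four L^2 components, and the eigenvalue equation is solved
    in the sense of distributions; this is why the du Bois-Reymond lemma and primitives of L^2
    functions are developed. The form N only sees v + u' on the loop, hence is degenerate on the
    whole space. It becomes an inner product on H_pa alone, so the model Hilbert space of the Riesz
    basis is H_pa itself with a multiple of N, and its completeness is inherited from that of the
    energy space. Identities are proved on finite combinations of eigenfunctions; only norm
    inequalities are carried to the closure. *)

#[local] Instance ae_lebesgue_filter (R : realType) :
  Filter (nbhs (almost_everywhere (@lebesgue_measure R))).
Proof. exact: (ae_filter_ringOfSetsType (@lebesgue_measure R)). Qed.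

(** * Semi-inner products, Riesz bases and semigroups *)

Section ComplexParts.
Context {R : realType}.
Local Notation C := R[i].
Implicit Types z w : C.

Lemma conjE z : z^* = Complex (complex.Re z) (- complex.Im z).
Proof. by case: z. Qed.

Lemma complex_ext z w : complex.Re z = complex.Re w -> complex.Im z = complex.Im w -> z = w.
Proof. by case: z w => [a b] [c d] /= -> ->. Qed.

Lemma cReD z w : complex.Re (z + w) = complex.Re z + complex.Re w.
Proof. by case: z w => [? ?] [? ?]. Qed.
Lemma cImD z w : complex.Im (z + w) = complex.Im z + complex.Im w.
Proof. by case: z w => [? ?] [? ?]. Qed.
Lemma cReN z : complex.Re (- z) = - complex.Re z. Proof. by case: z. Qed.
Lemma cImN z : complex.Im (- z) = - complex.Im z. Proof. by case: z. Qed.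
Lemma cReM z w : complex.Re (z * w) =
  complex.Re z * complex.Re w - complex.Im z * complex.Im w.
Proof. by case: z w => [? ?] [? ?]. Qed.
Lemma cImM z w : complex.Im (z * w) =
  complex.Re z * complex.Im w + complex.Im z * complex.Re w.
Proof. by case: z w => [? ?] [? ?]. Qed.

Lemma sqabsE z : (sqabs z)%:C%C = z * z^*.
Proof.
by rewrite conjE; apply: complex_ext; rewrite ?cReM ?cImM /= /sqabs; ring.
Qed.

Lemma sqabsM z w : sqabs (z * w) = sqabs z * sqabs w.
Proof. by rewrite /sqabs cReM cImM; ring. Qed.

Lemma sqabs_real (r : R) : sqabs r%:C%C = r ^+ 2.
Proof. by rewrite /sqabs /= expr0n addr0. Qed.

Lemma sqabs_eq0 z : (sqabs z == 0) = (z == 0).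
Proof.
apply/eqP/eqP => [|->]; last by rewrite /sqabs /= expr0n addr0.
rewrite /sqabs => /eqP; rewrite paddr_eq0 ?sqr_ge0// !sqrf_eq0 => /andP[/eqP a /eqP b].
exact: complex_ext.
Qed.

Lemma sqabs1 : sqabs (1 : C) = 1.
Proof. by rewrite /sqabs /= expr0n addr0 expr1n. Qed.

End ComplexParts.

Section ComplexExponential.
Context {R : realType}.
Local Notation C := R[i].
Implicit Types l m : C.

Definition cexp l (t : R) : C :=
  Complex (expR (complex.Re l * t) * cos (complex.Im l * t))
          (expR (complex.Re l * t) * sin (complex.Im l * t)).

Lemma cexp0r l : cexp l 0 = 1.
Proof. by apply: complex_ext; rewrite /= !mulr0 expR0 ?cos0 ?sin0 ?mulr1 ?mulr0. Qed.

Lemma cexp0l t : cexp 0 t = 1.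
Proof. by apply: complex_ext; rewrite /= !mul0r expR0 ?cos0 ?sin0 ?mulr1 ?mulr0. Qed.

Lemma cexpDr l (s t : R) : cexp l (s + t) = cexp l s * cexp l t.
Proof.
by apply: complex_ext; rewrite ?cReM ?cImM /= !mulrDr expRD ?cosD ?sinD; ring.
Qed.

Lemma cexpDl l m (t : R) : cexp (l + m) t = cexp l t * cexp m t.
Proof.
by apply: complex_ext; rewrite ?cReM ?cImM /= cReD cImD !mulrDl expRD ?cosD ?sinD; ring.
Qed.

Lemma cexp_conj l t : cexp l^* t = (cexp l t)^*.
Proof. by rewrite !conjE; apply: complex_ext; rewrite /= mulNr ?cosN ?sinN ?mulrN. Qed.

Lemma sqabs_cexp l t : sqabs (cexp l t) = expR (2 * complex.Re l * t).
Proof.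
rewrite /sqabs /= !exprMn -mulrDr cos2Dsin2 mulr1 -mulrA [2 * _]mulrC mulrDr mulr1.
by rewrite expRD expr2.
Qed.

Lemma cexp_neq0 l t : cexp l t != 0.
Proof. by rewrite -sqabs_eq0 sqabs_cexp gt_eqF ?expR_gt0. Qed.

Lemma cexpN l t : cexp (- l) t = (cexp l t)^-1.
Proof.
by apply: (mulIf (cexp_neq0 l t)); rewrite -cexpDl addNr cexp0l mulVf ?cexp_neq0.
Qed.

Lemma cexpM l t n : cexp l (t *+ n) = cexp l t ^+ n.
Proof.
by elim: n => [|n IH]; rewrite ?mulr0n ?cexp0r ?expr0// mulrS cexpDr IH exprS.
Qed.

End ComplexExponential.

Section SemiInner.
Context {R : realType}.
Local Notation C := R[i].
Context {V : lmodType C}.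

(** Definiteness is left out so that the same calculus serves the energy product and the weighted
    forms on the loop, which vanish on nonzero vectors. *)
Record semi_inner (d : V -> V -> C) : Prop := {
  semi_lin : forall a x y z, d (a *: x + y) z = a * d x z + d y z ;
  semi_herm : forall x y, d x y = (d y x)^* ;
  semi_ge0 : forall x, 0 <= d x x }.

Variable d : V -> V -> C.
Hypothesis sd : semi_inner d.
Local Notation "''N' x" := (complex.Re (d x x)) (at level 8).

Lemma semi0l z : d 0 z = 0.
Proof. by have := semi_lin sd (-1) 0 0 z; rewrite scaler0 addr0 mulN1r addNr. Qed.
Lemma semiZl a x z : d (a *: x) z = a * d x z.
Proof. by have := semi_lin sd a x 0 z; rewrite semi0l !addr0. Qed.
Lemma semiDl x y z : d (x + y) z = d x z + d y z.
Proof. by have := semi_lin sd 1 x y z; rewrite scale1r mul1r. Qed.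
Lemma semiNl x z : d (- x) z = - d x z.
Proof. by rewrite -scaleN1r semiZl mulN1r. Qed.
Lemma semiBl x y z : d (x - y) z = d x z - d y z.
Proof. by rewrite semiDl semiNl. Qed.
Lemma semiZr a x z : d z (a *: x) = a^* * d z x.
Proof. by rewrite (semi_herm sd) semiZl rmorphM [d z x](semi_herm sd). Qed.
Lemma semiDr x y z : d z (x + y) = d z x + d z y.
Proof. by rewrite (semi_herm sd) semiDl rmorphD [d z x](semi_herm sd) [d z y](semi_herm sd). Qed.
Lemma semiNr x z : d z (- x) = - d z x.
Proof. by rewrite (semi_herm sd) semiNl rmorphN [d z x](semi_herm sd). Qed.

Lemma semi_Re_ge0 x : 0 <= 'N x.
Proof. by have := semi_ge0 sd x; rewrite lecE => /andP[]. Qed.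
Lemma semi_self x : d x x = ('N x)%:C%C.
Proof.
have := semi_ge0 sd x; rewrite lecE => /andP[/eqP h _].
by apply: complex_ext.
Qed.
Lemma hnorm_ge0 x : 0 <= hnorm d x. Proof. exact: sqrtr_ge0. Qed.
Lemma hnorm_sqr x : hnorm d x ^+ 2 = 'N x.
Proof. by rewrite sqr_sqrtr ?semi_Re_ge0. Qed.

Lemma semi_normZ a x : 'N (a *: x) = sqabs a * 'N x.
Proof. by rewrite semiZl semiZr mulrA -sqabsE semi_self; case: (d x x) => u v /=; rewrite mul0r subr0. Qed.

Lemma semi_normD x y : 'N (x + y) = 'N x + 'N y + 2 * complex.Re (d x y).
Proof.
rewrite semiDl !semiDr !cReD [d y x](semi_herm sd) conjE /=; ring.
Qed.

Lemma semi_CS_Re x y : complex.Re (d x y) ^+ 2 <= 'N x * 'N y.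
Proof.
have h t : 0 <= 'N x + t ^+ 2 * 'N y + 2 * t * complex.Re (d x y).
  have := semi_Re_ge0 (x + t%:C%C *: y).
  rewrite semi_normD semi_normZ sqabs_real semiZr conjE /= cReM /= oppr0 mul0r subr0.
  by rewrite mulrA.
have [y0|ny] := eqVneq ('N y) 0.
  have hr t : 0 <= 'N x + 2 * t * complex.Re (d x y) by have := h t; rewrite y0 mulr0 addr0.
  have [r0|nr] := eqVneq (complex.Re (d x y)) 0; first by rewrite r0 y0 mulr0 expr0n.
  (* When y has norm zero the quadratic in t is affine; this t gives it the value -1. *)
  have := hr (- ('N x + 1) / (2 * complex.Re (d x y))).
  by have -> : 'N x + 2 * (- ('N x + 1) / (2 * complex.Re (d x y))) * complex.Re (d x y) = -1
    by [field]; rewrite oppr_ge0 ler10.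
have py : 0 < 'N y by rewrite lt_def ny semi_Re_ge0.
(* This is the minimizer of the quadratic in t. *)
have := h (- complex.Re (d x y) / 'N y); rewrite -(pmulr_rge0 _ py).
set e := (X in 0 <= X); have -> : e = 'N x * 'N y - complex.Re (d x y) ^+ 2 by rewrite /e; field.
by rewrite subr_ge0.
Qed.

Lemma hnormD x y : hnorm d (x + y) <= hnorm d x + hnorm d y.
Proof.
rewrite -(@ler_pXn2r _ 2)// ?nnegrE ?addr_ge0 ?hnorm_ge0// sqrrD !hnorm_sqr semi_normD.
suff : complex.Re (d x y) <= hnorm d x * hnorm d y by lra.
apply: le_trans (ler_norm _) _.
rewrite -(@ler_pXn2r _ 2)// ?nnegrE ?mulr_ge0 ?hnorm_ge0// exprMn !hnorm_sqr.
by rewrite real_normK ?num_real// semi_CS_Re.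
Qed.

Lemma hnormZ a x : hnorm d (a *: x) = Num.sqrt (sqabs a) * hnorm d x.
Proof. by rewrite /hnorm semi_normZ sqrtrM ?sqabs_ge0. Qed.

Lemma hnormN x : hnorm d (- x) = hnorm d x.
Proof. by rewrite /hnorm semiNl semiNr opprK. Qed.

Lemma hnorm0 : hnorm d 0 = 0.
Proof. by rewrite /hnorm semi0l sqrtr0. Qed.

Lemma hnormBC x y : hnorm d (x - y) = hnorm d (y - x).
Proof. by rewrite -hnormN opprB. Qed.

Lemma hnormB_trans x y z : hnorm d (x - z) <= hnorm d (x - y) + hnorm d (y - z).
Proof. by rewrite -(subrKA y); exact: hnormD. Qed.

(** The factor 2 comes from bounding real and imaginary parts separately, the latter as the real
    part for - i x. This suffices for the continuity of the form. *)
Lemma semi_CS x y : sqabs (d x y) <= 2 * (hnorm d x * hnorm d y) ^+ 2.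
Proof.
rewrite exprMn !hnorm_sqr /sqabs mulrDl mul1r lerD ?semi_CS_Re//.
have := semi_CS_Re (Complex 0 (-1) *: x) y; rewrite semi_normZ semiZl cReM /=.
rewrite (_ : sqabs _ = 1) ?mul1r; last by rewrite /sqabs /= sqrrN expr1n expr0n add0r.
by rewrite mul0r add0r mulN1r opprK.
Qed.

End SemiInner.

(** * Linear spans and their closures *)

Section ClosedSpan.
Context {R : realType}.
Local Notation C := R[i].
Context {V : lmodType C} (d : V -> V -> C).
Hypothesis sd : semi_inner d.
Implicit Types A B : set V.

Lemma lin_span_sub A x : A x -> lin_span A x.
Proof.
move=> Ax; exists 1%N, (fun=> 1), (fun=> x); split => //.
by rewrite big_ord1 scale1r.
Qed.

Lemma lin_span_lin A a x y : lin_span A x -> lin_span A y -> lin_span A (a *: x + y).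
Proof.
move=> [n [c [u [uA ->]]]] [m [e [v [vA ->]]]].
exists (n + m)%N, (fun i => match fintype.split i with inl j => a * c j | inr j => e j end),
  (fun i => match fintype.split i with inl j => u j | inr j => v j end).
split=> [i|]; first by case: fintype.split.
rewrite big_split_ord /= scaler_sumr; congr (_ + _); apply: eq_bigr => i _.
  by rewrite (unsplitK (inl i)) scalerA.
by rewrite (unsplitK (inr i)).
Qed.

Lemma lin_span_ind A (P : set V) : P 0 -> (forall a x y, A x -> P y -> P (a *: x + y)) ->
  lin_span A `<=` P.
Proof.
move=> P0 PD _ [n [c [u [uA ->]]]].
elim: n c u uA => [|n IH] c u uA; first by rewrite big_ord0.
by rewrite big_ord_recl; apply: PD => //; apply: IH.
Qed.

Lemma closed_span_lin_span A : lin_span A `<=` closed_span d A.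
Proof. by move=> x xA e e0; exists x => //; rewrite subrr hnorm0. Qed.

Lemma closed_span_sub A : A `<=` closed_span d A.
Proof. by move=> x /lin_span_sub/closed_span_lin_span. Qed.

Lemma closed_span_submod A : GRing.submod_closed (fun x => `[< closed_span d A x >]).
Proof.
split.
  apply/asboolP; apply: closed_span_lin_span.
  by exists 0%N, (fun=> 0), (fun=> 0); split; [case|rewrite big_ord0].
move=> a x y /asboolP xA /asboolP yA; apply/asboolP => e e0.
(* The added 1 keeps the divisor positive when a = 0. *)
have s0 : 0 < Num.sqrt (sqabs a) + 1 by rewrite ltr_wpDl ?sqrtr_ge0.
have [x' x'A xx'] := xA _ (divr_gt0 (divr_gt0 e0 (ltr0Sn R 1)) s0).
have [y' y'A yy'] := yA _ (divr_gt0 e0 (ltr0Sn R 1)).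
exists (a *: x' + y'); first exact: lin_span_lin.
rewrite opprD addrACA -scalerBr.
apply: le_lt_trans (hnormD sd _ _) _; rewrite hnormZ// [e]splitr ler_ltD//.
move: xx'; rewrite ltr_pdivlMr// mulrDr mulr1 mulrC => xx'.
by apply: le_trans (ltW xx'); rewrite lerDl hnorm_ge0.
Qed.

Lemma closed_span_lin A a x y : closed_span d A x -> closed_span d A y ->
  closed_span d A (a *: x + y).
Proof.
move=> xA yA; have [_ /(_ a x y)] := closed_span_submod A.
by move=> /(_ _ _)/asboolP; apply; apply/asboolP.
Qed.

Lemma closed_span0 A : closed_span d A 0.
Proof. by have [/asboolP] := closed_span_submod A. Qed.

Lemma closed_spanB A x y : closed_span d A x -> closed_span d A y ->
  closed_span d A (x - y).
Proof. by move=> xA yA; rewrite addrC -scaleN1r; exact: closed_span_lin. Qed.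

Lemma closed_spanZ A a x : closed_span d A x -> closed_span d A (a *: x).
Proof. by move=> xA; rewrite -[_ *: _]addr0; apply: closed_span_lin => //; exact: closed_span0. Qed.

Lemma closed_span_closed A x :
  (forall e, 0 < e -> exists2 y, closed_span d A y & hnorm d (x - y) < e) ->
  closed_span d A x.
Proof.
move=> h e e0; have e2 := divr_gt0 e0 (ltr0Sn R 1).
have [y yA xy] := h _ e2; have [z zA yz] := yA _ e2.
exists z => //; apply: le_lt_trans (hnormB_trans sd _ y _) _.
by rewrite [e]splitr ltrD.
Qed.

Lemma closed_span_min A B : A `<=` closed_span d B -> closed_span d A `<=` closed_span d B.
Proof.
move=> AB x xA; apply: closed_span_closed => e /xA[y yA xy]; exists y => //.
move: yA; apply: lin_span_ind; first exact: closed_span0.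
by move=> a u v /AB uB vB; exact: closed_span_lin.
Qed.

Lemma orthogonal_lin_span A b : (forall a, A a -> d a b = 0) ->
  forall x, lin_span A x -> d x b = 0.
Proof.
move=> h; apply: lin_span_ind; first exact: semi0l.
by move=> a x y xA yb; rewrite (semi_lin sd) h// yb mulr0 addr0.
Qed.

(** By Cauchy-Schwarz the map sending x to d x b is continuous for the seminorm, so it vanishes on
    the closure as soon as it vanishes on the span. *)
Lemma orthogonal_closed_span A b : (forall a, A a -> d a b = 0) ->
  forall x, closed_span d A x -> d x b = 0.
Proof.
move=> h x xA; apply/eqP; rewrite -sqabs_eq0 eq_le sqabs_ge0 andbT.
apply/ler_addgt0Pr => e e0; rewrite add0r.
have s0 : 0 < hnorm d b + 1 by rewrite ltr_wpDl ?hnorm_ge0.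
(* With m = min (1, e), this radius bounds the product of norms by m / 2, and 2 (m / 2)^2 <= e
   because m^2 <= m <= e. *)
pose r := Num.min 1 e / 2 / (hnorm d b + 1).
have m0 : 0 < Num.min 1 e by rewrite lt_min ltr01.
have r0 : 0 < r by rewrite !divr_gt0.
have [y yA xy] := xA _ r0.
have -> : d x b = d (x - y) b by rewrite semiBl// (orthogonal_lin_span h yA) subr0.
apply: le_trans (semi_CS sd _ _) _.
have /andP[q0 q1] : 0 <= hnorm d (x - y) * hnorm d b <= Num.min 1 e / 2.
  rewrite mulr_ge0 ?hnorm_ge0//=.
  apply: (@le_trans _ _ (r * (hnorm d b + 1))); last by rewrite /r divfK ?gt_eqF.
  by apply: ler_pM; rewrite ?hnorm_ge0 ?(ltW xy)// lerDl.
have : Num.min 1 e <= 1 /\ Num.min 1 e <= e by rewrite !ge_min !lexx orbT.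
by nra.
Qed.

Lemma orthogonal_closed_spans A B : orthogonal_sets d A B ->
  orthogonal_sets d (closed_span d A) (closed_span d B).
Proof.
move=> AB a b aA bB; apply: orthogonal_closed_span aA => x xA.
rewrite (semi_herm sd); have -> : d b x = 0; last by rewrite rmorph0.
apply: orthogonal_closed_span bB => y yB.
by rewrite (semi_herm sd) AB// rmorph0.
Qed.

End ClosedSpan.

Section SubspaceType.
Context {K : pzRingType} {V : lmodType K} (W : submodClosed V).

Record subspace_type := SubspaceType { subspace_val :> V ; _ : subspace_val \in W }.
HB.instance Definition _ := [isSub for subspace_val].
HB.instance Definition _ := [Choice of subspace_type by <:].
HB.instance Definition _ := [SubChoice_isSubLmodule of subspace_type by <:].

End SubspaceType.

(** * Riesz bases from an equivalent inner product *)

Section RieszBasis.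
Context {R : realType}.
Local Notation C := R[i].
Context {V : lmodType C} (d dE : V -> V -> C).
Hypothesis (sd : semi_inner d) (sE : semi_inner dE).
Hypothesis d_complete : complete_dot d.
Variable Psi : int -> V.
Local Notation W := (closed_span d (range Psi)).
Variables M1 M2 : R.
Hypothesis d_definite : forall x, d x x = 0 -> x = 0.
Hypothesis le_dE : forall x, W x -> hnorm d x <= M1 * hnorm dE x.
Hypothesis dE_le : forall x, W x -> hnorm dE x <= M2 * hnorm d x.
Hypothesis dE_orthonormal : forall m n, dE (Psi m) (Psi n) = (m == n)%:R.

Let W_pred : {pred V} := fun x => `[< W x >].
HB.instance Definition _ := GRing.isSubmodClosed.Build C V W_pred
  (closed_span_submod sd (range Psi)).
Let E := subspace_type W_pred.
Let dotE (x y : E) : C := dE (subspace_val x) (subspace_val y).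

Let mkE (x : V) (xW : W x) : E := @SubspaceType _ _ W_pred x (asboolT xW).

Let EW (x : E) : W (subspace_val x).
Proof. by case: x => x xW; apply/asboolP. Qed.

Let dotE_bilinear : bilinear_for *%R (Num.conj \; *%R) dotE.
Proof.
split=> u a x y; first exact: (semi_lin sE).
by rewrite /dotE /= semiDr// semiZr.
Qed.
HB.instance Definition _ := bilinear_isBilinear.Build C E E C *%R (Num.conj \; *%R) dotE dotE_bilinear.
Let dotE_herm x y : dotE x y = (-1) ^+ false * (dotE y x)^*.
Proof. by rewrite expr0 mul1r; exact: (semi_herm sE). Qed.
HB.instance Definition _ := isHermitianSesquilinear.Build C E false Num.conj dotE dotE_herm.
(** Positivity of [dE] is available on W only: there [hnorm d] is dominated by [hnorm dE], and d is
    definite. *)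
Let dotE_pos (x : E) : x != 0 -> 0 < dotE x x.
Proof.
move=> x0; rewrite lt_def (semi_ge0 sE) andbT; apply: contra x0 => /eqP x0.
have h0 : hnorm d (subspace_val x) = 0.
  apply/eqP; rewrite eq_le hnorm_ge0 andbT (le_trans (le_dE (EW x)))//.
  by rewrite {1}/hnorm -/(dotE x x) x0 sqrtr0 mulr0.
apply/eqP/val_inj/d_definite; rewrite semi_self// -hnorm_sqr//.
by rewrite [hnorm _ _]h0 expr0n.
Qed.
HB.instance Definition _ := isDotProduct.Build C E dotE dotE_pos.

(** A Cauchy sequence for [dE] is Cauchy for d, its d-limit stays in the closed set W, and the
    opposite comparison turns d-convergence back into [dE]-convergence. *)
Let E_complete : complete_dot dotE.
Proof.
move=> u uC.
have dC : forall e : R, 0 < e -> exists N, forall m n, (N <= m)%N -> (N <= n)%N ->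
    hnorm d (subspace_val (u m) - subspace_val (u n)) < e.
  (* No sign is assumed for the comparison constants, hence the absolute value and the added 1. *)
  move=> e e0; have M0 : 0 < `|M1| + 1 by rewrite ltr_wpDl.
  have [N NC] := uC _ (divr_gt0 e0 M0).
  exists N => m n /NC h /h{h}; rewrite ltr_pdivlMr// => h.
  apply: le_lt_trans (le_dE (EW (u m - u n))) _; apply: le_lt_trans h.
  rewrite mulrC ler_wpM2l ?hnorm_ge0//.
  by rewrite (le_trans (ler_norm _))// lerDl.
have [l ul] := d_complete dC.
have lW : W l.
  apply: closed_span_closed => // e e0.
  have /cvgrPdist_lt /(_ e e0)[N _ NC] := ul.
  exists (subspace_val (u N)); first exact: EW.
  by have := NC N (leqnn N); rewrite sub0r normrN ger0_norm ?hnorm_ge0// hnormBC.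
exists (mkE lW).
apply: (@squeeze_cvgr _ _ _ _ (fun=> 0) (fun n => M2 * hnorm d (subspace_val (u n) - l))).
- by apply: nearW => n; rewrite hnorm_ge0/=; exact: (dE_le (EW (u n - mkE lW))).
- exact: cvg_cst.
- by rewrite -[X in _ --> X](mulr0 M2); apply: cvgM => //; exact: cvg_cst.
Qed.

Let EPsi n : E := mkE (@closed_span_sub _ _ _ sd (range Psi) (Psi n) (imageT _ _)).

Let val_lin_span (y : V) : lin_span (range Psi) y ->
  exists2 y' : E, lin_span (range EPsi) y' & subspace_val y' = y.
Proof.
have h : lin_span (range Psi) `<=` [set y | exists2 y' : E, lin_span (range EPsi) y' & subspace_val y' = y].
  apply: lin_span_ind.
    by exists 0 => //; exists 0%N, (fun=> 0), (fun=> 0); split; [case|rewrite big_ord0].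
  move=> a x z [n _ <-] [z' z's <-]; exists (a *: EPsi n + z') => //.
  by apply: lin_span_lin => //; apply: lin_span_sub; exists n.
exact: h.
Qed.

(** The Hilbert space is W with the product [dE], the orthonormal basis is the family itself, and
    the isomorphism is the inclusion into V; the two norm comparisons say that it is bounded with
    bounded inverse. *)
Theorem riesz_basis_orthonormal_form : riesz_basis d W Psi.
Proof.
exists (@HilbertSpace R E dotE E_complete), EPsi, (val : {linear E -> V}); split.
- split=> [m n|]; first exact: dE_orthonormal.
  apply/seteqP; split=> // x _ e e0.
  have M0 : 0 < `|M2| + 1 by rewrite ltr_wpDl.
  have [y /val_lin_span[y' y's <-] xy] := EW x (divr_gt0 e0 M0).
  exists y' => //; move: xy; rewrite ltr_pdivlMr// => xy.
  apply: le_lt_trans (dE_le (EW (x - y'))) _; apply: le_lt_trans xy.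
  by rewrite mulrC ler_wpM2l ?hnorm_ge0// (le_trans (ler_norm _))// lerDl.
- split; first exact: val_inj.
  apply/seteqP; split=> [_ [x _ <-]|x xW]; first exact: EW.
  by exists (mkE xW).
- by exists M1 => x; exact: le_dE (EW x).
- by exists M2 => x; exact: dE_le (EW x).
- by [].
Qed.

End RieszBasis.

Section CexpDeriv.
Context {R : realType}.
Local Notation C := R[i].

Lemma is_derive_Re_cexp (l : C) (t : R) : is_derive t 1 (fun t => complex.Re (cexp l t))
  (complex.Re (l * cexp l t)).
Proof.
rewrite /=; apply: is_derive_eq.
by rewrite !scaler1 cReM /= /GRing.scale /=; ring.
Qed.

Lemma is_derive_Im_cexp (l : C) (t : R) : is_derive t 1 (fun t => complex.Im (cexp l t))
  (complex.Im (l * cexp l t)).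
Proof.
rewrite /=; apply: is_derive_eq.
by rewrite !scaler1 cImM /= /GRing.scale /=; ring.
Qed.

Lemma cvg_quotient_derive (f : R -> R) (a f' : R) : is_derive a 1 f f' ->
  h^-1 * (f (h + a) - f a) @[h --> 0^'+] --> f'.
Proof.
move=> -[df <-]; apply: cvg_dnbhs_at_right.
have h : h^-1 *: ((f \o shift a) (h *: 1) - f a) @[h --> 0^'] --> 'D_1 f a := df.
by move: h; under eq_fun do rewrite /= [_%:A]mulr1.
Qed.

End CexpDeriv.

(** * Orbits of eigenvectors under a contraction semigroup *)

Section Semigroup.
Context {R : realType}.
Local Notation C := R[i].
Context {V : lmodType C} (d : V -> V -> C).
Hypothesis sd : semi_inner d.

Lemma hnorm_eq0_real (x : V) : hnorm d x = 0 -> d x x = 0.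
Proof. by move=> h; rewrite (semi_self sd) -(hnorm_sqr sd) h expr0n. Qed.

Lemma cexp_quotient (l : C) : Num.sqrt (sqabs ((h^-1)%:C%C * (cexp l h - 1) - l))
  @[h --> 0^'+] --> (0 : R).
Proof.
have hr := cvg_quotient_derive (is_derive_Re_cexp l 0).
have hi := cvg_quotient_derive (is_derive_Im_cexp l 0).
rewrite -[X in _ --> X]sqrtr0; apply: continuous_cvg; first exact: sqrt_continuous.
rewrite [X in _ --> X](_ : 0 = (complex.Re l - complex.Re l) ^+ 2 + (complex.Im l - complex.Im l) ^+ 2);
  last by rewrite !subrr expr0n addr0.
rewrite cexp0r !mulr1 in hr hi.
have -> : (fun h => sqabs ((h^-1)%:C%C * (cexp l h - 1) - l)) =
  (fun h => (h^-1 * (complex.Re (cexp l (h + 0)) - complex.Re (1 : C)) - complex.Re l) ^+ 2 +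
            (h^-1 * (complex.Im (cexp l (h + 0)) - complex.Im (1 : C)) - complex.Im l) ^+ 2).
  by apply/funext => h; rewrite /sqabs !cReD !cImD !cReN !cImN !cReM !cImM !cReD !cImD !cReN !cImN addr0 /=; ring.
have sub (f : R -> R) (a : R) : f h @[h --> 0^'+] --> a -> (f h - a) ^+ 2 @[h --> 0^'+] --> (a - a) ^+ 2.
  by move=> fa; rewrite !expr2; apply: cvgM; apply: cvgB => //; exact: cvg_cst.
have h1 := sub _ _ hr; have h2 := sub _ _ hi. exact: (cvgD h1 h2).
Qed.

Lemma semigroupB (S : R -> V -> V) t : contraction_semigroup d S -> 0 <= t ->
  forall u v, S t (u - v) = S t u - S t v.
Proof.
by move=> cS t0 u v; have := csg_linear cS t0 (-1) v u; rewrite !scaleN1r ![- _ + _]addrC.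
Qed.

Lemma semigroup0 (S : R -> V -> V) t : contraction_semigroup d S -> 0 <= t -> S t 0 = 0.
Proof. by move=> cS t0; have := semigroupB cS t0 0 0; rewrite !subrr. Qed.

(* With [c = cexp l h], nonexpansiveness of S and [|c| <= 1] give
   [|S (k h) x - c ^ k x| <= k |S h x - c x|], and the right-hand side is [o(1)]
   for [h = t / k]. *)
Lemma semigroup_eigenvector (S : R -> V -> V) (l : C) (x : V) :
  (forall y, d y y = 0 -> y = 0) ->
  contraction_semigroup d S -> complex.Re l <= 0 ->
  hnorm d ((h^-1)%:C%C *: (S h x - x) - l *: x) @[h --> 0^'+] --> (0 : R) ->
  forall t, 0 <= t -> S t x = cexp l t *: x.
Proof.
move=> dd cS l0 Sx t; rewrite le_eqVlt => /predU1P[<-|t0].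
  by rewrite (csg0 cS) cexp0r scale1r.
pose r h := hnorm d ((h^-1)%:C%C *: (S h x - cexp l h *: x)).
have r0 : r h @[h --> 0^'+] --> (0 : R).
  apply: (@squeeze_cvgr _ _ _ _ (fun=> 0) (fun h => hnorm d ((h^-1)%:C%C *: (S h x - x) - l *: x) +
     Num.sqrt (sqabs ((h^-1)%:C%C * (cexp l h - 1) - l)) * hnorm d x)).
  - apply: nearW => h; rewrite hnorm_ge0/= -(hnormZ sd) -(hnormN sd (_ *: x)).
    rewrite (_ : r h = hnorm d (((h^-1)%:C%C *: (S h x - x) - l *: x) +
      - (((h^-1)%:C%C * (cexp l h - 1) - l) *: x))); first exact: hnormD.
    rewrite /r; congr hnorm.
    rewrite scalerBl -scalerA opprB addrA subrK -scalerBr.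
    by congr (_ *: _); rewrite scalerBl scale1r opprB addrA subrK.
  - exact: cvg_cst.
  - rewrite -[X in _ --> X]addr0 -[X in _ --> 0 + X](mul0r (hnorm d x)).
    exact: (cvgD Sx (cvgM (cexp_quotient l) (cvg_cst _))).
have SZ s a u : 0 <= s -> S s (a *: u) = a *: S s u.
  by move=> s0; have := csg_linear cS s0 a u 0; rewrite (semigroup0 cS s0) !addr0.
(* The induction compares both sides with the intermediate vector e^{l k h} S h x, which is also the
   image under S h of e^{l k h} x. *)
have step h k : 0 < h -> hnorm d (S (h *+ k) x - cexp l (h *+ k) *: x) <= (h *+ k) * r h.
  move=> h0; have h1 := ltW h0; have hE : hnorm d (S h x - cexp l h *: x) = h * r h.
    rewrite /r (hnormZ sd) mulrA sqabs_real sqrtr_sqr ger0_norm ?invr_ge0 ?ltW//.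
    by rewrite divff ?mul1r// gt_eqF.
  elim: k => [|k IH]; first by rewrite !mulr0n (csg0 cS) cexp0r scale1r subrr (hnorm0 sd) mul0r.
  rewrite mulrS (csgD cS h1 (mulrn_wge0 k h1)) cexpDr.
  apply: le_trans (hnormB_trans sd _ (cexp l (h *+ k) *: S h x) _) _.
  rewrite -(SZ _ _ _ h1) -(semigroupB cS h1) [_ * r h]mulrDl addrC; apply: lerD.
    rewrite (SZ _ _ _ h1) [cexp l h * _]mulrC -scalerA -scalerBr (hnormZ sd) hE ler_piMl//.
      by rewrite -hE hnorm_ge0.
    rewrite -sqrtr1 ler_wsqrtr// sqabs_cexp -expR0 ler_expR.
    by rewrite mulr_le0_ge0 ?mulr_ge0_le0 ?mulrn_wge0.
  exact: le_trans (csg_contr cS h1 _) IH.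
apply/eqP; rewrite -subr_eq0; apply/eqP/dd/hnorm_eq0_real/eqP.
rewrite eq_le hnorm_ge0 andbT; apply/ler_addgt0Pr => e e0; rewrite add0r.
have /cvgrPdist_lt /(_ _ (divr_gt0 e0 t0)) [q /= q0 hq] := r0.
(* With this many steps the length t / n is below q, where r < e / t, so the accumulated error t r
   (t / n) stays below e. *)
pose n := (Num.bound (t / q)).+1.
have n0 : 0 < n%:R :> R by rewrite ltr0n.
have tn : 0 < t / n%:R by rewrite divr_gt0.
have := step _ n tn.
have -> : (t / n%:R) *+ n = t by rewrite -[LHS]mulr_natr divfK ?gt_eqF.
move=> /le_trans; apply; rewrite mulrC -ler_pdivlMr//.
have := hq (t / n%:R); rewrite /= !sub0r !normrN !ger0_norm ?hnorm_ge0 ?(ltW tn)//.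
move=> h; apply/ltW/h => //; rewrite ltr_pdivrMr// mulrC -ltr_pdivrMr//.
apply: (lt_le_trans (archi_boundP _)); first by rewrite divr_ge0 ?(ltW t0) ?(ltW q0).
by rewrite ler_nat.
Qed.

End Semigroup.

(** * Exponential decay and optimality of the rate *)

Section Decay.
Context {R : realType}.
Local Notation C := R[i].
Context {V : lmodType C} (d dE : V -> V -> C).
Hypothesis (sd : semi_inner d) (sE : semi_inner dE).
Variables (Psi : int -> V) (B : set V).
Local Notation W := (closed_span d (range Psi)).
Local Notation W0 := (closed_span d B).
Variables M1 M2 : R.
Hypothesis d_definite : forall x, d x x = 0 -> x = 0.
Hypothesis le_dE : forall x, W x -> hnorm d x <= M1 * hnorm dE x.
Hypothesis dE_le : forall x, W x -> hnorm dE x <= M2 * hnorm d x.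
Hypothesis dE_orthonormal : forall m n, dE (Psi m) (Psi n) = (m == n)%:R.
Hypothesis W_orthogonal : orthogonal_sets d W W0.
Variables (S : R -> V -> V) (l : int -> C) (s : R).
Hypothesis cS : contraction_semigroup d S.
Hypothesis Re_l : forall n, complex.Re (l n) = s.
Hypothesis S_Psi : forall t n, 0 <= t -> S t (Psi n) = cexp (l n) t *: Psi n.

Lemma span_semigroup t x : 0 <= t -> lin_span (range Psi) x -> lin_span (range Psi) (S t x).
Proof.
move=> t0; move: x; apply: lin_span_ind => /=.
  rewrite /= (semigroup0 cS)//; exists 0%N, (fun=> 0), (fun=> 0).
  by split; [case|rewrite big_ord0].
move=> a x y [n _ <-] yS; rewrite /= (csg_linear cS t0) S_Psi// scalerA.
by apply: lin_span_lin => //; apply: lin_span_sub; exists n.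
Qed.

(** Off the diagonal both sides vanish by orthonormality; on the diagonal the factor is |e^{l_n
    t}|^2, the same for all n since the real parts agree. Thus e^{- s t} S t is isometric for [dE]
    on the span. *)
Lemma dE_semigroup t x y : 0 <= t -> lin_span (range Psi) x -> lin_span (range Psi) y ->
  dE (S t x) (S t y) = (expR (2 * s * t))%:C%C * dE x y.
Proof.
move=> t0 + yS; move: x; apply: lin_span_ind => /=.
  by rewrite /= (semigroup0 cS)// !semi0l// mulr0.
move=> a x z [m _ <-] /= zS; rewrite (csg_linear cS t0) !(semi_lin sE) zS mulrDr mulrCA.
congr (a * _ + _); rewrite [LHS](semi_herm sE) [dE _ y](semi_herm sE).
rewrite -[_%:C%C]conjc_real -rmorphM; congr (_^* )%R.
move: y yS {x z zS}; apply: lin_span_ind => /=.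
  by rewrite /= (semigroup0 cS)// !semi0l// mulr0.
move=> b u z [n _ <-] /= zS; rewrite (csg_linear cS t0) !(semi_lin sE) zS mulrDr mulrCA.
congr (b * _ + _); rewrite !S_Psi// semiZl// semiZr// dE_orthonormal.
have [->|_] := eqVneq n m; last by rewrite !mulr0.
by rewrite !mulr1 -sqabsE sqabs_cexp Re_l.
Qed.

(** On the span the two norm comparisons surround the isometry property of [dE]; the passage to the
    closure uses only that S t is a contraction for d. *)
Lemma hnorm_semigroup_le t x : 0 <= t -> W x ->
  hnorm d (S t x) <= (`|M1| * `|M2| + 1) * expR (s * t) * hnorm d x.
Proof.
move=> t0 xW; set M := (X in X * _ * _).
have M0 : 0 < M by rewrite ltr_wpDl ?mulr_ge0.
have Me : 0 <= M * expR (s * t) by rewrite mulr_ge0 ?expR_ge0// ltW.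
have spanM y : lin_span (range Psi) y -> hnorm d (S t y) <= M * expR (s * t) * hnorm d y.
  move=> yS; apply: le_trans (le_dE (closed_span_lin_span sd (span_semigroup t0 yS))) _.
  have -> : hnorm dE (S t y) = expR (s * t) * hnorm dE y.
    rewrite /hnorm dE_semigroup// cReM /= mul0r subr0 sqrtrM ?expR_ge0//.
    rewrite -mulrA [2 * _]mulrC mulrDr mulr1 expRD -expr2 sqrtr_sqr ger0_norm ?expR_ge0//.
  have h := dE_le (closed_span_lin_span sd yS).
  apply: le_trans (_ : `|M1| * (expR (s * t) * (`|M2| * hnorm d y)) <= _).
    apply: (@le_trans _ _ (`|M1| * (expR (s * t) * hnorm dE y))).
      by rewrite ler_wpM2r ?mulr_ge0 ?expR_ge0 ?hnorm_ge0// ler_norm.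
    rewrite ler_wpM2l// ler_wpM2l ?expR_ge0//; apply: le_trans h _.
    by rewrite ler_wpM2r ?hnorm_ge0// ler_norm.
  rewrite (_ : _ * _ = `|M1| * `|M2| * expR (s * t) * hnorm d y); last by ring.
  by rewrite !ler_wpM2r ?hnorm_ge0 ?expR_ge0// lerDl.
apply/ler_addgt0Pr => e e0.
(* The error x - y is counted once through the contraction and once, with factor M e^{s t}, when the
   norm of y is replaced by that of x. *)
have q0 : 0 < 1 + M * expR (s * t) by rewrite ltr_wpDr.
have [y yS xy] := xW _ (divr_gt0 e0 q0).
have -> : S t x = S t (x - y) + S t y by rewrite (semigroupB cS)// subrK.
apply: le_trans (hnormD sd _ _) _.
have h1 := csg_contr cS t0 (x - y).
have h2 : hnorm d y <= hnorm d x + hnorm d (x - y).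
  by have := hnormB_trans sd y x 0; rewrite !subr0 (hnormBC sd y x) addrC.
move: xy; rewrite ltr_pdivlMr// => xy.
apply: le_trans (lerD h1 (spanM _ yS)) _.
have := ler_wpM2l Me h2; lra.
Qed.

Theorem decays_at_common_rate : decays_at_rate d S W W0 s.
Proof.
exists (`|M1| * `|M2| + 1); first by rewrite ltr_wpDl ?mulr_ge0.
move=> x p [a [b [aW bW0 ->]]] [pW0 pP] t t0.
(* Since b - p = (a + b - p) - a lies in W0 and both terms on the right are orthogonal to W0, it is
   orthogonal to itself. *)
have bp : b - p = 0.
  have bpW : W0 (b - p) by exact: closed_spanB.
  apply: d_definite; rewrite -[X in d X _](addKr a) addrC addrA semiBl//.
  by rewrite (W_orthogonal aW bpW) subr0 pP.
have -> : a + b - p = a by rewrite -addrA bp addr0.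
have -> : S t (a + b) - S t p = S t a.
  by rewrite -(semigroupB cS)// -addrA bp addr0.
exact: hnorm_semigroup_le.
Qed.

(** A single eigenvector, whose projection on W0 is 0, already decays exactly like e^{s t}. *)
Theorem decay_rate_optimal omega : decays_at_rate d S W W0 omega -> s <= omega.
Proof.
move=> [M M0 h].
have P0 : W (Psi 0) by apply: closed_span_sub => //; exists 0.
have W00 : W0 0 by exact: closed_span0.
have nP : 0 < hnorm d (Psi 0).
  rewrite lt_def hnorm_ge0 andbT; apply/eqP => /(hnorm_eq0_real sd)/d_definite P00.
  by have := dE_orthonormal 0 0; rewrite P00 semi0l// => /eqP; rewrite eq_sym oner_eq0.
have {h} h t : 0 <= t -> expR (s * t) <= M * expR (omega * t).
  move=> t0; have := h (Psi 0) 0 _ _ t t0.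
  rewrite (semigroup0 cS)// !subr0 S_Psi// hnormZ// sqabs_cexp Re_l.
  rewrite -mulrA [2 * _]mulrC mulrDr mulr1 expRD -expr2 sqrtr_sqr ger0_norm ?expR_ge0//.
  rewrite ler_pM2r//; apply; first by exists (Psi 0), 0; rewrite addr0.
  by split=> // w wW; rewrite subr0; exact: W_orthogonal.
rewrite leNgt; apply/negP => so; have so0 : 0 < s - omega by rewrite subr_gt0.
(* At this time the estimate would read e^M <= M, against 1 + M <= e^M. *)
have := h (M / (s - omega)) (divr_ge0 (ltW M0) (ltW so0)).
rewrite -ler_pdivrMr ?expR_gt0// -expRN -expRD -mulrBl [(_ - _) * _]mulrC divfK ?gt_eqF//.
by move=> /(le_trans (expR_ge1Dx M)); rewrite gerDr ler10.
Qed.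

End Decay.

(** * Test functions *)

Section Smooth.
Context {R : realType}.
Implicit Types f g : R -> R.

Record smooth f : Prop := Smooth { derivable_smooth : forall n x, derivable (derive1n n f) x 1 }.
Arguments derivable_smooth {f} _ _ _.

Lemma is_derive_derive1 f g : (forall x : R, is_derive x 1 f (g x)) -> derive1 f = g.
Proof.
by move=> fg; apply/funext => x; rewrite derive1E; have [_ ->] := fg x.
Qed.

(** A coinduction principle: a family closed under differentiation consists of smooth functions. It
    replaces closed formulas for iterated derivatives by the choice of a suitable family. *)
Lemma smooth_coind (F : set (R -> R)) :
  (forall f, F f -> exists2 g, F g & forall x : R, is_derive x 1 f (g x)) ->
  forall f, F f -> smooth f.
Proof.
move=> Fd f Ff; split=> n x; have : F (derive1n n f).
  elim: n => [//|n IH]; rewrite derive1nS.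
  by have [g Fg fg] := Fd _ IH; rewrite (is_derive_derive1 fg).
by move=> /Fd[g _ /(_ x)[]].
Qed.

Lemma smooth_is_derive f : smooth f -> forall x : R, is_derive x 1 f (derive1 f x).
Proof. move=> sf x; rewrite derive1E; apply: derivableP; exact: (derivable_smooth sf 0%N x). Qed.

Lemma smooth_derive f : smooth f -> smooth (derive1 f).
Proof. by move=> sf; split=> n x; have := derivable_smooth sf n.+1 x; rewrite /derive1n iterSr. Qed.

Lemma smooth_continuous f : smooth f -> continuous f.
Proof.
by move=> sf x; apply/differentiable_continuous/derivable1_diffP; exact: (derivable_smooth sf 0%N x).
Qed.

(** Products of two smooth functions are not closed under differentiation, but finite sums of them
    are, by the Leibniz rule. *)
Inductive sums_of_products : (R -> R) -> Prop :=
| ProductSmooth f g : smooth f -> smooth g -> sums_of_products (fun x => f x * g x)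
| SumProducts f g : sums_of_products f -> sums_of_products g ->
    sums_of_products (fun x => f x + g x).

Lemma sums_of_products_smooth f : sums_of_products f -> smooth f.
Proof.
move: f; apply: smooth_coind => h0 /= h; elim: h => {h0} [f g sf sg|f g _ [f' Ff ff'] _ [g' Fg gg']].
  exists (fun x => derive1 f x * g x + f x * derive1 g x).
    by apply: SumProducts; apply: ProductSmooth => //; [exact: (smooth_derive sf)|exact: (smooth_derive sg)].
  move=> x; have df := smooth_is_derive sf x; have dg := smooth_is_derive sg x.
  apply: is_derive_eq; rewrite /GRing.scale /=; ring.
exists (fun x => f' x + g' x); first exact: SumProducts.
by move=> x; have df := ff' x; have dg := gg' x; exact: is_deriveD.
Qed.

Lemma smoothM f g : smooth f -> smooth g -> smooth (fun x => f x * g x).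
Proof. by move=> sf sg; exact/sums_of_products_smooth/ProductSmooth. Qed.

Lemma smooth_cst c : smooth (cst c).
Proof.
refine (@smooth_coind (range cst) _ _ _); last by exists c.
by move=> _ [a _ <-]; exists (cst 0); [exists 0|move=> x; exact: is_derive_cst].
Qed.

Lemma smoothD f g : smooth f -> smooth g -> smooth (fun x => f x + g x).
Proof.
move=> sf sg; apply: sums_of_products_smooth.
have -> : (fun x => f x + g x) = (fun x => cst 1 x * f x + cst 1 x * g x).
  by apply/funext => x; rewrite !mul1r.
exact: (SumProducts (ProductSmooth (smooth_cst 1) sf) (ProductSmooth (smooth_cst 1) sg)).
Qed.

Lemma smooth_affine f a b : smooth f -> smooth (fun x => f (a * x + b)).
Proof.
(* The prefactor c absorbs the factor a produced by each application of the chain rule. *)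
move=> sf; refine (@smooth_coind [set h | exists c g, smooth g /\ h = fun x => c * g (a * x + b)] _ _ _).
  move=> _ [c [g [sg ->]]]; exists (fun x => c * a * derive1 g (a * x + b)).
    by rewrite /=; exists (c * a), (derive1 g); split=> //; exact: (smooth_derive sg).
  move=> x; have dg := smooth_is_derive sg (a * x + b).
  have da : is_derive x 1 (fun x => a * x + b) a.
    by apply: is_derive_eq; rewrite /GRing.scale /=; ring.
  have dc := @is_derive1_comp _ g (fun x => a * x + b) x _ _ dg da.
  by apply: is_derive_eq; rewrite /GRing.scale /=; ring.
by exists 1, f; split=> //; apply/funext => x; rewrite mul1r.
Qed.

Lemma smooth_Re_cexp_mul (c l : R[i]) : smooth (fun x => complex.Re (c * cexp l x)).
Proof.
(* Differentiation acts on this family by replacing c with c l. *)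
refine (@smooth_coind (range (fun c x => complex.Re (c * cexp l x))) _ _ _); last by exists c.
move=> _ {c} [c _ <-]; exists (fun x => complex.Re (c * l * cexp l x)); first by exists (c * l).
move=> x; have dr := is_derive_Re_cexp l x; have di := is_derive_Im_cexp l x.
under eq_fun do rewrite cReM; apply: is_derive_eq.
by rewrite -mulrA [in RHS]cReM /GRing.scale /=; ring.
Qed.

Lemma smooth_Re_cexp l : smooth (fun x => complex.Re (cexp l x)).
Proof.
by have := smooth_Re_cexp_mul 1 l; congr smooth; apply/funext => x; rewrite mul1r.
Qed.

Lemma smooth_Im_cexp l : smooth (fun x => complex.Im (cexp l x)).
Proof.
have := smooth_Re_cexp_mul (Complex 0 (-1)) l.
by congr smooth; apply/funext => x; rewrite cReM /=; ring.
Qed.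

End Smooth.

(** * Bump functions *)

Section Bump.
Context {R : realType}.

(** The classical flat function e^{-1/x}, with a polynomial in 1/x in front so that the family is
    closed under differentiation: p becomes X^2 (p - p'). *)
Definition poly_exp_inv (p : {poly R}) (x : R) : R :=
  if 0 < x then p.[x^-1] * expR (- x^-1) else 0.

Lemma poly_bound (p : {poly R}) : exists n K, 0 <= K /\
  forall y, 1 <= y -> `|p.[y]| <= K * y ^+ n.
Proof.
elim/poly_ind: p => [|p c [n [K [K0 h]]]].
  by exists 0%N, 0; split=> // y _; rewrite horner0 normr0 mul0r.
exists n.+1, (K + `|c|); split=> [|y y1]; first by rewrite addr_ge0.
have y0 : 0 <= y by apply: le_trans y1.
rewrite hornerMXaddC (le_trans (ler_normD _ _))// mulrDl; apply: lerD.
  by rewrite normrM (ger0_norm y0) exprSr mulrA ler_wpM2r// h.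
by rewrite ler_peMr// exprn_ege1.
Qed.

(** A quadratic bound to the right of 0 is what makes the derivative at 0 exist and vanish, the only
    point where the family needs an estimate. *)
Lemma poly_exp_inv_bound (p : {poly R}) : exists2 K, 0 <= K &
  forall x, 0 < x <= 1 -> `|poly_exp_inv p x| <= K * x ^+ 2.
Proof.
have [n [K [K0 h]]] := poly_bound p.
exists (K * n.+2%:R ^+ n.+2); first by rewrite mulr_ge0// exprn_ge0.
move=> x /andP[x0 x1]; rewrite /poly_exp_inv x0.
set y := x^-1; have y1 : 1 <= y by rewrite -invr1 lef_pV2 ?posrE.
have y0 : 0 < y by rewrite invr_gt0.
have xE : x = y^-1 by rewrite invrK.
have N0 : 0 < n.+2%:R :> R by rewrite ltr0n.
(* From u <= e^u at u = y / (n + 2), raised to the power n + 2: two degrees more than p, which leave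
   the factor x^2. *)
have e1 : (y / n.+2%:R) ^+ n.+2 <= expR y.
  have -> : expR y = expR (y / n.+2%:R) ^+ n.+2.
    by rewrite -expRM_natl mulrC divfK ?gt_eqF.
  rewrite lerXn2r ?nnegrE ?expR_ge0 ?divr_ge0 ?(ltW y0) ?(ltW N0)//.
  by apply: le_trans (expR_ge1Dx _); rewrite lerDr.
rewrite normrM [X in _ * X]ger0_norm ?expR_ge0// expRN.
rewrite ler_pdivrMr ?expR_gt0//.
apply: le_trans (h _ y1) _; rewrite -mulrA -mulrA ler_wpM2l//.
apply: le_trans (_ : n.+2%:R ^+ n.+2 * (x ^+ 2 * (y / n.+2%:R) ^+ n.+2) <= _).
  rewrite expr_div_n xE; set N := n.+2%:R ^+ n.+2.
  have N1 : N != 0 by rewrite expf_neq0// gt_eqF.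
  rewrite (_ : N * _ = y ^+ n)//.
  rewrite mulrCA [N * _]mulrC divfK// exprVn -[n.+2]addn2 exprD mulrCA.
  by rewrite mulVf ?mulr1// expf_neq0// gt_eqF.
by rewrite -[leRHS]mulrA ler_wpM2l ?exprn_ge0// ler_wpM2l// exprn_ge0// ltW.
Qed.

Lemma is_derive_quadratic_bound (f : R -> R) (K : R) :
  (forall x, `|x| <= 1 -> `|f x| <= K * x ^+ 2) -> is_derive 0 (1 : R) f 0.
Proof.
move=> fK; have f0 : f 0 = 0.
  by apply/eqP; rewrite -normr_le0 (le_trans (fK 0 _)) ?normr0// expr0n mulr0.
have h : h^-1 *: ((f \o shift 0) (h *: (1 : R)) - f 0) @[h --> 0^'] --> (0 : R).
  apply/cvgrPdist_le => e e0; near=> h.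
  rewrite /= f0 subr0 sub0r normrN addr0 [h%:A]mulr1 normrZ normfV.
  have h0 : h != 0 by near: h; exact: nbhs_dnbhs_neq.
  rewrite ler_pdivrMl ?normr_gt0//.
  have K0 : 0 < `|K| + 1 by rewrite ltr_wpDl.
  have h1 : `|h| <= 1.
    by near: h; apply: dnbhs0_le; rewrite ltr01.
  have h2 : `|h| <= e / (`|K| + 1).
    by near: h; apply: dnbhs0_le; rewrite divr_gt0.
  apply: le_trans (fK _ h1) _.
  rewrite -[h ^+ 2]real_normK ?num_real// expr2 mulrCA ler_wpM2l//.
  move: h2; rewrite ler_pdivlMr// => h2; apply: le_trans h2; rewrite mulrC ler_wpM2l//.
  by rewrite (le_trans (ler_norm _))// lerDl.
by split; [apply/cvg_ex; exists 0|exact: cvg_lim h].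
Unshelve. all: by end_near. Qed.

Lemma smooth_poly_exp_inv (p : {poly R}) : smooth (poly_exp_inv p).
Proof.
refine (@smooth_coind _ (range poly_exp_inv) _ _ _); last by exists p.
move=> _ {p} [p _ <-]; exists (poly_exp_inv ('X^2 * (p - p^`()))); first by exists ('X^2 * (p - p^`())).
move=> x; rewrite {2}/poly_exp_inv; have [x0|x0|<-] := ltgtP 0 x.
- have nx : x != 0 by rewrite gt_eqF.
  have dV : is_derive x 1 (fun x : R => x^-1) (- x ^- 2).
    have := @is_deriveV _ id x 1 1 nx (is_derive_id _ _).
    by rewrite /GRing.scale /= mulr1.
  have dp := is_derive_poly p x^-1.
  have dc := @is_derive1_comp _ (horner p) (fun x => x^-1) x _ _ dp dV.
  have df : is_derive x 1 (fun x : R => p.[x^-1] * expR (- x^-1))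
      (('X^2 * (p - p^`())).[x^-1] * expR (- x^-1)).
    by apply: is_derive_eq; rewrite /GRing.scale /= !hornerE /= exprVn; ring.
  apply: near_eq_is_derive df; near=> y.
  by rewrite /poly_exp_inv ifT//; near: y; exact: lt_nbhsr.
- have df : is_derive x 1 (cst (0 : R)) 0 := is_derive_cst _ _ _.
  apply: near_eq_is_derive df; near=> y; rewrite /poly_exp_inv ifF//.
  by apply/negbTE; rewrite -leNgt ltW//; near: y; exact: lt_nbhsl.
- have [K K0 h] := poly_exp_inv_bound p; apply: (@is_derive_quadratic_bound _ K) => x1 hx.
  rewrite /poly_exp_inv; case: ifPn => x0; last by rewrite normr0 mulr_ge0 ?sqr_ge0.
  have := h x1; rewrite /poly_exp_inv x0; apply.
  by move: hx; rewrite ger0_norm// ltW.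
Unshelve. all: by end_near. Qed.

(** The parameter k steepens the two flanks: the functions stay between 0 and 1 and converge to 1 on
    ]a, b[, so dominated convergence recovers plain integrals over ]a, b[. *)
Definition bump (k : nat) (a b x : R) : R :=
  poly_exp_inv 1 (k.+1%:R * (x - a)) * poly_exp_inv 1 (k.+1%:R * (b - x)).

Lemma smooth_bump k a b : smooth (bump k a b).
Proof.
apply: smoothM.
  have := smooth_affine k.+1%:R (- k.+1%:R * a) (smooth_poly_exp_inv 1).
  by congr smooth; apply/funext => x; congr poly_exp_inv; ring.
have := smooth_affine (- k.+1%:R) (k.+1%:R * b) (smooth_poly_exp_inv 1).
by congr smooth; apply/funext => x; congr poly_exp_inv; ring.
Qed.

Lemma poly_exp_inv1_ge0 x : 0 <= poly_exp_inv 1 x.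
Proof. by rewrite /poly_exp_inv hornerC mul1r; case: ifP => // _; exact: expR_ge0. Qed.

Lemma poly_exp_inv1_le1 x : poly_exp_inv 1 x <= 1.
Proof.
rewrite /poly_exp_inv hornerC mul1r; case: ifP => // x0.
by rewrite -expR0 ler_expR oppr_le0 invr_ge0 ltW.
Qed.

Lemma bump_ge0 k a b x : 0 <= bump k a b x.
Proof. by rewrite mulr_ge0 ?poly_exp_inv1_ge0. Qed.

Lemma bump_le1 k a b x : bump k a b x <= 1.
Proof. by rewrite mulr_ile1 ?poly_exp_inv1_ge0 ?poly_exp_inv1_le1. Qed.

Lemma bump_out k a b x : ~~ (a < x < b) -> bump k a b x = 0.
Proof.
rewrite negb_and -!leNgt /bump /poly_exp_inv => /orP[xa|bx].
  by rewrite ifF ?mul0r// pmulr_rgt0// subr_gt0 ltNge xa.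
by rewrite mulrC ifF ?mul0r// pmulr_rgt0// subr_gt0 ltNge bx.
Qed.

Lemma cvg_poly_exp_inv1 (y : R) : 0 < y ->
  poly_exp_inv 1 (k.+1%:R * y) @[k --> \oo] --> (1 : R).
Proof.
move=> y0; rewrite /poly_exp_inv.
have -> : (fun k => if 0 < k.+1%:R * y then (1%:P).[(k.+1%:R * y)^-1] * expR (- (k.+1%:R * y)^-1) else 0)
  = (fun k => expR (- (y^-1 * k.+1%:R^-1))).
  by apply/funext => k; rewrite ifT ?mulr_gt0// hornerC mul1r invfM mulrC.
rewrite [X in _ --> X](_ : 1 = expR (- (y^-1 * 0))); last by rewrite mulr0 oppr0 expR0.
apply: continuous_cvg; first exact: continuous_expR.
by apply: cvgN; apply: cvgM; [exact: cvg_cst|exact: cvg_harmonic].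
Qed.

Lemma cvg_bump a b x : a < x < b -> bump k a b x @[k --> \oo] --> (1 : R).
Proof.
move=> /andP[ax xb]; rewrite -[X in _ --> X]mulr1.
by apply: cvgM; apply: cvg_poly_exp_inv1; rewrite subr_gt0.
Qed.

End Bump.

(** * Locally integrable functions with vanishing integrals *)

Section LocallyIntegrable.
Context {R : realType}.
Local Notation T := (measurableTypeR R).
Local Notation mu := (@lebesgue_measure R).
Implicit Types (I : set R) (f g phi : R -> R) (a b : R).

Definition locally_integrable_on I f :=
  forall a b, `[a, b] `<=` I -> mu.-integrable `[a, b] (EFin \o f).

Lemma Rintegral_support I J f : J `<=` I -> (forall x, ~ J x -> f x = 0) ->
  \int[mu]_(x in I) f x = \int[mu]_(x in J) f x.
Proof.
move=> JI f0; rewrite [LHS]Rintegral_mkcond [RHS]Rintegral_mkcond.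
congr Rintegral; apply/funext => x; rewrite !patchE; case: ifPn => [xI|].
  by case: ifPn => //; rewrite notin_setE => /f0.
rewrite notin_setE => xI; case: ifPn => //; rewrite inE => /JI //.
Qed.

Lemma Rdominated_cvg I (f_ : nat -> R -> R) f g : measurable (I : set T) ->
  (forall n, measurable_fun (I : set T) (f_ n)) -> measurable_fun (I : set T) f ->
  (forall x, I x -> f_ n x @[n --> \oo] --> f x) ->
  mu.-integrable I (EFin \o g) -> (forall n x, I x -> `|f_ n x| <= g x) ->
  \int[mu]_(x in I) f_ n x @[n --> \oo] --> \int[mu]_(x in I) f x.
Proof.
move=> mI mf_ mf fcvg ig fg.
have [] := @dominated_convergence _ _ R mu I mI (fun n => EFin \o f_ n) (EFin \o f) (EFin \o g).
- by move=> n; exact/measurable_EFinP.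
- exact/measurable_EFinP.
- by apply: aeW => x Ix; apply: cvg_comp (fcvg x Ix) _; exact: cvg_id.
- exact: ig.
- by apply: aeW => x n Ix /=; rewrite lee_fin fg.
move=> fi _ h.
have fin : ((\int[mu]_(x in I) (EFin \o f) x)%E \is a fin_num) by exact: integrable_fin_num.
by apply: fine_cvg; rewrite fineK.
Qed.

Lemma integrableM_continuous f phi a b : continuous phi ->
  mu.-integrable `[a, b] (EFin \o f) ->
  mu.-integrable `[a, b] (EFin \o (fun x => f x * phi x)).
Proof.
move=> cphi fi; apply: (@integrableMl _ _ _ mu `[a, b] _ (EFin \o f) phi) => //.
  by apply: measurable_funTS; exact: continuous_measurable_fun.
have := @continuous_compact _ _ phi `[a, b].
move=> /(_ (continuous_subspaceT cphi) (@segment_compact R a b)) /compact_bounded.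
move=> [M [Mr Mh]]; exists M; split => // x Mx y /= yab; apply: Mh => //; exists y => //.
Qed.

Lemma integrable_itv_continuous phi a b : continuous phi ->
  mu.-integrable `[a, b] (EFin \o phi).
Proof.
move=> cphi; apply: continuous_compact_integrable; first exact: segment_compact.
exact: continuous_subspaceT.
Qed.

Lemma locally_integrable_on_sub I a b f : locally_integrable_on I f -> `[a, b] `<=` I ->
  mu.-integrable `]a, b[ (EFin \o f).
Proof. by move=> fI /fI; apply: integrableS => //; exact: subset_itv_oo_cc. Qed.

Lemma Rintegral_bump0 I f a b : measurable (I : set T) -> locally_integrable_on I f ->
  `[a, b] `<=` I -> (forall k, \int[mu]_(x in I) (f x * bump k a b x) = 0) ->
  \int[mu]_(x in `]a, b[) f x = 0.
Proof.
move=> mI fI abI f0; have fab := locally_integrable_on_sub fI abI.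
have mf : measurable_fun (`]a, b[ : set T) f.
  by move: fab => /measurable_int/measurable_EFinP.
have h := @Rdominated_cvg `]a, b[ (fun k x => f x * bump k a b x) f (fun x => `|f x|).
apply: (cvg_unique _ (h _ _ _ _ _ _)) => //.
- move=> n; apply: measurable_funM => //; apply: measurable_funTS.
  by apply: continuous_measurable_fun; apply: smooth_continuous; exact: smooth_bump.
- move=> x; rewrite /= in_itv /= => xab; rewrite -[X in _ --> X]mulr1.
  by apply: cvgM; [exact: cvg_cst|exact: cvg_bump].
- exact: (integrable_abse fab).
- move=> n x _; rewrite normrM ler_piMr//.
  by rewrite ger0_norm ?bump_ge0 ?bump_le1.
rewrite (_ : (fun n => _) = cst 0); first exact: cvg_cst.
apply/funext => k; rewrite -[RHS](f0 k); apply/esym/Rintegral_support.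
  by apply: subset_trans abI; exact: subset_itv_oo_cc.
by move=> x /negP; rewrite in_itv /= => xab; rewrite bump_out// mulr0.
Qed.

(** The primitive of f from a vanishes on ]a, b[, and almost everywhere its derivative is f by
    Lebesgue differentiation. *)
Lemma ae0_of_Rintegral0 I f a b : locally_integrable_on I f ->
  `[a, b] `<=` I ->
  (forall c d, `[c, d] `<=` I -> \int[mu]_(x in `]c, d[) f x = 0) ->
  {ae mu, forall x, x \in `]a, b[ -> f x = 0}.
Proof.
move=> fI abI f0; pose g := f \_ `[a, b].
have gi : mu.-integrable setT (EFin \o g).
  rewrite -restrict_EFin; apply/integrable_restrict => //; rewrite setTI; exact: fI.
have gl : locally_integrable [set: R] g.
  by apply: open_integrable_locally; [exact: openT|exact: gi].
have giS (J : interval R) : mu.-integrable [set` J] (EFin \o g).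
  by apply: integrableS gi => //; exact: measurableT.
have := @FTC1 R g (BRight a) (fun y => giS _) gl.
apply: filterS => x h; rewrite in_itv /= => /andP[ax xb].
have [dF] := h ax.
have -> : g x = f x by rewrite /g patchE ifT// inE /= in_itv /= !ltW.
move=> <-; rewrite derive1E.
rewrite (near_eq_derive (g := cst 0)) ?derive_cst//; near=> y.
have ya : a < y by near: y; exact: lt_nbhsr.
have yb : y < b by near: y; exact: lt_nbhsl.
rewrite /= -[RHS](f0 a y); last first.
  by apply: subset_trans abI => z /=; rewrite !in_itv /= => /andP[-> zy]/=; apply: le_trans zy (ltW yb).
rewrite -Rintegral_itv_bndo_bndc; last exact: giS.
apply: eq_Rintegral => z; rewrite inE /= in_itv /= => /andP[az zy].
by rewrite /g patchE ifT// inE /= in_itv /= !ltW// (lt_trans zy).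
Unshelve. all: by end_near. Qed.

End LocallyIntegrable.

(** * The fundamental lemma of the calculus of variations and the du Bois-Reymond lemma *)

Section FundamentalLemma.
Context {R : realType}.
Local Notation T := (measurableTypeR R).
Local Notation mu := (@lebesgue_measure R).
Implicit Types (I : set R) (f g phi : R -> R) (a b : R).

(** The countable exhaustion glues almost everywhere statements on compact pieces; convexity keeps
    the hull of two supports inside I. *)
Definition open_interval I := exists a b : nat -> R,
  [/\ forall n, a n < b n /\ `[a n, b n] `<=` I,
      (forall x, I x -> exists n, x \in `]a n, b n[) &
      forall x y, I x -> I y -> `[x, y] `<=` I].

Lemma test_smooth I phi : test_function I phi -> smooth phi.
Proof. by move=> [h _]; split. Qed.

Lemma test_bump I k a b : `[a, b] `<=` I -> test_function I (bump k a b).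
Proof.
move=> abI; split; first by move=> n x; exact: (derivable_smooth (smooth_bump k a b)).
exists a, b; split=> // x; rewrite in_itv /= => /negP xab.
by rewrite bump_out//; apply: contra_notN xab => /andP[/ltW -> /ltW ->].
Qed.

Lemma test_smoothM I phi f : test_function I phi -> smooth f ->
  test_function I (fun x => f x * phi x).
Proof.
move=> tphi sf; have sphi := test_smooth tphi; have [_ [a [b [abI h]]]] := tphi.
split; first by move=> n x; exact: (derivable_smooth (smoothM sf sphi)).
by exists a, b; split=> // x /h ->; rewrite mulr0.
Qed.

Lemma test_lin I (c : R) f g : open_interval I ->
  test_function I f -> test_function I g -> test_function I (fun x => f x + c * g x).
Proof.
move=> [_ [_ [_ _ Iitv]]] tf tg.
have [_ [a [b [abI f0]]]] := tf; have [_ [a' [b' [abI' g0]]]] := tg.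
split.
  move=> n x; apply: derivable_smooth.
  by apply: smoothD; [exact: test_smooth tf|apply: smoothM;
    [exact: smooth_cst|exact: test_smooth tg]].
(* A support interval may be empty, in which case the function is 0 and its end points say nothing
   about I; such an interval must not enter the hull. *)
have [ab|ba] := leP a b; last first.
  exists a', b'; split=> // x xab; rewrite g0// mulr0 addr0 f0//.
  by rewrite in_itv /=; apply/negP => /andP[ax /(le_trans ax)]; rewrite leNgt ba.
have [ab'|ba'] := leP a' b'; last first.
  exists a, b; split=> // x xab; rewrite f0// add0r g0 ?mulr0//.
  by rewrite in_itv /=; apply/negP => /andP[ax /(le_trans ax)]; rewrite leNgt ba'.
exists (Num.min a a'), (Num.max b b'); split.
  apply: Iitv; [case: (leP a a') => _|case: (leP b b') => _];
    by [apply: abI; rewrite /= in_itv /= lexx ab|apply: abI'; rewrite /= in_itv /= lexx ab'].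
move=> x; rewrite in_itv /= ge_min le_max => h.
rewrite f0 ?g0 ?mulr0 ?addr0//; apply: contra h; rewrite in_itv /= => /andP[-> ->];
  by rewrite ?orbT.
Qed.

Lemma ae_zero_test I f : measurable (I : set T) -> open_interval I ->
  locally_integrable_on I f ->
  (forall phi, test_function I phi -> \int[mu]_(x in I) (f x * phi x) = 0) ->
  {ae mu, forall x, I x -> f x = 0}.
Proof.
move=> mI [a [b [abI Iab _]]] fI f0.
have h n : {ae mu, forall x, x \in `]a n, b n[ -> f x = 0}.
  apply: (ae0_of_Rintegral0 fI); first by have [] := abI n.
  move=> c d cdI; apply: (Rintegral_bump0 mI fI cdI) => k.
  by apply: f0; exact: test_bump.
have := ae_foralln h; apply: filterS => x hx /Iab[n xn]; exact: hx xn.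
Qed.

(** The zero integral is exactly what makes the primitive vanish again to the right of b, so that it
    keeps compact support. *)
Lemma smooth_antiderivative phi a b : smooth phi ->
  (forall x, x \notin `[a, b] -> phi x = 0) -> \int[mu]_(x in `[a, b]) phi x = 0 ->
  exists f, [/\ smooth f, derive1 f = phi & forall x, x \notin `[a, b] -> f x = 0].
Proof.
move=> sphi phi0 iphi; have cphi := smooth_continuous sphi.
(* Starting at a - 1 places every x >= a strictly inside the interval of integration, where the
   fundamental theorem applies. *)
pose f x := \int[mu]_(t in `[a - 1, x]) phi t.
have fl x : x < a -> f x = 0.
  move=> xa; rewrite /f (@eq_Rintegral _ _ _ _ _ (cst 0)); first by rewrite Rintegral_cst// mul0r.
  move=> t; rewrite inE /= in_itv /= => /andP[_ tx]; rewrite phi0// in_itv /= negb_and -ltNge.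
  by rewrite (le_lt_trans tx xa).
have f0 x : x \notin `[a, b] -> f x = 0.
  rewrite in_itv /= negb_and -!ltNge => /orP[/fl//|bx].
  rewrite -iphi; apply: Rintegral_support.
    move=> t /=; rewrite !in_itv /= => /andP[at_ tb]; rewrite (le_trans tb (ltW bx)) andbT.
    by rewrite (le_trans _ at_)// gerBl.
  by move=> t /negP tab; apply: phi0; rewrite in_itv.
have fd (x : R) : is_derive x 1 f (phi x).
  have [xa|ax] := ltP x a.
    have -> : phi x = 0.
      by apply: phi0; rewrite in_itv /= negb_and -ltNge xa.
    have d0 : is_derive x 1 (cst (0 : R)) 0 := is_derive_cst _ _ _.
    apply: near_eq_is_derive d0; near=> y; rewrite fl//; near: y; exact: lt_nbhsl.
  have ax1 : a - 1 < x by rewrite (lt_le_trans _ ax)// gtrBl.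
  have xx1 : x < x + 1 by rewrite ltrDl.
  have [df <-] := continuous_FTC1_closed xx1 (integrable_itv_continuous _ _ cphi) ax1 (cphi x).
  by rewrite derive1E; exact: derivableP.
have df := is_derive_derive1 fd.
exists f; split => //; split => -[|n] x; first by have [] := fd x.
by rewrite /derive1n iterSr df; exact: (derivable_smooth sphi).
Unshelve. all: by end_near. Qed.

Lemma loc_integrableM_test I f phi : measurable (I : set T) -> locally_integrable_on I f ->
  test_function I phi -> mu.-integrable I (EFin \o (fun x => f x * phi x)).
Proof.
move=> mI fI tphi; have [_ [a [b [abI phi0]]]] := tphi.
have cphi := smooth_continuous (test_smooth tphi).
have := integrableM_continuous cphi (fI _ _ abI).
have mab : measurable (`[a, b] : set T) by [].
move=> h; move/(integrable_mkcond _ mab): h => h; apply/(integrable_mkcond _ mI).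
move: h; congr (integrable _ _ _); apply/funext => x; rewrite !patchE.
case: ifPn => [xab|]; first by rewrite ifT// inE; apply: abI; rewrite inE in xab.
rewrite notin_setE => /negP xab; case: ifPn => //= _.
by rewrite phi0 ?mulr0.
Qed.

(** If all these integrals vanished, so would their limit b - a. *)
Lemma bump_integral_gt0 a b : a < b -> exists k, \int[mu]_(x in `[a, b]) bump k a b x != 0.
Proof.
move=> ab; apply: contrapT => /forallNP h.
have mab : measurable (`[a, b] : set T) by [].
have : \int[mu]_(x in `]a, b[) cst 1 x = 0 :> R.
  apply: (@Rintegral_bump0 _ `[a, b]) => //.
    by move=> c d _; apply: integrable_itv_continuous => x; exact: cvg_cst.
  move=> k; under eq_Rintegral do rewrite mul1r.
  by apply/eqP/negPn/negP/h.
rewrite Rintegral_cst// mul1r.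
have := lebesgue_measure_itv (`]a, b[ : interval R); rewrite /= lte_fin ab => -> /eqP.
by rewrite subr_eq0 gt_eqF.
Qed.

(** The du Bois-Reymond lemma: every test function is a multiple of a fixed [eta] plus the
    derivative of a test function, so f is determined by its pairing with [eta], which fixes the
    constant. *)
Lemma ae_cst_test I f : measurable (I : set T) -> open_interval I ->
  locally_integrable_on I f ->
  (forall phi, test_function I phi -> \int[mu]_(x in I) (f x * derive1 phi x) = 0) ->
  exists c, {ae mu, forall x, I x -> f x = c}.
Proof.
move=> mI oI fI f0; have [a0 [b0 [abI0 _ _]]] := oI.
have [ab0 abI] := abI0 0%N; have [k A0] := bump_integral_gt0 ab0.
set eta := bump k (a0 0%N) (b0 0%N) in A0; set A := Rintegral _ _ _ in A0.
have teta : test_function I eta := test_bump k abI.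
have one_loc : locally_integrable_on I (cst 1).
  by move=> c d _; apply: integrable_itv_continuous => x; exact: cvg_cst.
have etaI : \int[mu]_(x in I) eta x = A.
  apply: Rintegral_support => // x /negP; rewrite in_itv /= => xab; apply: bump_out.
  by apply: contraNN xab => /andP[/ltW -> /ltW ->].
have int_test phi : test_function I phi -> mu.-integrable I (EFin \o phi).
  move=> tphi; have := loc_integrableM_test mI one_loc tphi.
  by congr (integrable _ _ (EFin \o _)); apply/funext => x; rewrite mul1r.
pose c := (\int[mu]_(x in I) (f x * eta x)) / A.
exists c.
have fc_loc : locally_integrable_on I (fun x => f x - c).
  move=> a b ab; have cc : continuous (cst c : R -> R) by move=> x; exact: cvg_cst.
  have mab : measurable (`[a, b] : set T) by [].
  exact: (integrableB mab (fI _ _ ab) (integrable_itv_continuous _ _ cc)).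
suff h : {ae mu, forall x, I x -> (f x - c) = 0}.
  by apply: filterS h => x h /h /eqP; rewrite subr_eq0 => /eqP.
apply: (ae_zero_test mI oI fc_loc) => phi tphi.
pose B := \int[mu]_(x in I) phi x.
(* The coefficient cancels the integral of [phi], so [psi] is the derivative of a test function. *)
pose psi x := phi x + (- (B / A)) * eta x.
have tpsi : test_function I psi by exact: test_lin.
have psiI : \int[mu]_(x in I) psi x = 0.
  rewrite RintegralD//; [|exact: int_test|]; last first.
    exact: (integrableZl mI (- (B / A)) (int_test _ teta)).
  by rewrite RintegralZl ?int_test// etaI mulNr divfK// subrr.
have [_ [a [b [abI' psi0]]]] := tpsi.
have psiab : \int[mu]_(x in `[a, b]) psi x = 0.
  by rewrite -psiI; apply/esym/Rintegral_support => // x /negP ?; rewrite psi0// in_itv.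
have [zeta [szeta dzeta zeta0]] := smooth_antiderivative (test_smooth tpsi) psi0 psiab.
have tzeta : test_function I zeta.
  by split; [move=> n x; exact: derivable_smooth|exists a, b].
have := f0 _ tzeta; rewrite dzeta.
under eq_Rintegral do rewrite mulrDr mulrCA.
have fphi := loc_integrableM_test mI fI tphi.
have feta := loc_integrableM_test mI fI teta.
rewrite RintegralD//; last exact: (integrableZl mI (- (B / A)) feta).
rewrite RintegralZl// => h.
under eq_Rintegral do rewrite mulrBl.
rewrite RintegralB//; last exact: (integrableZl mI c (int_test _ tphi)).
move/eqP: h; rewrite addr_eq0 => /eqP ->.
by rewrite RintegralZl ?int_test// -/B /c; ring.
Qed.

End FundamentalLemma.

(** * Weak derivatives and square-integrable functions *)

Section WeakDerivatives.
Context {R : realType}.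
Local Notation C := R[i].
Local Notation T := (measurableTypeR R).
Local Notation mu := (@lebesgue_measure R).
Implicit Types (I : set R) (u v g w : R -> C) (phi rho : R -> R) (a b : R).

Definition continuous_parts u :=
  continuous (fun x => complex.Re (u x)) /\ continuous (fun x => complex.Im (u x)).

Lemma continuous_partsD (f g : R -> C) : continuous_parts f -> continuous_parts g ->
  continuous_parts (fun x => f x + g x).
Proof.
move=> [fr fi] [gr gi]; split=> x.
  by under eq_fun do rewrite cReD; apply: cvgD; [exact: fr|exact: gr].
by under eq_fun do rewrite cImD; apply: cvgD; [exact: fi|exact: gi].
Qed.

Lemma continuous_partsZ (c : C) (f : R -> C) : continuous_parts f -> continuous_parts (fun x => c * f x).
Proof.
move=> [fr fi]; split=> x.
  under eq_fun do rewrite cReM.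
  by apply: cvgB; apply: cvgM; [exact: cvg_cst|exact: fr|exact: cvg_cst|exact: fi].
under eq_fun do rewrite cImM.
by apply: cvgD; apply: cvgM; [exact: cvg_cst|exact: fi|exact: cvg_cst|exact: fr].
Qed.

Lemma complexI2 (a b c d : R) : Complex a b = Complex c d -> a = c /\ b = d.
Proof. by case. Qed.

Lemma Re_mulr (z : C) (r : R) : complex.Re (z * r%:C%C) = complex.Re z * r.
Proof. by rewrite cReM /= mulr0 subr0. Qed.

Lemma Im_mulr (z : C) (r : R) : complex.Im (z * r%:C%C) = complex.Im z * r.
Proof. by rewrite cImM /= mulr0 add0r. Qed.

Lemma cintegral_mulr I u phi : cintegral I (fun x => u x * (phi x)%:C%C) =
  Complex (\int[mu]_(x in I) (complex.Re (u x) * phi x))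
          (\int[mu]_(x in I) (complex.Im (u x) * phi x)).
Proof.
rewrite /cintegral; congr Complex; apply: eq_Rintegral => x _.
  exact: Re_mulr.
exact: Im_mulr.
Qed.

Lemma parts_le_sqabs (z : C) : `|complex.Re z| <= 1 + sqabs z /\ `|complex.Im z| <= 1 + sqabs z.
Proof.
case: z => a b; rewrite /sqabs !ler_norml /=.
have := sqr_ge0 (a - 1); have := sqr_ge0 (a + 1); have := sqr_ge0 (b - 1); have := sqr_ge0 (b + 1).
by move=> *; split; apply/andP; split; nra.
Qed.

Lemma L2_integrable a b u : L2 `[a, b] u ->
  mu.-integrable `[a, b] (EFin \o (fun x => complex.Re (u x))) /\
  mu.-integrable `[a, b] (EFin \o (fun x => complex.Im (u x))).
Proof.
have mab : measurable (`[a, b] : set T) by [].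
move=> /(L2P _ mab)[mr mi hu].
have c1 : continuous (cst 1 : R -> R) by move=> x; exact: cvg_cst.
have hi := integrableD mab (integrable_itv_continuous a b c1) hu.
split; apply: le_integrable hi => //; try exact/measurable_EFinP;
  move=> x _; rewrite /= lee_fin [leRHS]ger0_norm ?addr_ge0 ?sqr_ge0 ?ler01//;
  by have [] := parts_le_sqabs (u x).
Qed.

Lemma L2loc_locally_integrable I u : L2loc I u ->
  locally_integrable_on I (fun x => complex.Re (u x)) /\
  locally_integrable_on I (fun x => complex.Im (u x)).
Proof. by move=> uI; split=> a b /uI/L2_integrable[]. Qed.

Lemma weak_deriv1_ae_cst I u : measurable (I : set T) -> open_interval I ->
  L2loc I u -> weak_deriv 1 I u 0 -> exists c, {ae mu, forall x, I x -> u x = c}.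
Proof.
move=> mI oI /L2loc_locally_integrable[ur ui] du.
have hu phi : test_function I phi ->
    \int[mu]_(x in I) (complex.Re (u x) * derive1 phi x) = 0 /\
    \int[mu]_(x in I) (complex.Im (u x) * derive1 phi x) = 0.
  move=> /du; rewrite cintegral_mulr.
  under [in RHS]eq_fun do rewrite mul0r.
  by rewrite cintegral0 mulr0 => /complexI2.
have [c1 h1] := ae_cst_test mI oI ur (fun phi t => (hu phi t).1).
have [c2 h2] := ae_cst_test mI oI ui (fun phi t => (hu phi t).2).
exists (Complex c1 c2); apply: filterS2 h1 h2 => x h1 h2 Ix.
by apply: complex_ext => /=; [exact: h1|exact: h2].
Qed.

Lemma weak_deriv_unique m I u g1 g2 : measurable (I : set T) -> open_interval I ->
  L2loc I g1 -> L2loc I g2 -> weak_deriv m I u g1 -> weak_deriv m I u g2 ->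
  {ae mu, forall x, I x -> g1 x = g2 x}.
Proof.
move=> mI oI G1 G2 d1 d2.
have Gd : L2loc I (fun x => (-1) * g2 x + g1 x) by exact: L2loc_lin.
have [gr gi] := L2loc_locally_integrable Gd.
have hu phi : test_function I phi ->
    \int[mu]_(x in I) (complex.Re (-1 * g2 x + g1 x) * phi x) = 0 /\
    \int[mu]_(x in I) (complex.Im (-1 * g2 x + g1 x) * phi x) = 0.
  move=> t; have := d1 _ t; rewrite d2// => /(congr1 (fun z => (-1) ^+ m * z)).
  rewrite !mulrA -!expr2 !sqrr_sign !mul1r => h.
  apply: complexI2; rewrite -cintegral_mulr.
  under eq_fun do rewrite mulrDl -mulrA.
  have [? ?] := test_integrable mI G1 t; have [? ?] := test_integrable mI G2 t.
  by rewrite cintegral_lin// h mulN1r addNr.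
have h1 := ae_zero_test mI oI gr (fun phi t => (hu phi t).1).
have h2 := ae_zero_test mI oI gi (fun phi t => (hu phi t).2).
apply: filterS2 h1 h2 => x h1 h2 Ix; apply/esym/eqP.
rewrite -subr_eq0 -oppr_eq0 opprB addrC -mulN1r.
by apply/eqP/complex_ext; [exact: h1|exact: h2].
Qed.

Lemma ae_eq_Rintegral I (f h : R -> R) : measurable (I : set T) ->
  mu.-integrable I (EFin \o f) -> mu.-integrable I (EFin \o h) ->
  {ae mu, forall x, I x -> f x = h x} ->
  \int[mu]_(x in I) f x = \int[mu]_(x in I) h x.
Proof.
move=> mI fi hi fh; congr fine; apply: ae_eq_integral => //.
- exact: (measurable_int _ fi).
- exact: (measurable_int _ hi).
- by apply: filterS fh => x fh Ix /=; rewrite fh.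
Qed.

(** Needed throughout because the components of an energy class are known only up to null sets. *)
Lemma weak_deriv_ae m I u u' g g' : measurable (I : set T) ->
  L2loc I u -> L2loc I u' -> L2loc I g -> L2loc I g' ->
  {ae mu, forall x, I x -> u x = u' x} -> {ae mu, forall x, I x -> g x = g' x} ->
  weak_deriv m I u g -> weak_deriv m I u' g'.
Proof.
move=> mI U U' G G' uu gg d phi t; have := d phi t.
have tm := test_derivS m t.
have aux v v' psi : L2loc I v -> L2loc I v' -> test_function I psi ->
    {ae mu, forall x, I x -> v x = v' x} ->
    cintegral I (fun x => v x * (psi x)%:C%C) = cintegral I (fun x => v' x * (psi x)%:C%C).
  move=> V V' tpsi vv; have [? ?] := test_integrable mI V tpsi.
  have [? ?] := test_integrable mI V' tpsi.
  by congr Complex; apply: ae_eq_Rintegral => //; apply: filterS vv => x vv Ix; rewrite vv.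
by rewrite (aux u u')// (aux g g').
Qed.

Lemma L2_mul I (E u : R -> C) (M : R) : measurable (I : set T) ->
  measurable_fun (I : set T) (fun x => complex.Re (E x)) ->
  measurable_fun (I : set T) (fun x => complex.Im (E x)) ->
  (forall x, I x -> sqabs (E x) <= M) -> L2 I u -> L2 I (fun x => E x * u x).
Proof.
move=> mI Er Ei EM /(L2P _ mI)[ur ui uL].
have mr : measurable_fun (I : set T) (fun x => complex.Re (E x * u x)).
  under eq_fun do rewrite cReM.
  by apply: measurable_funB; exact: measurable_funM.
have mi : measurable_fun (I : set T) (fun x => complex.Im (E x * u x)).
  under eq_fun do rewrite cImM.
  by apply: measurable_funD; exact: measurable_funM.
apply/(L2P _ mI); split => //.
apply: le_integrable (integrableZl mI M uL) => //.
  by apply/measurable_EFinP/measurable_funD; exact: measurable_funX.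
move=> x Ix /=; rewrite lee_fin ger0_norm ?sqabs_ge0// sqabsM.
apply: le_trans (ler_norm _); rewrite ler_wpM2r ?sqabs_ge0//; exact: EM.
Qed.

Lemma L2loc_mul_continuous I (E u : R -> C) :
  continuous_parts E -> L2loc I u -> L2loc I (fun x => E x * u x).
Proof.
move=> [Er Ei] uL a b /uL uab.
have [M EM] : exists M, forall x, x \in `[a, b] -> sqabs (E x) <= M.
  have cE : continuous (fun x => sqabs (E x)).
    by move=> x; apply: cvgD; rewrite !expr2; apply: cvgM; [exact: Er|exact: Er|exact: Ei|exact: Ei].
  have := @continuous_compact _ _ (fun x => sqabs (E x)) `[a, b].
  move=> /(_ (continuous_subspaceT cE) (@segment_compact R a b)) /compact_bounded.
  move=> [M [Mr Mh]]; exists (M + 1) => x xab.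
  by apply: le_trans (ler_norm _) _; apply: (Mh (M + 1)); [rewrite ltrDl|exists x].
by apply: (@L2_mul _ _ _ M) => //; apply: measurable_funTS; exact: continuous_measurable_fun.
Qed.

(** The factor [rho] is moved onto the test function; the Leibniz rule for [rho * phi] produces the
    extra term. *)
Lemma weak_deriv_mul_smooth I u g rho : measurable (I : set T) ->
  L2loc I u -> L2loc I g -> smooth rho -> weak_deriv 1 I u g ->
  weak_deriv 1 I (fun x => (rho x)%:C%C * u x)
    (fun x => (derive1 rho x)%:C%C * u x + (rho x)%:C%C * g x).
Proof.
move=> mI U G sr d phi t.
have t1 := test_smoothM t sr; have t2 := test_smoothM t (smooth_derive sr).
have t3 := test_smoothM (test_derivS 1 t) sr; rewrite derive1n1 in t3.
have sphi := test_smooth t.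
have d1 : derive1 (fun x => rho x * phi x) =
    (fun x => derive1 rho x * phi x + rho x * derive1 phi x).
  apply: is_derive_derive1 => x.
  have df := smooth_is_derive sr x; have dg := smooth_is_derive sphi x.
  by apply: is_derive_eq; rewrite /GRing.scale /=; ring.
have [? ?] := test_integrable mI U t2; have [? ?] := test_integrable mI G t1.
have [? ?] := test_integrable mI U t3.
have := d _ t1; rewrite !derive1n1 d1 expr1 !mulN1r => h.
have -> : (fun x => (rho x)%:C%C * u x * (derive1 phi x)%:C%C) =
    (fun x => u x * (rho x * derive1 phi x)%:C%C).
  by apply/funext => x; rewrite rmorphM /=; ring.
have -> : (fun x => ((derive1 rho x)%:C%C * u x + (rho x)%:C%C * g x) * (phi x)%:C%C) =
    (fun x => 1 * (u x * (derive1 rho x * phi x)%:C%C) + g x * (rho x * phi x)%:C%C).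
  by apply/funext => x; rewrite !rmorphM /=; ring.
rewrite cintegral_lin// mul1r opprD -h.
have -> : (fun x => u x * (derive1 rho x * phi x + rho x * derive1 phi x)%:C%C) =
    (fun x => 1 * (u x * (derive1 rho x * phi x)%:C%C) + u x * (rho x * derive1 phi x)%:C%C).
  by apply/funext => x; rewrite rmorphD /=; ring.
by rewrite cintegral_lin// mul1r addKr.
Qed.

Lemma derive1_Re_cexp (l : C) :
  derive1 (fun x => complex.Re (cexp l x)) = (fun x => complex.Re (l * cexp l x)).
Proof. by apply: is_derive_derive1 => x; exact: is_derive_Re_cexp. Qed.

Lemma derive1_Im_cexp (l : C) :
  derive1 (fun x => complex.Im (cexp l x)) = (fun x => complex.Im (l * cexp l x)).
Proof. by apply: is_derive_derive1 => x; exact: is_derive_Im_cexp. Qed.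

Lemma continuous_Re_cexp (l : C) : continuous (fun x => complex.Re (cexp l x)).
Proof. exact/smooth_continuous/smooth_Re_cexp. Qed.

Lemma continuous_Im_cexp (l : C) : continuous (fun x => complex.Im (cexp l x)).
Proof. exact/smooth_continuous/smooth_Im_cexp. Qed.

Lemma continuous_parts_cexp l : continuous_parts (cexp l : R -> C).
Proof. by split; [exact: continuous_Re_cexp|exact: continuous_Im_cexp]. Qed.

Lemma L2loc_cexp I l u : L2loc I u -> L2loc I (fun x => cexp l x * u x).
Proof. exact: L2loc_mul_continuous (continuous_parts_cexp l). Qed.

Lemma L2loc_real_mul I rho u : continuous rho -> L2loc I u ->
  L2loc I (fun x => (rho x)%:C%C * u x).
Proof. by move=> cr; apply: L2loc_mul_continuous; split=> // x; exact: cvg_cst. Qed.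

Lemma weak_deriv_cexp_mul I u g l : measurable (I : set T) ->
  L2loc I u -> L2loc I g -> weak_deriv 1 I u g ->
  weak_deriv 1 I (fun x => cexp l x * u x) (fun x => cexp l x * (l * u x + g x)).
Proof.
move=> mI U G d.
have sr := smooth_Re_cexp l; have si := smooth_Im_cexp l.
have cr := smooth_continuous sr; have ci := smooth_continuous si.
have cr' := smooth_continuous (smooth_derive sr).
have ci' := smooth_continuous (smooth_derive si).
have dr := weak_deriv_mul_smooth mI U G sr d.
have di := weak_deriv_mul_smooth mI U G si d.
have L1 rho rho' : continuous rho -> continuous rho' ->
    L2loc I (fun x => (rho' x)%:C%C * u x + (rho x)%:C%C * g x).
  move=> c c'; have := L2loc_lin 1 (L2loc_real_mul c' U) (L2loc_real_mul c G).
  by congr L2loc; apply/funext => x; rewrite mul1r.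
(* The product rule is stated for real factors, so the exponential is reassembled as i times its
   imaginary part plus its real part. *)
have := weak_deriv_lin (Complex 0 1) mI (L2loc_real_mul ci U) (L2loc_real_mul cr U)
  (L1 _ _ ci ci') (L1 _ _ cr cr') di dr.
rewrite derive1_Re_cexp derive1_Im_cexp; congr weak_deriv; apply/funext => x;
  by apply: complex_ext; rewrite ?(cReM, cImM, cReD, cImD) /=; ring.
Qed.

Lemma weak_deriv1_cst I (c : C) : measurable (I : set T) -> weak_deriv 1 I (cst c) 0.
Proof.
move=> mI phi t; under [in RHS]eq_fun do rewrite mul0r.
rewrite cintegral0 mulr0 cintegral_mulr.
have sphi := test_smooth t; have [_ [a [b [abI phi0]]]] := t.
have t1 := test_derivS 1 t; rewrite derive1n1 in t1 *.
have [_ [a1 [b1 [abI1 phi1]]]] := t1.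
suff h : forall r : R, \int[mu]_(x in I) (r * derive1 phi x) = 0 by rewrite !h.
(* The support intervals of [phi] and of its derivative are unrelated witnesses; [-B, B] contains
   the second, and both of its ends lie outside the first. *)
move=> r; pose B := `|a| + `|b| + (`|a1| + `|b1|) + 1.
have bnd (p : R) : - `|p| <= p <= `|p| by rewrite -ler_norml.
have [/andP[la ua] /andP[lb ub]] := (bnd a, bnd b).
have [/andP[la1 ua1] /andP[lb1 ub1]] := (bnd a1, bnd b1).
have pos := normr_ge0; have ccI : - B < B by have := pos R R a; have := pos R R b;
  have := pos R R a1; have := pos R R b1; rewrite /B; lra.
rewrite (@Rintegral_support _ _ `[a1, b1])//; last first.
  by move=> x /negP xab; rewrite phi1 ?mulr0.
rewrite -(@Rintegral_support _ `[- B, B] `[a1, b1]); last 2 first.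
- move=> x /=; rewrite !in_itv /= => /andP[ax xb]; have := pos R R a; have := pos R R b.
  by rewrite /B; move=> *; apply/andP; split; lra.
- by move=> x /negP xab; rewrite phi1 ?mulr0.
have cphi' := smooth_continuous (smooth_derive sphi).
rewrite RintegralZl//; last exact: integrable_itv_continuous.
have pa : phi (- B) = 0.
  apply: phi0; rewrite in_itv /= negb_and -!ltNge; apply/orP; left.
  by have := pos R R b; have := pos R R a1; have := pos R R b1; rewrite /B; lra.
have pb : phi B = 0.
  apply: phi0; rewrite in_itv /= negb_and -!ltNge; apply/orP; right.
  by have := pos R R a; have := pos R R a1; have := pos R R b1; rewrite /B; lra.
rewrite /Rintegral (@continuous_FTC2 _ (derive1 phi) phi)//.
- by rewrite pa pb /= subrr mulr0.
- exact: continuous_subspaceT.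
- split.
  + by move=> x _; have [] := smooth_is_derive sphi x.
  + by apply: cvg_at_right_filter; exact: smooth_continuous.
  + by apply: cvg_at_left_filter; exact: smooth_continuous.
Qed.

Lemma L2loc_cst I (c : C) : L2loc I (cst c).
Proof.
move=> a b _; apply/L2P => //; split; [exact: (measurable_cst (complex.Re c))|exact: (measurable_cst (complex.Im c))|].
by apply: integrable_itv_continuous => x; exact: (cvg_cst (sqabs c)).
Qed.

Lemma weak_deriv_cexp I l : measurable (I : set T) ->
  weak_deriv 1 I (cexp l) (fun x => l * cexp l x).
Proof.
move=> mI.
have := weak_deriv_cexp_mul l mI (@L2loc_cst I 1) (@L2loc_cst I 0) (weak_deriv1_cst 1 mI).
by congr weak_deriv; apply/funext => x; rewrite /cst /=; ring.
Qed.

(** The derivative of a test function is again a test function, so one order can be peeled off by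
    testing u with it. *)
Lemma weak_deriv21 I u g w : weak_deriv 1 I u g -> weak_deriv 2 I u w -> weak_deriv 1 I g w.
Proof.
move=> d1 d2 phi t; have h : _ = _ * cintegral I (fun x => g x * (derive1n 1 phi x)%:C%C) :=
  d1 _ (test_derivS 1 t).
by move: (d2 _ t); rewrite h expr1 !mulN1r sqrrN expr1n mul1r => <-; rewrite opprK.
Qed.

Lemma weak_deriv11 I u g w : weak_deriv 1 I u g -> weak_deriv 1 I g w -> weak_deriv 2 I u w.
Proof.
move=> d1 d2 phi t; have h : cintegral I (fun x => u x * (derive1n 2 phi x)%:C%C) = _ :=
  d1 _ (test_derivS 1 t).
by rewrite h expr1 mulN1r d2// expr1 mulN1r opprK sqrrN expr1n mul1r.
Qed.

End WeakDerivatives.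

(** * Completeness of L^2 *)

Section L2Completeness.
Context {R : realType}.
Local Notation C := R[i].
Local Notation T := (measurableTypeR R).
Local Notation mu := (@lebesgue_measure R).
Implicit Types (I : set R) (u v g w : R -> C).

Definition L2_sqr I u : \bar R := (\int[mu]_(x in I) (sqabs (u x))%:E)%E.

Lemma measurable_sqabs I u : measurable_fun (I : set T) (fun x => complex.Re (u x)) ->
  measurable_fun (I : set T) (fun x => complex.Im (u x)) ->
  measurable_fun (I : set T) (fun x => (sqabs (u x))%:E).
Proof. by move=> ? ?; apply/measurable_EFinP/measurable_funD; exact: measurable_funX. Qed.

Lemma L2B I u v : measurable (I : set T) -> L2 I u -> L2 I v -> L2 I (fun x => u x - v x).
Proof.
move=> mI uL vL; have := L2_lin (-1) mI vL uL; congr L2; apply/funext => x.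
by rewrite mulN1r addrC.
Qed.

(** With p = 2^{i+1} one has |w| <= 1/p + p w^2, so the weighted sum of squares makes the increments
    absolutely summable. *)
Lemma cvgn_of_summable (u : nat -> C) (S : R) :
  (forall k, \sum_(0 <= i < k) (2 ^ i.+1)%:R * sqabs (u i.+1 - u i) <= S) ->
  cvgn (fun k => complex.Re (u k)) /\ cvgn (fun k => complex.Im (u k)).
Proof.
move=> hS.
suff aux (v : nat -> R) : (forall i, (v i.+1 - v i) ^+ 2 <= sqabs (u i.+1 - u i)) -> cvgn v.
  split; apply: aux => i; rewrite /sqabs ?cReD ?cImD ?cReN ?cImN.
    by rewrite lerDl sqr_ge0.
  by rewrite lerDr sqr_ge0.
move=> hv; pose w i := v i.+1 - v i.
have sw : cvgn (series w).
  apply: normed_cvg; apply: nondecreasing_is_cvgn.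
    by apply: nondecreasing_series => n _ _; exact: normr_ge0.
  exists (1 + S) => _ [k _ <-]; rewrite /series /=.
  apply: le_trans (_ : \sum_(0 <= i < k) (1 / (2 ^ i.+1)%:R + (2 ^ i.+1)%:R * sqabs (u i.+1 - u i)) <= _).
    apply: ler_sum_nat => i _.
    have p0 : 0 < (2 ^ i.+1)%:R :> R by rewrite ltr0n expn_gt0.
    apply: le_trans (_ : 1 / (2 ^ i.+1)%:R + (2 ^ i.+1)%:R * (w i) ^+ 2 <= _); last first.
      by rewrite lerD2l ler_wpM2l ?hv// ltW.
    rewrite -(ler_pM2l p0) mulrDr mul1r divff ?gt_eqF// mulrA -expr2 -exprMn.
    rewrite -[X in X * _ <= _]gtr0_norm// -normrM; set y := _ * _.
    have := sqr_ge0 (`|y| - 1); rewrite sqrrB -[`|y| ^+ 2]/(`|y| ^+ 2) real_normK ?num_real//.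
    by have := normr_ge0 y; nra.
  rewrite big_split /= lerD//.
  rewrite -lee_fin -sumEFin; apply: le_trans (epsilon_trick0 xpredT (@ler01 R)).
  by apply: nneseries_lim_ge => n _ _; rewrite lee_fin divr_ge0.
have -> : v = (fun k => v 0%N + series w k).
  by apply/funext => k; rewrite /series /= telescope_sumr// addrC subrK.
by apply: is_cvgD => //; exact: is_cvg_cst.
Qed.

(** Squared increments of order 4^{-(k+1)} survive the weight 2^{k+1}: the weighted series has
    integral at most 1, hence is finite almost everywhere. *)
Lemma L2_ae_cvg I (u : nat -> R -> C) : measurable (I : set T) ->
  (forall k, L2 I (u k)) ->
  (forall k, (L2_sqr I (fun x => u k.+1 x - u k x)%R <= (1 / (2 ^ k.+1)%:R / (2 ^ k.+1)%:R)%:E)%E) ->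
  {ae mu, forall x, I x -> cvgn (fun k => complex.Re (u k x)) /\
                           cvgn (fun k => complex.Im (u k x))}.
Proof.
move=> mI uL hu.
pose p k : R := (2 ^ k.+1)%:R.
have p0 k : 0 < p k by rewrite /p ltr0n expn_gt0.
pose F k x : \bar R := (p k * sqabs (u k.+1 x - u k x))%:E.
have F0 k x : (0 <= F k x)%E by rewrite lee_fin mulr_ge0 ?sqabs_ge0// ltW.
have ms k : measurable_fun (I : set T) (fun x => (sqabs (u k.+1 x - u k x))%:E).
  by have [mr mi _] := L2B mI (uL k.+1) (uL k); exact: measurable_sqabs.
have mF k : measurable_fun (I : set T) (F k).
  rewrite (_ : F k = (fun x => (p k)%:E * (sqabs (u k.+1 x - u k x))%:E)%E).
    by apply: measurable_funeM.
  by apply/funext => x; rewrite /F EFinM.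
pose S x := (\sum_(0 <= k <oo) F k x)%E.
have S0 x : (0 <= S x)%E by apply: nneseries_ge0.
have mS : measurable_fun (I : set T) S.
  by apply: ge0_emeasurable_sum.
have intS : mu.-integrable I S.
  apply/integrableP; split => //.
  under eq_integral do rewrite gee0_abs//.
  rewrite integral_nneseries//.
  apply: (@le_lt_trans _ _ (1%:E)); last exact: ltry.
  apply: le_trans (epsilon_trick0 xpredT (@ler01 R)).
  apply: lee_nneseries => k _; first by move=> _; apply: integral_ge0.
  rewrite /F; under eq_integral do rewrite EFinM.
  rewrite ge0_integralZl_EFin ?(ltW (p0 k))//; last by move=> x _; rewrite lee_fin sqabs_ge0.
  apply: le_trans (_ : ((p k)%:E * (1 / (2 ^ k.+1)%:R / (2 ^ k.+1)%:R)%:E <= _)%E).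
    by apply: lee_wpmul2l; [rewrite lee_fin ltW|exact: hu].
  by rewrite -EFinM lee_fin mulrC divfK// gt_eqF.
have := integrable_ae mI intS; apply: filterS => x h Ix.
apply: (@cvgn_of_summable _ (fine (S x))) => k.
rewrite -lee_fin (fineK (h Ix)) -sumEFin.
by apply: nneseries_lim_ge => i _ _; exact: F0.
Qed.

Lemma L2_complete I (u : nat -> R -> C) : measurable (I : set T) ->
  (forall k, L2 I (u k)) ->
  (forall e : R, 0 < e -> exists N, forall m n, (N <= m)%N -> (N <= n)%N ->
     (L2_sqr I (fun x => u m x - u n x)%R <= e%:E)%E) ->
  exists2 g, L2 I g & forall e : R, 0 < e -> exists N, forall n, (N <= n)%N ->
     (L2_sqr I (fun x => u n x - g x)%R <= e%:E)%E.
Proof.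
move=> mI uL uC.
have e0 k : 0 < 1 / (2 ^ k.+1)%:R / (2 ^ k.+1)%:R :> R.
  by rewrite !divr_gt0// ltr0n expn_gt0.
have [N NC] := choice (fun k => uC _ (e0 k)).
(* Both n k and n (k + 1) lie beyond N k, so consecutive terms of the subsequence are close; the
   summand k makes the indices tend to infinity. *)
pose n k := (k + \sum_(i < k.+1) N i)%N.
have nN k : (N k <= n k)%N.
  by rewrite /n big_ord_recr /= addnA leq_addl.
have nN1 k : (N k <= n k.+1)%N.
  by rewrite /n 2!big_ord_recr /= addnA addnAC addnA leq_addl.
have hae := @L2_ae_cvg I (fun k => u (n k)) mI (fun k => uL (n k)) (fun k => NC k _ _ (nN1 k) (nN k)).
(* The upper limit is defined and measurable everywhere, and it is the limit wherever the sequence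
   converges; this spares a modification on a null set. *)
pose lim_sup (v : nat -> R) := fine (limn_esup (EFin \o v)).
have lim_supE (v : nat -> R) : cvgn v -> v k @[k --> \oo] --> lim_sup v.
  move=> cv; suff -> : lim_sup v = limn v by [].
  have : (EFin \o v) k @[k --> \oo] --> (limn v)%:E.
    by apply: cvg_comp cv _; exact: cvg_id.
  by rewrite /lim_sup => /cvg_limn_einf_sup[_ ->].
pose g x := Complex (lim_sup (fun k => complex.Re (u (n k) x))) (lim_sup (fun k => complex.Im (u (n k) x))).
have mlim (v : nat -> R -> R) : (forall k, measurable_fun (I : set T) (v k)) ->
    measurable_fun (I : set T) (fun x => lim_sup (fun k => v k x)).
  move=> mv; apply: (measurableT_comp (fine_measurable measurableT)).
  by apply: measurable_fun_limn_esup => k; exact/measurable_EFinP.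
have mgr : measurable_fun (I : set T) (fun x => complex.Re (g x)).
  by apply: mlim => k; have [] := uL (n k).
have mgi : measurable_fun (I : set T) (fun x => complex.Im (g x)).
  by apply: mlim => k; have [] := uL (n k).
have mB m : measurable_fun (I : set T) (fun x => complex.Re (u m x - g x)) /\
            measurable_fun (I : set T) (fun x => complex.Im (u m x - g x)).
  have [mr mi _] := uL m; split.
    by under eq_fun do rewrite cReD cReN; exact: measurable_funB.
  by under eq_fun do rewrite cImD cImN; exact: measurable_funB.
(* Fatou's lemma along the subsequence carries the Cauchy bound to the limit. *)
have hcvg e m : (forall k, (m <= k)%N -> (L2_sqr I (fun x => u m x - u k x)%R <= e%:E)%E) ->
    (L2_sqr I (fun x => u m x - g x)%R <= e%:E)%E.
  move=> h; pose H k x : \bar R := (sqabs (u m x - u (n k) x))%:E.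
  have mH k : measurable_fun (I : set T) (H k).
    by have [mr mi _] := L2B mI (uL m) (uL (n k)); exact: measurable_sqabs.
  have H0 k x : (0 <= H k x)%E by rewrite lee_fin sqabs_ge0.
  have mlimH : measurable_fun (I : set T) (fun x => limn_einf (H ^~ x)).
    have -> : (fun x => limn_einf (H ^~ x)) = (fun x => - limn_esup (fun k => - H k x))%E.
      apply/funext => x; rewrite -limn_einfN; congr limn_einf.
      by apply/funext => k; rewrite /comp oppeK.
    apply: measurableT_comp => //.
    by apply: measurable_fun_limn_esup => k; exact: measurableT_comp.
  rewrite /L2_sqr (@ge0_ae_eq_integral _ _ _ mu I _ (fun x => limn_einf (H ^~ x)))//.
  - apply: le_trans (fatou mu mI mH (fun k x _ => H0 k x)) _.
    rewrite limn_einf_lim; apply: lime_le; first exact: is_cvg_einfs.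
    near=> k; apply: le_trans (_ : (\int[mu]_(x in I) H k x)%E <= _)%E.
      by apply: ereal_inf_lbound; exists k => /=.
    apply: h; rewrite (@leq_trans k)//; last exact: leq_addr.
    by near: k; exact: nbhs_infty_ge.
  - by have [mr mi] := mB m; exact: measurable_sqabs.
  - by move=> x _; rewrite lee_fin sqabs_ge0.
  - move=> x _; rewrite limn_einf_lim; apply: lime_ge; first exact: is_cvg_einfs.
    apply: nearW => k; apply: le_ereal_inf_tmp => _ [i _ <-]; exact: H0.
  - apply: filterS hae => x hx Ix; have [cr ci] := hx Ix.
    suff : H k x @[k --> \oo] --> (sqabs (u m x - g x))%:E.
      by move=> /cvg_limn_einf_sup[-> _].
    have h1 := lim_supE _ cr; have h2 := lim_supE _ ci.
    have : sqabs (u m x - u (n k) x) @[k --> \oo] --> sqabs (u m x - g x).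
      rewrite /sqabs !cReD !cImD !cReN !cImN.
      under eq_fun do rewrite !cReD !cImD !cReN !cImN.
      by apply: cvgD; rewrite !expr2; apply: cvgM; apply: cvgB => //; exact: cvg_cst.
    by move=> hc; apply: cvg_comp hc _; exact: cvg_id.
exists g; last first.
  move=> e /uC[M MC]; exists M => m Mm; apply: hcvg => k mk; apply: MC => //.
  exact: leq_trans mk.
have [M MC] := uC 1 ltr01.
have hM := hcvg 1 M (fun k Mk => MC _ _ (leqnn M) Mk).
have LB : L2 I (fun x => u M x - g x).
  have [mr mi] := mB M; split => //; apply: le_lt_trans hM _; exact: ltry.
have := L2B mI (uL M) LB; congr L2; apply/funext => x.
by rewrite opprB addrC subrK.
Unshelve. all: by end_near. Qed.

End L2Completeness.

(** * A first-order equation with resonant forcing *)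

Section FirstOrderODE.
Context {R : realType}.
Local Notation C := R[i].
Local Notation T := (measurableTypeR R).
Local Notation mu := (@lebesgue_measure R).
Implicit Types (I : set R) (u v g w : R -> C).

Lemma smooth_id : smooth (fun x : R => x).
Proof.
have d (x : R) : is_derive x 1 (fun x : R => x) (cst (1 : R) x) by exact: is_derive_id.
split=> -[|n] x; first by have [] := d x.
by rewrite /derive1n iterSr (is_derive_derive1 d); exact: (derivable_smooth (smooth_cst 1)).
Qed.

(** The function e^{- l x} u - k x has weak derivative zero. The resonant term k x e^{l x} is the
    trace that a Jordan chain would leave. *)
Lemma weak_deriv_ode I l (k : C) u : measurable (I : set T) -> open_interval I ->
  L2loc I u -> weak_deriv 1 I u (fun x => l * u x + k * cexp l x) ->
  exists c, {ae mu, forall x, I x -> u x = (c + k * x%:C%C) * cexp l x}.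
Proof.
move=> mI oI U d.
have cexpL : L2loc I (cexp l).
  by have := L2loc_cexp l (@L2loc_cst _ I 1); congr L2loc; apply/funext => x; rewrite /cst mulr1.
have G : L2loc I (fun x => l * u x + k * cexp l x).
  have := L2loc_lin l U (L2loc_lin k cexpL (@L2loc_cst _ I 0)).
  by congr L2loc; apply/funext => x; rewrite /cst addr0.
have dv := weak_deriv_cexp_mul (- l) mI U G d.
have dx := weak_deriv_mul_smooth mI (@L2loc_cst _ I 1) (@L2loc_cst _ I 0) smooth_id (weak_deriv1_cst 1 mI).
have dvE : (fun x => cexp (- l) x * (- l * u x + (l * u x + k * cexp l x))) = cst k.
  apply/funext => x; rewrite addrA mulNr addNr add0r mulrCA cexpN mulVf ?cexp_neq0//.
  by rewrite mulr1.
rewrite dvE in dv.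
have d1 : derive1 (fun x : R => x) = cst 1.
  by apply: is_derive_derive1 => x; exact: is_derive_id.
rewrite d1 in dx.
have dxE : (fun x : R => (cst 1 x)%:C%C * cst 1 x + x%:C%C * cst 0 x) = cst 1 :> (R -> C).
  by apply/funext => x; rewrite /cst mulr0 addr0 mulr1.
rewrite dxE in dx.
have XL : L2loc I (fun x => x%:C%C * cst 1 x).
  by apply: L2loc_real_mul; [exact: smooth_continuous smooth_id|exact: L2loc_cst].
have VL := L2loc_cexp (- l) U.
have dw := weak_deriv_lin (- k) mI XL VL (@L2loc_cst _ I 1) (@L2loc_cst _ I k) dx dv.
have dwE : (fun x : R => - k * cst 1 x + cst k x) = 0 :> (R -> C).
  by apply/funext => x; rewrite /cst mulr1 addNr.
rewrite dwE in dw.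
have [c hc] := weak_deriv1_ae_cst mI oI (L2loc_lin (- k) XL VL) dw.
exists c; apply: filterS hc => x hx /hx <-.
rewrite /cst mulr1 mulNr [- _ + _ + _]addrAC addNr add0r mulrAC cexpN mulVf ?cexp_neq0//.
by rewrite mul1r.
Qed.

End FirstOrderODE.

(** * Integration by parts for primitives of integrable functions *)

Section Primitive.
Context {R : realType}.
Local Notation T := (measurableTypeR R).
Local Notation mu := (@lebesgue_measure R).
Implicit Types (I : set R) (g h phi : R -> R) (b : R).

Lemma integrable_sub0 g b x : mu.-integrable `[0, b] (EFin \o g) -> x <= b ->
  mu.-integrable `[0, x] (EFin \o g).
Proof.
move=> gi xb; apply: integrableS gi => // y /=; rewrite !in_itv /= => /andP[-> yx].
exact: le_trans yx xb.
Qed.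

Lemma integrable_primitive_mul g phi b : 0 < b -> mu.-integrable `[0, b] (EFin \o g) ->
  continuous phi ->
  mu.-integrable `[0, b] (EFin \o (fun x => (\int[mu]_(t in `[0, x]) g t) * phi x)).
Proof.
move=> b0 gi cphi; apply: continuous_compact_integrable; first exact: segment_compact.
have cP := parameterized_integral_continuous (ltW b0) gi.
have c1 : {within `[0, b], continuous phi} := continuous_subspaceT cphi.
by move=> x; exact: (continuousM (cP x) (c1 x)).
Qed.

(** The failure of integration by parts. It is additive in g and bounded by the L^1 norm of g, so
    its vanishing for continuous g extends by density. *)
Let defect g phi b := \int[mu]_(x in `[0, b]) ((\int[mu]_(t in `[0, x]) g t) * derive1 phi x) -
  ((\int[mu]_(t in `[0, b]) g t) * phi b - \int[mu]_(x in `[0, b]) (g x * phi x)).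

Let defect_bound g phi b M : 0 < b -> mu.-integrable `[0, b] (EFin \o g) -> smooth phi ->
  (forall x, 0 <= x <= b -> `|phi x| <= M) -> (forall x, 0 <= x <= b -> `|derive1 phi x| <= M) ->
  `|defect g phi b| <= M * (b + 2) * \int[mu]_(x in `[0, b]) `|g x|.
Proof.
move=> b0 gi sphi M1 M2; set d := \int[mu]_(x in _) `|_|.
have mb : measurable (`[0, b] : set T) by [].
have cphi := smooth_continuous sphi; have cphi' := smooth_continuous (smooth_derive sphi).
have M0 : 0 <= M by apply: le_trans (M1 0 _) => //; rewrite lexx (ltW b0).
have absi : mu.-integrable `[0, b] (EFin \o (fun x => `|g x|)) := integrable_abse gi.
have P x : 0 <= x <= b -> `|\int[mu]_(t in `[0, x]) g t| <= d.
  move=> /andP[x0 xb]; apply: le_trans (le_normr_Rintegral _ _) _ => //.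
    exact: integrable_sub0 gi xb.
  have := @Rintegral_itvB _ (fun x => `|g x|) (BLeft 0) (BRight b) x absi.
  rewrite !bnd_simp => /(_ x0 xb) h; rewrite -subr_ge0 h; exact: Rintegral_ge0.
have i1 := integrable_primitive_mul b0 gi cphi'.
have i2 := integrableM_continuous cphi gi.
have d0 : 0 <= d by apply: Rintegral_ge0.
have h1 : `|\int[mu]_(x in `[0, b]) ((\int[mu]_(t in `[0, x]) g t) * derive1 phi x)| <= d * M * b.
  apply: le_trans (le_normr_Rintegral _ i1) _ => //.
  apply: le_trans (_ : \int[mu]_(x in `[0, b]) (d * M) <= _).
    apply: le_Rintegral => //.
    - exact: (integrable_abse i1).
    - by apply: integrable_itv_continuous => x; exact: cvg_cst.
    - move=> x; rewrite /= in_itv /= => xb; rewrite normrM ler_pM//; [exact: P|exact: M2].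
  rewrite Rintegral_cst//; have := lebesgue_measure_itv (`[0, b] : interval R).
  by rewrite /= lte_fin b0 => -> /=; rewrite subr0.
have h2 : `|\int[mu]_(x in `[0, b]) (g x * phi x)| <= d * M.
  apply: le_trans (le_normr_Rintegral _ i2) _ => //.
  rewrite /d -RintegralZr//; apply: le_Rintegral => //.
  - exact: (integrable_abse i2).
  - have := integrableZr mb M absi; apply.
  - by move=> x; rewrite /= in_itv /= => xb; rewrite normrM ler_wpM2l// M1.
have h3 : `|(\int[mu]_(t in `[0, b]) g t) * phi b| <= d * M.
  by rewrite normrM ler_pM//; [apply: P; rewrite (ltW b0) lexx|apply: M1; rewrite (ltW b0) lexx].
rewrite /defect; apply: le_trans (ler_normB _ _) _.
apply: le_trans (lerD h1 (ler_normB _ _)) _.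
apply: le_trans (lerD (lexx _) (lerD h3 h2)) _; lra.
Qed.

Let defect_continuous g phi b : 0 < b -> continuous g -> smooth phi -> defect g phi b = 0.
Proof.
move=> b0 cg sphi.
have cphi := smooth_continuous sphi; have cphi' := smooth_continuous (smooth_derive sphi).
have gi := integrable_itv_continuous 0 b cg.
pose P x := \int[mu]_(t in `[0, x]) g t.
have P0 : P 0 = 0 by rewrite /P set_itv1 Rintegral_set1.
have cP := parameterized_integral_continuous (ltW b0) gi.
have dP x : x \in `]0, b[ -> derivable P x 1 /\ derive1 P x = g x.
  rewrite in_itv /= => /andP[x0 xb]; exact: (continuous_FTC1_closed xb gi x0 (cg x)).
rewrite /defect (@Rintegration_by_parts _ P phi g (derive1 phi))//.
- by rewrite P0 mul0r subr0 subrr.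
- exact: continuous_subspaceT.
- split; first by move=> x /dP[].
  + rewrite P0; apply: cvg_at_right_filter; exact: (parameterized_integral_cvg_left b0 gi).
  + exact: (parameterized_integral_cvg_at_left b0 gi).
- by move=> x /dP[].
- exact: continuous_subspaceT.
- split; first by move=> x _; have [] := smooth_is_derive sphi x.
  + by apply: cvg_at_right_filter; exact: cphi.
  + by apply: cvg_at_left_filter; exact: cphi.
Qed.

Let defectB g h phi b : 0 < b -> mu.-integrable `[0, b] (EFin \o g) ->
  mu.-integrable `[0, b] (EFin \o h) -> smooth phi ->
  defect (fun x => g x - h x) phi b = defect g phi b - defect h phi b.
Proof.
move=> b0 gi hi sphi.
have mb (x : R) : measurable (`[0, x] : set T) by [].
have cphi := smooth_continuous sphi; have cphi' := smooth_continuous (smooth_derive sphi).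
have PB x : x <= b -> \int[mu]_(t in `[0, x]) (g t - h t) =
    \int[mu]_(t in `[0, x]) g t - \int[mu]_(t in `[0, x]) h t.
  by move=> xb; rewrite RintegralB//; [exact: integrable_sub0 gi xb|exact: integrable_sub0 hi xb].
have i1 := integrable_primitive_mul b0 gi cphi'.
have i2 := integrable_primitive_mul b0 hi cphi'.
rewrite /defect PB//.
under eq_Rintegral => x xI.
  rewrite PB; last by move: xI; rewrite inE /= in_itv /= => /andP[].
  rewrite mulrBl; over.
under [in X in _ - (_ - X)]eq_Rintegral do rewrite mulrBl.
rewrite (RintegralB (mb b) i1 i2).
rewrite (RintegralB (mb b) (integrableM_continuous cphi gi) (integrableM_continuous cphi hi)).
ring.
Qed.

Lemma primitive_by_parts g phi b : 0 < b -> mu.-integrable `[0, b] (EFin \o g) -> smooth phi ->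
  \int[mu]_(x in `[0, b]) ((\int[mu]_(t in `[0, x]) g t) * derive1 phi x) =
  (\int[mu]_(t in `[0, b]) g t) * phi b - \int[mu]_(x in `[0, b]) (g x * phi x).
Proof.
move=> b0 gi sphi; apply/eqP; rewrite -subr_eq0 -/(defect g phi b) -normr_le0.
have cphi := smooth_continuous sphi; have cphi' := smooth_continuous (smooth_derive sphi).
have bnd (f : R -> R) : continuous f -> exists M, forall x, 0 <= x <= b -> `|f x| <= M.
  move=> cf; have := @continuous_compact _ _ f `[0, b].
  move=> /(_ (continuous_subspaceT cf) (@segment_compact R 0 b)) /compact_bounded.
  move=> [M [Mr Mh]]; exists (M + 1) => x xb.
  by apply: (Mh (M + 1)); [rewrite ltrDl|exists x].
have [M1 hM1] := bnd _ cphi; have [M2 hM2] := bnd _ cphi'.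
pose M := Num.max M1 M2.
have h1 x : 0 <= x <= b -> `|phi x| <= M.
  by move=> /hM1 h; rewrite le_max h.
have h2 x : 0 <= x <= b -> `|derive1 phi x| <= M.
  by move=> /hM2 h; rewrite le_max h orbT.
have mb : measurable (`[0, b] : set T) by [].
have fb : (mu `[0%R, b] < +oo)%E.
  have := lebesgue_measure_itv (`[0, b] : interval R).
  by rewrite /= lte_fin b0 => ->; rewrite -EFinD ltry.
have [g_ [cg_ ig_ hg_]] := approximation_continuous_integrable mb fb gi.
have hn n : `|defect g phi b| <= M * (b + 2) * \int[mu]_(x in `[0, b]) `|g x - g_ n x|.
  have hi : mu.-integrable `[0, b] (EFin \o (fun x => g x - g_ n x)).
    exact: (integrableB mb gi (ig_ n)).
  apply: le_trans (defect_bound b0 hi sphi h1 h2).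
  by rewrite defectB// (defect_continuous b0 (cg_ n) sphi) subr0.
have cv : M * (b + 2) * \int[mu]_(x in `[0, b]) `|g x - g_ n x| @[n --> \oo] --> M * (b + 2) * 0.
  by apply: cvgM; [exact: cvg_cst|exact: (fine_cvg hg_)].
rewrite mulr0 in cv.
by rewrite -(cvg_lim _ cv)//; apply: limr_ge; [apply/cvg_ex; exists 0|apply: nearW].
Qed.

End Primitive.

Section ComplexPrimitive.
Context {R : realType}.
Local Notation C := R[i].
Local Notation T := (measurableTypeR R).
Local Notation mu := (@lebesgue_measure R).
Implicit Types (I : set R) (u v g w : R -> C).

(** Both edges start at 0, so integrating from 0 the extension by zero treats them alike and makes
    the value at that end 0. *)
Definition rprim I (f : R -> R) x := \int[mu]_(t in `[0, x]) (f \_ I) t.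

Definition cprim I g x : C := Complex (rprim I (fun t => complex.Re (g t)) x)
  (rprim I (fun t => complex.Im (g t)) x).

Lemma L2_patch_integrable I g b : measurable (I : set T) -> L2 I g ->
  mu.-integrable `[0, b] (EFin \o ((fun t => complex.Re (g t)) \_ I)) /\
  mu.-integrable `[0, b] (EFin \o ((fun t => complex.Im (g t)) \_ I)).
Proof.
move=> mI /(L2P _ mI)[mr mi hu].
have mb : measurable (`[0, b] : set T) by [].
have hu1 : mu.-integrable `[0, b] (EFin \o ((fun t => sqabs (g t)) \_ I)).
  move/(integrable_mkcond _ mI): hu; rewrite restrict_EFin => hu.
  by apply: integrableS hu => //; exact: measurableT.
have c1 : continuous (cst 1 : R -> R) by move=> x; exact: cvg_cst.
have hi := integrableD mb (integrable_itv_continuous 0 b c1) hu1.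
have m (f : R -> R) : measurable_fun (I : set T) f -> measurable_fun (`[0, b] : set T) (EFin \o (f \_ I)).
  by move=> mf; apply/measurable_EFinP; apply: measurable_funTS; apply/(measurable_restrictT _ mI).
split; apply: le_integrable hi => //; try exact: m;
  move=> x _ /=; rewrite lee_fin !patchE; case: ifPn => _; rewrite ?normr0//;
  rewrite [leRHS]ger0_norm ?addr_ge0 ?sqr_ge0 ?ler01//;
  by have [] := parts_le_sqabs (g x).
Qed.

Lemma rprim_by_parts I (f : R -> R) phi : I `<=` `]0, +oo[ ->
  (forall b, mu.-integrable `[0, b] (EFin \o (f \_ I))) -> test_function I phi ->
  \int[mu]_(x in I) (rprim I f x * derive1 phi x) = - \int[mu]_(x in I) (f x * phi x).
Proof.
move=> I0 fi tphi; have sphi := test_smooth tphi.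
have [_ [a [b [abI phi0]]]] := test_derivS 1 tphi; rewrite derive1n1 in phi0.
have [_ [a' [b' [abI' phi0']]]] := tphi.
(* Positive and strictly beyond the support of [phi], so the boundary term at B vanishes. *)
pose B := Num.max (Num.max b b') 0 + 1.
have bB : b <= B by rewrite /B; apply: ler_wpDr => //; rewrite !le_max lexx.
have bB' : b' < B by rewrite /B; apply: ltr_pwDr => //; rewrite !le_max lexx orbT.
have B0 : 0 < B by rewrite /B; apply: ltr_pwDr => //; rewrite !le_max lexx orbT.
have sub c d : `[c, d] `<=` I -> d <= B -> `[c, d] `<=` `[0, B].
  move=> cdI dB x xcd; have := I0 _ (cdI _ xcd); move: xcd; rewrite /= !in_itv /= andbT.
  by move=> /andP[_ xd] /ltW ->; exact: le_trans xd dB.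
have := primitive_by_parts B0 (fi B) sphi.
have -> : phi B = 0 by apply: phi0'; rewrite in_itv /= negb_and -!ltNge bB' orbT.
rewrite mulr0 sub0r => h.
rewrite (@Rintegral_support _ _ `[a, b])//; last first.
  by move=> x /negP xab; rewrite phi0 ?mulr0.
rewrite -(@Rintegral_support _ `[0, B] `[a, b]); last 2 first.
- exact: sub.
- by move=> x /negP xab; rewrite phi0 ?mulr0.
rewrite h; congr (- _).
rewrite (@Rintegral_support _ _ `[a', b'])//; last 2 first.
- by apply: sub => //; exact: ltW.
- by move=> x /negP xab; rewrite phi0' ?mulr0.
rewrite [RHS](@Rintegral_support _ _ `[a', b'])//; last first.
  by move=> x /negP xab; rewrite phi0' ?mulr0.
apply: eq_Rintegral => x; rewrite inE => xab; rewrite patchE ifT// inE; exact: abI'.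
Qed.

Lemma weak_deriv_cprim I g : measurable (I : set T) -> I `<=` `]0, +oo[ -> L2 I g ->
  weak_deriv 1 I (cprim I g) g.
Proof.
move=> mI I0 gL phi t; rewrite !cintegral_mulr expr1 mulN1r derive1n1 /=.
have fr b := (L2_patch_integrable b mI gL).1.
have fi b := (L2_patch_integrable b mI gL).2.
by rewrite !rprim_by_parts.
Qed.

Lemma rprim_within I f b : 0 <= b ->
  (forall b, mu.-integrable `[0, b] (EFin \o (f \_ I))) ->
  {within `[0, b], continuous (rprim I f)}.
Proof. by move=> b0 fi; exact: (parameterized_integral_continuous b0 (fi b)). Qed.

Lemma rprim_continuous I f x : 0 < x ->
  (forall b, mu.-integrable `[0, b] (EFin \o (f \_ I))) ->
  {for x, continuous (rprim I f)}.
Proof.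
move=> x0 fi; have x1 : 0 < x + 1 by rewrite ltr_wpDr.
have := rprim_within (ltW x1) fi => /(continuous_within_itvP _ x1)[+ _ _].
by apply; rewrite in_itv /= x0 ltrDl ltr01.
Qed.

Lemma rprim_cvg0 I f : (forall b, mu.-integrable `[0, b] (EFin \o (f \_ I))) ->
  rprim I f x @[x --> 0] --> 0.
Proof. by move=> fi; exact: (parameterized_integral_cvg_left ltr01 (fi 1)). Qed.

Lemma has_limit_continuous I x f : {for x, continuous (fun t => complex.Re (f t))} ->
  {for x, continuous (fun t => complex.Im (f t))} -> has_limit I x f (f x).
Proof. by move=> fr fi; split; apply: cvg_within_filter; [exact: fr|exact: fi]. Qed.

Lemma cprim_limit I J g x : measurable (I : set T) -> L2 I g -> 0 < x ->
  has_limit J x (cprim I g) (cprim I g x).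
Proof.
move=> mI gL x0; apply: has_limit_continuous; apply: rprim_continuous => // b.
  by have [] := L2_patch_integrable b mI gL.
by have [] := L2_patch_integrable b mI gL.
Qed.

Lemma cprim_limit0 I J g : measurable (I : set T) -> L2 I g -> has_limit J 0 (cprim I g) 0.
Proof.
move=> mI gL; split; apply: cvg_within_filter; apply: rprim_cvg0 => b.
  by have [] := L2_patch_integrable b mI gL.
by have [] := L2_patch_integrable b mI gL.
Qed.

Lemma L2loc_cprim I g : measurable (I : set T) -> I `<=` `]0, +oo[ -> L2 I g ->
  L2loc I (cprim I g).
Proof.
move=> mI I0 gL a b abI.
have fr b := (L2_patch_integrable b mI gL).1.
have fi b := (L2_patch_integrable b mI gL).2.
pose B := Num.max b 0.
have B0 : 0 <= B by rewrite le_max lexx orbT.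
have mB : measurable (`[0, B] : set T) by [].
apply: (@L2S _ `[0, B]) => //.
  move=> x xab; have := I0 _ (abI _ xab); move: xab; rewrite /= !in_itv /= andbT.
  by move=> /andP[_ xd] /ltW ->; rewrite le_max xd.
have cr := rprim_within B0 fr; have ci := rprim_within B0 fi.
apply/(L2P _ mB); split.
- exact: subspace_continuous_measurable_fun.
- exact: subspace_continuous_measurable_fun.
- apply: continuous_compact_integrable; first exact: segment_compact.
  have -> : (fun x => sqabs (cprim I g x)) =
      (fun x => rprim I (fun t => complex.Re (g t)) x * rprim I (fun t => complex.Re (g t)) x +
        rprim I (fun t => complex.Im (g t)) x * rprim I (fun t => complex.Im (g t)) x).
    by apply/funext => x; rewrite /sqabs !expr2.
  by move=> x; exact: (continuousD (continuousM (cr x) (cr x)) (continuousM (ci x) (ci x))).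
Qed.

End ComplexPrimitive.

(** * The two edges *)

Section Edges.
Context {R : realType}.
Local Notation C := R[i].
Local Notation T := (measurableTypeR R).
Local Notation mu := (@lebesgue_measure R).
Implicit Types (I : set R) (u v g w : R -> C).

Lemma open_interval_edge1 : open_interval (@edge1 R).
Proof.
(* The shift by 2 gives 1 / (n + 2) < 1 <= n + 1 already at n = 0. *)
exists (fun n => n.+2%:R^-1), (fun n => n.+1%:R); split.
- move=> n; split.
    rewrite (@lt_le_trans _ _ 1)// ?ler1n// invf_lt1 ?ltr0n// ltr1n //.
  move=> x; rewrite /edge1 /= !in_itv /= andbT => /andP[h _].
  by rewrite (lt_le_trans _ h)// invr_gt0 ltr0n.
- move=> x; rewrite /edge1 /= in_itv /= andbT => x0.
  exists (maxn (Num.bound x) (Num.bound x^-1)); rewrite in_itv /=; apply/andP; split.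
    rewrite invf_plt ?posrE ?ltr0n//.
    apply: lt_le_trans (archi_boundP _) _; first by rewrite invr_ge0 ltW.
    by rewrite ler_nat; apply: leq_trans (leq_maxr (Num.bound x) _) _; rewrite -addn2 leq_addr.
  apply: lt_le_trans (archi_boundP (ltW x0)) _.
  by rewrite ler_nat; apply: leq_trans (leq_maxl _ (Num.bound x^-1)) _.
- move=> x y; rewrite /edge1 /= !in_itv /= !andbT => x0 y0 z /=.
  by rewrite !in_itv /= andbT => /andP[xz _]; exact: lt_le_trans xz.
Qed.

Lemma open_interval_edge2 (L : R) : 0 < L -> open_interval (edge2 L).
Proof.
move=> L0.
(* The denominator starts at 3 because L / 2 on both sides would leave a single point at n = 0. *)
have e0 n : 0 < L / n.+3%:R by rewrite divr_gt0.
exists (fun n => L / n.+3%:R), (fun n => L - L / n.+3%:R); split.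
- move=> n; split.
    by rewrite ltrBrDr -mulrDl ltr_pdivrMr// -mulr2n -(mulr_natr L 2) ltr_pM2l// ltr_nat.
  move=> x; rewrite /edge2 /= !in_itv /= => /andP[h h'].
  by rewrite (lt_le_trans (e0 n) h) (le_lt_trans h')// gtrBl.
- move=> x; rewrite /edge2 /= in_itv /= => /andP[x0 xL].
  have y0 : 0 < L - x by rewrite subr_gt0.
  exists (maxn (Num.bound (L / x)) (Num.bound (L / (L - x)))); rewrite in_itv /=; apply/andP; split.
    rewrite ltr_pdivrMr// mulrC -ltr_pdivrMr//.
    apply: lt_le_trans (archi_boundP _) _; first by rewrite divr_ge0 ?ltW.
    by rewrite ler_nat; apply: leq_trans (leq_maxl _ (Num.bound (L / (L - x)))) _; rewrite -addn3 leq_addr.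
  rewrite ltrBrDr -ltrBrDl ltr_pdivrMr// mulrC -ltr_pdivrMr//.
  apply: lt_le_trans (archi_boundP _) _; first by rewrite divr_ge0 ?ltW.
  by rewrite ler_nat; apply: leq_trans (leq_maxr (Num.bound (L / x)) _) _; rewrite -addn3 leq_addr.
- move=> x y; rewrite /edge2 /= !in_itv /= => /andP[x0 xL] /andP[y0 yL] z /=.
  rewrite !in_itv /= => /andP[xz zy].
  by rewrite (lt_le_trans x0 xz) (le_lt_trans zy yL).
Qed.

Lemma edge1_pos : @edge1 R `<=` `]0, +oo[. Proof. by []. Qed.
Lemma edge2_pos (L : R) : edge2 L `<=` `]0, +oo[.
Proof. by move=> x; rewrite /edge2 /= !in_itv /= andbT => /andP[]. Qed.

(** Every neighbourhood of a meets I in a set of positive measure, so two functions equal almost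
    everywhere share points arbitrarily close to a; this makes endpoint values unique. *)
Definition endpoint_of I (a : R) := forall e, 0 < e ->
  exists c d, c < d /\ forall x, c < x < d -> I x /\ `|a - x| < e.

Lemma endpoint_edge1 : endpoint_of (@edge1 R) 0.
Proof.
move=> e e0; exists 0, e; split=> // x /andP[x0 xe]; rewrite /edge1 /= in_itv /= x0; split=> //.
by rewrite sub0r normrN gtr0_norm.
Qed.

Lemma endpoint_edge2_0 (L : R) : 0 < L -> endpoint_of (edge2 L) 0.
Proof.
move=> L0 e e0; exists 0, (Num.min e L); split=> [|x]; first by rewrite lt_min e0.
rewrite lt_min => /and3P[x0 xe xL]; rewrite /edge2 /= in_itv /= x0 xL; split=> //.
by rewrite sub0r normrN gtr0_norm.
Qed.

Lemma endpoint_edge2_L (L : R) : 0 < L -> endpoint_of (edge2 L) L.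
Proof.
move=> L0 e e0; exists (Num.max (L - e) 0), L; split=> [|x].
  by rewrite gt_max L0 gtrBl e0.
rewrite gt_max => /andP[/andP[xe x0] xL]; rewrite /edge2 /= in_itv /= x0 xL; split=> //.
by rewrite gtr0_norm ?subr_gt0// ltrBlDr -ltrBlDl.
Qed.

Lemma ae_exists_itv (P : R -> Prop) a b : {ae mu, forall x, P x} -> a < b ->
  exists2 x, a < x < b & P x.
Proof.
move=> [N [mN N0 PN]] ab; apply: contrapT => h.
have abN : `]a, b[ `<=` N.
  by move=> x xab; apply: PN => Px; apply: h; exists x => //; move: xab; rewrite /= in_itv.
have : (mu `]a, b[ <= mu N)%E by apply: le_measure; rewrite ?inE.
rewrite N0; have := lebesgue_measure_itv (`]a, b[ : interval R).
by rewrite /= lte_fin ab => ->; rewrite -EFinD lee_fin subr_le0 leNgt ab.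
Qed.

Lemma endpoint_value_ae I a f g c : endpoint_value I a f c ->
  {ae mu, forall x, I x -> f x = g x} -> endpoint_value I a g c.
Proof.
move=> [h [hc hf hl]] fg; exists h; split => //.
by apply: filterS2 hf fg => x hf fg Ix; rewrite -fg// hf.
Qed.

Lemma endpoint_value_unique I a f c d : endpoint_of I a ->
  endpoint_value I a f c -> endpoint_value I a f d -> c = d.
Proof.
move=> ea [g [_ fg [gr gi]]] [h [_ fh [hr hi]]].
have gh : {ae mu, forall x, I x -> g x = h x}.
  by apply: filterS2 fg fh => x fg fh Ix; rewrite -fg// fh.
have aux (p q : R -> R) (s t : R) : {ae mu, forall x, I x -> p x = q x} ->
    p x @[x --> within I (nbhs a)] --> s -> q x @[x --> within I (nbhs a)] --> t -> s = t.
  move=> pq ps qt; apply/eqP; rewrite -subr_eq0 -normr_le0; apply/ler_addgt0Pr => e e0.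
  rewrite add0r.
  have e2 : 0 < e / 2 by rewrite divr_gt0.
  have /cvgrPdist_lt /(_ _ e2) [r1 /= r10 h1] := ps.
  have /cvgrPdist_lt /(_ _ e2) [r2 /= r20 h2] := qt.
  have [c1 [d1 [cd1 cd]]] := ea (Num.min r1 r2) ltac:(by rewrite lt_min r10).
  have [x /cd[Ix]] := ae_exists_itv pq cd1.
  rewrite lt_min => /andP[x1 x2] /(_ Ix) pqx.
  have := ltW (h1 x x1 Ix); have := ltW (h2 x x2 Ix); rewrite pqx => k2 k1.
  by rewrite (splitr e) (le_trans (ler_distD (q x) _ _))// lerD// distrC.
apply: complex_ext; [apply: aux gr hr|apply: aux gi hi];
  by apply: filterS gh => x gh Ix; rewrite gh.
Qed.

Lemma ccontinuous_continuous I f : continuous_parts f -> ccontinuous I f.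
Proof. by move=> [fr fi] x _; apply: has_limit_continuous; [exact: fr|exact: fi]. Qed.

Lemma endpoint_value_continuous I a f : continuous_parts f -> endpoint_value I a f (f a).
Proof.
move=> cf; exists f; split; [exact: ccontinuous_continuous|exact: nearW|].
by have [fr fi] := cf; apply: has_limit_continuous; [exact: fr|exact: fi].
Qed.

Lemma continuous_L2 a b u : continuous_parts u -> L2 `[a, b] u.
Proof.
move=> [cr ci]; apply/L2P => //; split.
- by apply: measurable_funTS; exact: continuous_measurable_fun.
- by apply: measurable_funTS; exact: continuous_measurable_fun.
- apply: integrable_itv_continuous => x.
  by apply: cvgD; rewrite !expr2; apply: cvgM; [exact: cr|exact: cr|exact: ci|exact: ci].
Qed.

Lemma L2_edge2_continuous (L : R) u : continuous_parts u -> L2 (edge2 L) u.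
Proof.
move=> cu; apply: (@L2S _ `[0, L]) => //; first exact: measurable_edge2.
  exact: subset_itv_oo_cc.
exact: continuous_L2.
Qed.

Lemma cintegral_continuous_lin (L : R) (c : C) (f g : R -> C) : continuous_parts f -> continuous_parts g ->
  cintegral (edge2 L) (fun x => c * f x + g x) =
  c * cintegral (edge2 L) f + cintegral (edge2 L) g.
Proof.
have i2 (r : R -> R) : continuous r -> mu.-integrable (edge2 L) (EFin \o r).
  move=> cr; apply: integrableS (integrable_itv_continuous 0 L cr) => //.
    exact: measurable_edge2.
  exact: subset_itv_oo_cc.
by move=> [fr fi] [gr gi]; apply: cintegral_lin; [exact: measurable_edge2|exact: i2..].
Qed.

(** The product form avoids dividing by m, and follows from the fundamental theorem applied to the
    parts of e^{m x}. *)
Lemma cexp_integral_mul (m : C) (L : R) : 0 < L ->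
  m * cintegral (edge2 L) (cexp m) = cexp m L - 1.
Proof.
move=> L0.
have c0 : continuous_parts (fun=> 0 : C) by split=> x; exact: cvg_cst.
have := cintegral_continuous_lin L m (continuous_parts_cexp m) c0.
rewrite cintegral0 addr0 => <-.
have oo (f : R -> R) : continuous f -> \int[mu]_(x in edge2 L) f x = \int[mu]_(x in `[0, L]) f x.
  move=> cf; rewrite /edge2 Rintegral_itv_obnd_cbnd.
    rewrite Rintegral_itv_bndo_bndc//.
    by apply: integrableS (integrable_itv_continuous 0 L cf) => //; exact: subset_itv_co_cc.
  by apply: integrableS (integrable_itv_continuous 0 L cf) => //; exact: subset_itv_oo_cc.
have ftc (F f : R -> R) : (forall x : R, is_derive x 1 F (f x)) -> continuous f ->
    \int[mu]_(x in edge2 L) f x = F L - F 0.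
  move=> dF cf; rewrite oo// /Rintegral (@continuous_FTC2 _ f F)//.
  - exact: continuous_subspaceT.
  - have cF : continuous F.
      by move=> x; apply/differentiable_continuous/derivable1_diffP; have [] := dF x.
    split; first by move=> x _; have [] := dF x.
    + by apply: cvg_at_right_filter; exact: cF.
    + by apply: cvg_at_left_filter; exact: cF.
  - by move=> x _; rewrite derive1E; have [_ ->] := dF x.
have [crm cim] := continuous_partsZ m (continuous_parts_cexp m).
rewrite /cintegral; under eq_Rintegral do rewrite addr0.
under [X in Complex _ X]eq_Rintegral do rewrite addr0.
rewrite (ftc _ _ (is_derive_Re_cexp m) crm) (ftc _ _ (is_derive_Im_cexp m) cim).
by apply: complex_ext; rewrite ?cReD ?cImD ?cReN ?cImN -(cexp0r m).
Qed.

Lemma cexp_integral0 (L : R) : 0 < L -> cintegral (edge2 L) (cexp 0) = L%:C%C.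
Proof.
move=> L0; have -> : cexp 0 = cst (1 : C) by apply/funext => x; rewrite cexp0l.
have mL r : \int[mu]_(x in edge2 L) cst r x = r * L.
  rewrite Rintegral_cst; last exact: measurable_edge2.
  have := lebesgue_measure_itv (`]0, L[ : interval R); rewrite /= lte_fin L0 => ->.
  by rewrite /= subr0.
apply: complex_ext; first by rewrite /= mL mul1r.
by rewrite /= mL mul0r.
Qed.

Lemma cvg_expR_mul_pinfty (a : R) : a < 0 -> expR (a * x) @[x --> +oo] --> (0 : R).
Proof.
move=> a0; apply/cvgrPdist_le => e e0; near=> x.
rewrite sub0r normrN ger0_norm ?expR_ge0//.
have xa : ln e / a <= x by near: x; apply: nbhs_pinfty_ge; rewrite num_real.
rewrite -[leRHS](lnK e0) ler_expR mulrC -ler_ndivrMr//.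
Unshelve. all: by end_near. Qed.

Lemma integrable_expR_edge1 (a : R) : a < 0 ->
  mu.-integrable (@edge1 R) (EFin \o (fun x => expR (a * x))).
Proof.
move=> a0; have an0 : a != 0 by rewrite lt_eqF.
have ce : continuous (fun x : R => expR (a * x)).
  by move=> x; apply: continuous_comp; [apply: cvgM; [exact: cvg_cst|exact: cvg_id]|exact: continuous_expR].
have dF (x : R) : is_derive x 1 (fun x => a^-1 * expR (a * x)) (expR (a * x)).
  by apply: is_derive_eq; rewrite /GRing.scale /=; field.
have ey := cvg_expR_mul_pinfty a0.
have h : (\int[mu]_(x in `[0%R, +oo[) (expR (a * x))%:E = (0 : R)%:E - (a^-1 * expR (a * 0))%:E)%E.
  apply: (@ge0_continuous_FTC2y _ _ (fun x => a^-1 * expR (a * x))).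
  - by move=> x _; exact: expR_ge0.
  - exact: continuous_subspaceT.
  - rewrite -[X in _ --> X](mulr0 a^-1); by apply: cvgM; first exact: cvg_cst.
  - by move=> x _; have [] := dF x.
  - apply: cvg_at_right_filter; apply: cvgM; first exact: cvg_cst.
    exact: ce.
  - move=> x _; by rewrite derive1E; have [_ ->] := dF x.
apply/integrableP; split.
  by apply/measurable_EFinP; apply: measurable_funTS; exact: continuous_measurable_fun.
under eq_integral do rewrite /= ger0_norm ?expR_ge0//.
apply: (@le_lt_trans _ _ (\int[mu]_(x in `[0%R, +oo[) (expR (a * x))%:E)%E).
  apply: ge0_subset_integral => //; first exact: measurable_edge1.
  + by apply/measurable_EFinP; apply: measurable_funTS; exact: continuous_measurable_fun.
  + by move=> x; rewrite /edge1 /= !in_itv /= !andbT => /ltW.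
by rewrite h -EFinB ltry.
Qed.

Lemma measurable_Re_cexp I (m : C) : measurable_fun (I : set T) (fun x => complex.Re (cexp m x)).
Proof. by apply: measurable_funTS; apply: continuous_measurable_fun; exact: continuous_Re_cexp. Qed.

Lemma measurable_Im_cexp I (m : C) : measurable_fun (I : set T) (fun x => complex.Im (cexp m x)).
Proof. by apply: measurable_funTS; apply: continuous_measurable_fun; exact: continuous_Im_cexp. Qed.

Lemma cexp_parts_le (m : C) (x : R) : `|complex.Re (cexp m x)| <= expR (complex.Re m * x) /\
  `|complex.Im (cexp m x)| <= expR (complex.Re m * x).
Proof.
rewrite /= !normrM (ger0_norm (expR_ge0 _)); split; rewrite ler_piMr ?expR_ge0//.
  by rewrite ler_norml cos_geN1 cos_le1.
by rewrite ler_norml sin_geN1 sin_le1.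
Qed.

(** Limit of the formula on ]0, n + 1[, by dominated convergence with majorant e^{Re(m) x}. *)
Lemma cexp_integral_edge1_mul (m : C) : complex.Re m < 0 ->
  m * cintegral (@edge1 R) (cexp m) = -1.
Proof.
move=> m0; have g := integrable_expR_edge1 m0.
have m1 := @measurable_edge1 R.
pose fn (f : R -> R) (n : nat) := f \_ (edge2 n.+1%:R).
have sub n : edge2 n.+1%:R `<=` @edge1 R.
  by move=> x; rewrite /edge1 /edge2 /= !in_itv /= andbT => /andP[].
have fnE f n : \int[mu]_(x in @edge1 R) fn f n x = \int[mu]_(x in edge2 n.+1%:R) f x.
  rewrite (@Rintegral_support _ _ (edge2 n.+1%:R)); [|exact: sub|].
    by apply: eq_Rintegral => x xI; rewrite /fn patchE xI.
  by move=> x xI; rewrite /fn patchE memNset.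
have key (f : R -> R) : continuous f -> (forall x, `|f x| <= expR (complex.Re m * x)) ->
    \int[mu]_(x in edge2 n.+1%:R) f x @[n --> \oo] --> \int[mu]_(x in @edge1 R) f x.
  move=> cf fe.
  have -> : (fun n => \int[mu]_(x in edge2 n.+1%:R) f x) = (fun n => \int[mu]_(x in @edge1 R) fn f n x).
    by apply/funext => n; rewrite fnE.
  have mf : measurable_fun setT f by exact: continuous_measurable_fun.
  apply: (@Rdominated_cvg _ _ (fn f) f (fun x => expR (complex.Re m * x))) => //.
  - move=> n; apply: measurable_funTS; apply/(measurable_restrictT _ (measurable_edge2 _)).
    exact: measurable_funTS.
  - exact: measurable_funTS.
  - move=> x; rewrite /edge1 /= in_itv /= andbT => x0.
    apply: cvg_near_cst; near=> n.
    rewrite /fn patchE mem_set// /edge2 /= in_itv /= x0.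
    apply: lt_le_trans (archi_boundP (ltW x0)) _; rewrite ler_nat.
    by apply: leqW; near: n; exact: nbhs_infty_ge.
  - move=> n x _; rewrite /fn patchE; case: ifPn => // _.
    by rewrite normr0 expR_ge0.
have kr := key _ (@continuous_Re_cexp _ m) (fun x => (cexp_parts_le m x).1).
have ki := key _ (@continuous_Im_cexp _ m) (fun x => (cexp_parts_le m x).2).
pose J n := cintegral (edge2 n.+1%:R) (cexp m).
have JE n : m * J n = cexp m n.+1%:R - 1 by exact: cexp_integral_mul.
have e0 : expR (complex.Re m * n.+1%:R) @[n --> \oo] --> (0 : R).
  have h := cvg_expR_mul_pinfty m0.
  rewrite (cvg_shiftS (fun n => expR (complex.Re m * n%:R))).
  exact: (cvg_comp _ _ (@cvgr_idn R) h).
have z (f : nat -> R) : (forall n, `|f n| <= expR (complex.Re m * n.+1%:R)) ->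
    f n @[n --> \oo] --> (0 : R).
  move=> fe; apply/norm_cvg0P; apply: (@squeeze_cvgr _ _ _ _ (fun=> 0) (fun n => expR (complex.Re m * n.+1%:R))) => //.
    by apply: nearW => n; rewrite normr_ge0 fe.
  exact: cvg_cst.
have zr := z _ (fun n => (cexp_parts_le m n.+1%:R).1).
have zi := z _ (fun n => (cexp_parts_le m n.+1%:R).2).
have lim_unique (f : nat -> R) (x y : R) : f n @[n --> \oo] --> x -> f n @[n --> \oo] --> y -> x = y.
  by move=> fx fy; rewrite -(cvg_lim (@Rhausdorff R) fx); exact: cvg_lim.
apply: complex_ext.
- apply: (lim_unique (fun n => complex.Re (m * J n))).
    by rewrite cReM; under eq_fun do rewrite cReM; apply: cvgB; apply: cvgM => //; exact: cvg_cst.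
  rewrite (_ : (fun n => _) = (fun n => complex.Re (cexp m n.+1%:R) + complex.Re (-1 : C))).
    by rewrite -[X in _ --> X]add0r; apply: cvgD => //; exact: cvg_cst.
  by apply/funext => n; rewrite JE cReD.
- apply: (lim_unique (fun n => complex.Im (m * J n))).
    by rewrite cImM; under eq_fun do rewrite cImM; apply: cvgD; apply: cvgM => //; exact: cvg_cst.
  rewrite (_ : (fun n => _) = (fun n => complex.Im (cexp m n.+1%:R) + complex.Im (-1 : C))).
    by rewrite -[X in _ --> X]add0r; apply: cvgD => //; exact: cvg_cst.
  by apply/funext => n; rewrite JE cImD.
Unshelve. all: by end_near. Qed.

Lemma L2_edge1_cexp (m c : C) : complex.Re m < 0 -> L2 (@edge1 R) (fun x => c * cexp m x).
Proof.
move=> m0; have m1 := @measurable_edge1 R.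
have h : L2 (@edge1 R) (cexp m).
  apply/(L2P _ m1); split; [exact: measurable_Re_cexp|exact: measurable_Im_cexp|].
  have m20 : 2 * complex.Re m < 0 by rewrite pmulr_rlt0.
  have := integrable_expR_edge1 m20; congr (integrable _ _ (EFin \o _)).
  by apply/funext => x; rewrite sqabs_cexp.
have := L2_lin c m1 h (L2_0 m1).
by congr L2; apply/funext => x; rewrite /= addr0.
Qed.

(** The modulus is at least |c| on a set of infinite measure. This excludes incoming waves on the
    half-line, and every wave there when the eigenvalue is imaginary. *)
Lemma L2_edge1_growing (m c : C) (u : R -> C) : 0 <= complex.Re m -> L2 (@edge1 R) u ->
  {ae mu, forall x, edge1 x -> u x = c * cexp m x} -> c = 0.
Proof.
move=> m0 uL uE; have m1 := @measurable_edge1 R.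
have [ur ui /integrableP[mu_ fin]] := (L2P _ m1).1 uL.
apply/eqP; rewrite -sqabs_eq0; apply: contraT => c0.
have cp : 0 < sqabs c by rewrite lt_def c0 sqabs_ge0.
have : (\int[mu]_(x in @edge1 R) (sqabs c)%:E <= \int[mu]_(x in @edge1 R) `|(sqabs (u x))%:E|)%E.
  apply: ae_ge0_le_integral => //.
  - by move=> x _; rewrite lee_fin sqabs_ge0.
  - exact: measurableT_comp.
  - apply: filterS uE => x ux Ix; rewrite ux// lee_fin ger0_norm ?sqabs_ge0// sqabsM.
    rewrite ler_peMr ?sqabs_ge0// sqabs_cexp -expR0 ler_expR.
    move: Ix; rewrite /edge1 /= in_itv /= andbT => x0.
    by rewrite !mulr_ge0// ltW.
rewrite integral_cst//.
have := lebesgue_measure_itv (`]0, +oo[ : interval R).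
rewrite /= ltry => ->.
by rewrite addye// gt0_muley// => h; move: (le_lt_trans h fin); rewrite ltxx.
Qed.

End Edges.

(** * The energy space *)

Section L2Dot.
Context {R : realType}.
Local Notation C := R[i].
Local Notation T := (measurableTypeR R).
Local Notation mu := (@lebesgue_measure R).
Implicit Types (I : set R) (f g h : R -> C).

Lemma L2_mul_integrable I f g : measurable (I : set T) -> L2 I f -> L2 I g ->
  mu.-integrable I (EFin \o (fun x => complex.Re (f x * (g x)^*))) /\
  mu.-integrable I (EFin \o (fun x => complex.Im (f x * (g x)^*))).
Proof.
move=> mI /(L2P _ mI)[fr fi fL] /(L2P _ mI)[gr gi gL].
have hi := integrableD mI fL gL.
split; apply: le_integrable hi => //.
- apply/measurable_EFinP; under eq_fun do rewrite conjE cReM /= mulrN opprK.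
  by apply: measurable_funD; exact: measurable_funM.
- move=> x _ /=; rewrite lee_fin [leRHS]ger0_norm ?addr_ge0 ?sqr_ge0// conjE cReM /= /sqabs.
  move: (f x) (g x) => [a b] [c d] /=; rewrite ler_norml; apply/andP.
  have := sqr_ge0 (a + c); have := sqr_ge0 (a - c); have := sqr_ge0 (b + d); have := sqr_ge0 (b - d).
  by split; nra.
- apply/measurable_EFinP; under eq_fun do rewrite conjE cImM /= mulrN.
  by apply: measurable_funD; [apply: measurable_funN|]; exact: measurable_funM.
- move=> x _ /=; rewrite lee_fin [leRHS]ger0_norm ?addr_ge0 ?sqr_ge0// conjE cImM /= /sqabs.
  move: (f x) (g x) => [a b] [c d] /=; rewrite ler_norml; apply/andP.
  have := sqr_ge0 (a + d); have := sqr_ge0 (a - d); have := sqr_ge0 (b + c); have := sqr_ge0 (b - c).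
  by split; nra.
Qed.

Lemma L2dot_lin I c f g h : measurable (I : set T) -> L2 I f -> L2 I g -> L2 I h ->
  L2dot I (fun x => c * f x + g x) h = c * L2dot I f h + L2dot I g h.
Proof.
move=> mI fL gL hL; have [? ?] := L2_mul_integrable mI fL hL.
have [? ?] := L2_mul_integrable mI gL hL.
rewrite /L2dot -cintegral_lin//; congr cintegral; apply/funext => x.
by rewrite mulrDl mulrA.
Qed.

Lemma L2dot_conj I f g : measurable (I : set T) -> L2 I f -> L2 I g ->
  L2dot I f g = (L2dot I g f)^*.
Proof.
move=> mI fL gL; have [_ gi] := L2_mul_integrable mI gL fL.
rewrite conjE /L2dot /cintegral /=; congr Complex.
  by apply: eq_Rintegral => x _; rewrite !conjE !cReM /=; ring.
rewrite -mulN1r -RintegralZl//; apply: eq_Rintegral => x _.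
by rewrite !conjE !cImM /=; ring.
Qed.

Lemma L2dot_self I f : L2dot I f f = (\int[mu]_(x in I) sqabs (f x))%:C%C.
Proof.
rewrite /L2dot /cintegral; congr Complex.
  by apply: eq_Rintegral => x _; rewrite -sqabsE.
under eq_Rintegral do rewrite -sqabsE /=.
by rewrite /Rintegral integral0.
Qed.

Lemma L2dot_ge0 I f : 0 <= L2dot I f f.
Proof. by rewrite L2dot_self ler0c; apply: Rintegral_ge0 => x _; exact: sqabs_ge0. Qed.

Lemma L2_sqrE I f : measurable (I : set T) -> L2 I f ->
  L2_sqr I f = (complex.Re (L2dot I f f))%:E.
Proof.
move=> mI fL; have [_ _ fi] := (L2P _ mI).1 fL.
by rewrite L2dot_self /= /Rintegral fineK//; exact: integrable_fin_num.
Qed.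

Lemma L2dot_ae I f f' g g' : measurable (I : set T) -> L2 I f -> L2 I f' -> L2 I g -> L2 I g' ->
  {ae mu, forall x, I x -> f x = f' x} -> {ae mu, forall x, I x -> g x = g' x} ->
  L2dot I f g = L2dot I f' g'.
Proof.
move=> mI fL fL' gL gL' ff gg; have [? ?] := L2_mul_integrable mI fL gL.
have [? ?] := L2_mul_integrable mI fL' gL'.
by congr Complex; apply: ae_eq_Rintegral => //; apply: filterS2 ff gg => x ff gg Ix;
  rewrite ff// gg.
Qed.

Lemma L2dot_eq0 I f : measurable (I : set T) -> L2 I f -> L2dot I f f = 0 ->
  {ae mu, forall x, I x -> f x = 0}.
Proof.
move=> mI fL f0; have [mr mi _] := fL.
have : L2_sqr I f = 0%E by rewrite L2_sqrE// f0.
move=> h; have : ae_eq mu I (fun x => (sqabs (f x))%:E) (cst 0%E).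
  apply/(ae_eq_integral_abs mu mI (measurable_sqabs mr mi)); rewrite -[RHS]h /L2_sqr.
  by apply: eq_integral => x _; rewrite /= ger0_norm ?sqabs_ge0.
apply: filterS => x h0 /h0 /= [] /eqP; rewrite sqabs_eq0 => /eqP //.
Qed.

Lemma endpoint_value_cst I a (c : C) : endpoint_value I a (cst c) c.
Proof.
by apply: endpoint_value_continuous; split=> x; [exact: (cvg_cst (complex.Re c))|exact: (cvg_cst (complex.Im c))].
Qed.

End L2Dot.

Section Energy.
Context {R : realType} (L : R).
Hypothesis L_gt0 : 0 < L.
Local Notation C := R[i].
Local Notation T := (measurableTypeR R).
Local Notation mu := (@lebesgue_measure R).
Implicit Types (U V : energy L) (f g : R -> C).

Definition edge (j : bool) : set R := if j then edge2 L else @edge1 R.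
Definition on_edge (j : bool) (u : (R -> C) * (R -> C)) : R -> C := if j then u.2 else u.1.

Lemma measurable_edge j : measurable (edge j : set T).
Proof. by case: j; [exact: measurable_edge2|exact: measurable_edge1]. Qed.

Lemma open_interval_edge j : open_interval (edge j).
Proof. by case: j; [exact: open_interval_edge2|exact: open_interval_edge1]. Qed.

Lemma edge_pos j : edge j `<=` `]0, +oo[.
Proof. by case: j; [exact: edge2_pos|exact: edge1_pos]. Qed.

(* [comp false j U] is the derivative of the first component of U on edge j,
   [comp true j U] its second component. *)
Definition comp (i j : bool) U : R -> C :=
  if i then on_edge j (L2_val (repr U.2 : L2_fun L))
  else wderiv (edge j) (on_edge j (Hdot1_val (repr U.1 : Hdot1 L))).

Lemma energy_dotE U V : energy_dot L U V =
  (L2dot (edge false) (comp false false U) (comp false false V) +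
   L2dot (edge true) (comp false true U) (comp false true V)) +
  (L2dot (edge false) (comp true false U) (comp true false V) +
   L2dot (edge true) (comp true true U) (comp true true V)).
Proof. by []. Qed.

Lemma L2_fun_L2 (v : L2_fun L) j : L2 (edge j) (on_edge j (L2_val v)).
Proof. by have /asboolP[v1 v2] := valP v; case: j. Qed.

Lemma Hdot1_Hdot (u : Hdot1 L) j : Hdot 1 (edge j) (on_edge j (Hdot1_val u)).
Proof. by have /asboolP[u1 u2 _] := valP u; case: j. Qed.

Lemma Hdot1_vertex (u : Hdot1 L) : exists c, vertex_value L (Hdot1_val u) c.
Proof. by have /asboolP[] := valP u. Qed.

Lemma wderivP (u : Hdot1 L) j :
  L2 (edge j) (wderiv (edge j) (on_edge j (Hdot1_val u))) /\
  weak_deriv 1 (edge j) (on_edge j (Hdot1_val u)) (wderiv (edge j) (on_edge j (Hdot1_val u))).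
Proof.
have [_ [g gL gd]] := Hdot1_Hdot u j.
exact: (@xgetPex _ (0 : R -> C) [set g | L2 (edge j) g /\
  weak_deriv 1 (edge j) (on_edge j (Hdot1_val u)) g] (ex_intro _ g (conj gL gd))).
Qed.

Lemma wderivE (u : Hdot1 L) j g : L2 (edge j) g ->
  weak_deriv 1 (edge j) (on_edge j (Hdot1_val u)) g ->
  {ae mu, forall x, edge j x -> wderiv (edge j) (on_edge j (Hdot1_val u)) x = g x}.
Proof.
move=> gL gd; have [wL wd] := wderivP u j; have mj := measurable_edge j.
exact: (weak_deriv_unique mj (open_interval_edge j) (L2_L2loc mj wL) (L2_L2loc mj gL) wd gd).
Qed.

Lemma comp_L2 i j U : L2 (edge j) (comp i j U).
Proof. by case: i; [exact: L2_fun_L2|have [] := wderivP (repr U.1) j]. Qed.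

Lemma L2_classZ c (f : L2_fun L) : L2_class (c *: f) = c *: L2_class f.
Proof. by rewrite /L2_class -(pi_scaleq (@L2_null_scale R L)). Qed.

Lemma Hhat1_classZ c (f : Hdot1 L) : Hhat1_class (c *: f) = c *: Hhat1_class f.
Proof. by rewrite /Hhat1_class -(pi_scaleq (@P0_scale R L)). Qed.

Lemma L2_class_lin c (f g : L2_fun L) :
  L2_class (c *: f + g) = c *: L2_class f + L2_class g.
Proof. by rewrite -L2_classZ /L2_class raddfD. Qed.

Lemma Hhat1_class_lin c (f g : Hdot1 L) :
  Hhat1_class (c *: f + g) = c *: Hhat1_class f + Hhat1_class g.
Proof. by rewrite -Hhat1_classZ /Hhat1_class raddfD. Qed.

Lemma L2_class_eq (f g : L2_fun L) : L2_class f = L2_class g <->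
  forall j, {ae mu, forall x, edge j x -> on_edge j (L2_val f) x = on_edge j (L2_val g) x}.
Proof.
rewrite /L2_class; split.
  move/eqP; rewrite -Quotient.idealrBE => /asboolP[h1 h2] [].
    by apply: filterS h2 => x h /h /= /eqP; rewrite subr_eq0 => /eqP.
  by apply: filterS h1 => x h /h /= /eqP; rewrite subr_eq0 => /eqP.
move=> h; apply/eqP; rewrite -Quotient.idealrBE; apply/asboolP; split.
  by apply: filterS (h false) => x fg /fg /= /eqP; rewrite -subr_eq0 => /eqP.
by apply: filterS (h true) => x fg /fg /= /eqP; rewrite -subr_eq0 => /eqP.
Qed.

Lemma Hhat1_class_eq (f g : Hdot1 L) : Hhat1_class f = Hhat1_class g <->
  exists c, forall j, {ae mu, forall x, edge j x -> on_edge j (Hdot1_val f) x = on_edge j (Hdot1_val g) x + c}.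
Proof.
rewrite /Hhat1_class; split.
  move/eqP; rewrite -Quotient.idealrBE => /asboolP[c [h1 h2]]; exists c; case.
    by apply: filterS h2 => x h /h /= <-; rewrite addrC subrK.
  by apply: filterS h1 => x h /h /= <-; rewrite addrC subrK.
move=> [c h]; apply/eqP; rewrite -Quotient.idealrBE; apply/asboolP; exists c; split.
  apply: filterS (h false) => x fg /fg /= e.
  by have e' : (Hdot1_val f).1 x - (Hdot1_val g).1 x = c by rewrite e addrAC subrr add0r.
apply: filterS (h true) => x fg /fg /= e.
by have e' : (Hdot1_val f).2 x - (Hdot1_val g).2 x = c by rewrite e addrAC subrr add0r.
Qed.

Lemma L2_class_repr (y : L2_graph L) : L2_class (repr y) = y.
Proof. exact: reprK. Qed.

Lemma Hhat1_class_repr (y : Hhat1 L) : Hhat1_class (repr y) = y.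
Proof. exact: reprK. Qed.

Lemma comp_velocity j (x : Hhat1 L) (v : L2_fun L) :
  {ae mu, forall t, edge j t -> comp true j ((x, L2_class v) : energy L) t = on_edge j (L2_val v) t}.
Proof. by apply: (L2_class_eq _ _).1; exact: L2_class_repr. Qed.

(** The chosen representative differs from u by a constant, which the weak derivative does not
    see. *)
Lemma comp_derivative j (u : Hdot1 L) (y : L2_graph L) g : L2 (edge j) g ->
  weak_deriv 1 (edge j) (on_edge j (Hdot1_val u)) g ->
  {ae mu, forall t, edge j t -> comp false j ((Hhat1_class u, y) : energy L) t = g t}.
Proof.
move=> gL gd; apply: wderivE => //.
set r := repr _; have [c /(_ j) h] := (Hhat1_class_eq _ _).1 (Hhat1_class_repr (Hhat1_class u)).
have mj := measurable_edge j.
have gl := L2_L2loc mj gL.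
have [uL _] := Hdot1_Hdot u j; have [rL _] := Hdot1_Hdot r j.
have := weak_deriv_lin 1 mj uL (@L2loc_cst _ _ c) gl (@L2loc_cst _ _ 0) gd (weak_deriv1_cst c mj).
apply: weak_deriv_ae => //.
- exact: L2loc_lin uL (@L2loc_cst _ _ c).
- exact: L2loc_lin gl (@L2loc_cst _ _ 0).
- by apply: filterS h => x h /h ->; rewrite mul1r.
- by apply: nearW => x _; rewrite /cst mul1r addr0.
Qed.

Lemma comp_lin i j c U V :
  {ae mu, forall x, edge j x -> comp i j (c *: U + V) x = c * comp i j U x + comp i j V x}.
Proof.
have mj := measurable_edge j.
have -> : c *: U + V = (Hhat1_class (c *: (repr U.1 : Hdot1 L) + repr V.1),
                        L2_class (c *: (repr U.2 : L2_fun L) + repr V.2)) :> energy L.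
  rewrite Hhat1_class_lin L2_class_lin !L2_class_repr !Hhat1_class_repr.
  by case: U V => [? ?] [? ?].
case: i.
  have h := @comp_velocity j (Hhat1_class (c *: (repr U.1 : Hdot1 L) + repr V.1))
    (c *: (repr U.2 : L2_fun L) + repr V.2).
  apply: filterS h => x h /h ->.
  by case: j {mj h}.
have [uL ud] := wderivP (repr U.1) j; have [vL vd] := wderivP (repr V.1) j.
have [u1 _] := Hdot1_Hdot (repr U.1) j; have [v1 _] := Hdot1_Hdot (repr V.1) j.
have d := weak_deriv_lin c mj u1 v1 (L2_L2loc mj uL) (L2_L2loc mj vL) ud vd.
apply: (@comp_derivative j _ (L2_class (c *: (repr U.2 : L2_fun L) + repr V.2)) _
  (L2_lin c mj uL vL)).
rewrite (_ : on_edge j _ = fun x => c * on_edge j (Hdot1_val (repr U.1 : Hdot1 L)) x +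
  on_edge j (Hdot1_val (repr V.1 : Hdot1 L)) x); first exact: d.
by case: j {mj uL ud vL vd u1 v1 d}.
Qed.

Lemma comp_semi_lin i j c U V (h : R -> C) : L2 (edge j) h ->
  L2dot (edge j) (comp i j (c *: U + V)) h =
  c * L2dot (edge j) (comp i j U) h + L2dot (edge j) (comp i j V) h.
Proof.
move=> hL; have mj := measurable_edge j.
have cU := comp_L2 i j U; have cV := comp_L2 i j V.
have hh : {ae mu, forall x, edge j x -> h x = h x} by exact: nearW.
rewrite (L2dot_ae mj (comp_L2 i j (c *: U + V)) (L2_lin c mj cU cV) hL hL (comp_lin i j c U V) hh).
exact: L2dot_lin.
Qed.

Lemma sum4_lin (a x1 x2 x3 x4 y1 y2 y3 y4 : C) :
  ((a * x1 + y1) + (a * x2 + y2)) + ((a * x3 + y3) + (a * x4 + y4)) =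
  a * ((x1 + x2) + (x3 + x4)) + ((y1 + y2) + (y3 + y4)).
Proof. ring. Qed.

Lemma energy_semi_inner : semi_inner (energy_dot L).
Proof.
have c2 := comp_L2.
split.
- move=> a x y z; rewrite (energy_dotE (a *: x + y) z) (energy_dotE x z) (energy_dotE y z).
  rewrite (comp_semi_lin false a x y (c2 false false z)) (comp_semi_lin false a x y (c2 false true z)).
  rewrite (comp_semi_lin true a x y (c2 true false z)) (comp_semi_lin true a x y (c2 true true z)).
  exact: sum4_lin.
- move=> x y; rewrite (energy_dotE x y) (energy_dotE y x) !rmorphD.
  rewrite (L2dot_conj (measurable_edge false) (c2 false false x) (c2 false false y)).
  rewrite (L2dot_conj (measurable_edge true) (c2 false true x) (c2 false true y)).
  rewrite (L2dot_conj (measurable_edge false) (c2 true false x) (c2 true false y)).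
  by rewrite (L2dot_conj (measurable_edge true) (c2 true true x) (c2 true true y)).
- move=> x; rewrite (energy_dotE x x).
  exact: (addr_ge0 (addr_ge0 (L2dot_ge0 _ _) (L2dot_ge0 _ _)) (addr_ge0 (L2dot_ge0 _ _) (L2dot_ge0 _ _))).
Qed.

Lemma comp_dot_le i j U : complex.Re (L2dot (edge j) (comp i j U) (comp i j U)) <=
  hnorm (energy_dot L) U ^+ 2.
Proof.
rewrite hnorm_sqr; last exact: energy_semi_inner.
have p i' j' : 0 <= complex.Re (L2dot (edge j') (comp i' j' U) (comp i' j' U)).
  by have := L2dot_ge0 (edge j') (comp i' j' U); rewrite lecE => /andP[].
rewrite energy_dotE !cReD.
have le4 (a b c d : R) : 0 <= a -> 0 <= b -> 0 <= c -> 0 <= d ->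
    [/\ a <= (a + b) + (c + d), b <= (a + b) + (c + d), c <= (a + b) + (c + d) & d <= (a + b) + (c + d)].
  by move=> *; split; lra.
have [h1 h2 h3 h4] := le4 _ _ _ _ (p false false) (p false true) (p true false) (p true true).
by case: i; case: j.
Qed.

(** Vanishing derivatives make the displacement constant on each edge, and the common vertex value
    makes the two constants equal, so the class modulo constants is zero. *)
Lemma energy_eq0 U : (forall i j, {ae mu, forall x, edge j x -> comp i j U x = 0}) -> U = 0.
Proof.
move=> h.
have -> : U = (Hhat1_class (repr U.1), L2_class (repr U.2)).
  by rewrite L2_class_repr Hhat1_class_repr; case: U {h}.
have -> : 0 = (Hhat1_class 0, L2_class 0) :> energy L.
  by rewrite /Hhat1_class /L2_class !raddf0.
congr pair; last first.
  apply/L2_class_eq => j; apply: filterS (h true j) => x hx /hx.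
  by rewrite /comp => ->; case: j {h hx}.
set u : Hdot1 L := repr U.1; apply/Hhat1_class_eq.
have cst_edge j : exists c, {ae mu, forall x, edge j x -> on_edge j (Hdot1_val u) x = c}.
  have mj := measurable_edge j; have [uL _] := Hdot1_Hdot u j.
  have [wL wd] := wderivP u j.
  apply: weak_deriv1_ae_cst => //; first exact: open_interval_edge.
  apply: weak_deriv_ae wd => //; [exact: L2_L2loc|exact: (@L2loc_cst _ _ 0)|exact: nearW|exact: (h false j)].
have [c [v1 v2 v3]] := Hdot1_vertex u.
have [c1 h1] := cst_edge false; have [c2 h2] := cst_edge true.
have e1 : c = c1.
  by exact: (endpoint_value_unique (@endpoint_edge1 R) (endpoint_value_ae v1 h1) (endpoint_value_cst _ _ c1)).
have e2 : c = c2.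
  by exact: (endpoint_value_unique (endpoint_edge2_0 L_gt0) (endpoint_value_ae v2 h2) (endpoint_value_cst _ _ c2)).
exists c; case.
  by apply: filterS h2 => x h2 /h2 ->; rewrite -e2 /= add0r.
by apply: filterS h1 => x h1 /h1 ->; rewrite -e1 /= add0r.
Qed.

Lemma energy_definite U : energy_dot L U U = 0 -> U = 0.
Proof.
move=> U0; apply: energy_eq0 => i j; apply: L2dot_eq0; [exact: measurable_edge|exact: comp_L2|].
have := comp_dot_le i j U; rewrite hnorm_sqr; last exact: energy_semi_inner.
rewrite U0 => h; have := L2dot_ge0 (edge j) (comp i j U).
rewrite lecE => /andP[/eqP h2 h3]; apply: complex_ext => //=.
by apply/eqP; rewrite eq_le h.
Qed.

End Energy.

(** * Completeness of the energy space *)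

Section EnergyComplete.
Context {R : realType} (L : R).
Hypothesis L_gt0 : 0 < L.
Local Notation C := R[i].
Local Notation T := (measurableTypeR R).
Local Notation mu := (@lebesgue_measure R).
Implicit Types (I : set R) (U V : energy L) (f g h : R -> C).

Lemma rprimB I (f g : R -> R) x :
  (forall b, mu.-integrable `[0, b] (EFin \o (f \_ I))) ->
  (forall b, mu.-integrable `[0, b] (EFin \o (g \_ I))) ->
  rprim I (fun t => f t - g t) x = rprim I f x - rprim I g x.
Proof.
move=> fi gi; rewrite /rprim -RintegralB//.
by apply: eq_Rintegral => t _; rewrite !patchE; case: ifP => //; rewrite subrr.
Qed.

Lemma cprimB I f g x : measurable (I : set T) -> L2 I f -> L2 I g ->
  cprim I (fun t => f t - g t) x = cprim I f x - cprim I g x.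
Proof.
move=> mI fL gL.
have fr b := (L2_patch_integrable b mI fL).1; have fi b := (L2_patch_integrable b mI fL).2.
have gr b := (L2_patch_integrable b mI gL).1; have gi b := (L2_patch_integrable b mI gL).2.
apply: complex_ext; rewrite ?cReD ?cImD ?cReN ?cImN /= -rprimB//.
  by congr (rprim I _ x); apply/funext => t; rewrite cReD cReN.
by congr (rprim I _ x); apply/funext => t; rewrite cImD cImN.
Qed.

(** From |r| <= e + r^2 / e: the first term integrates to e x, the second to at most e, whence e (x
    + 1). *)
Lemma rprim_small I h (r : R -> R) x e : measurable (I : set T) -> L2 I h -> 0 < x -> 0 < e ->
  (L2_sqr I h <= (e ^+ 2)%:E)%E -> measurable_fun (I : set T) r ->
  (forall t, r t ^+ 2 <= sqabs (h t)) -> `|rprim I r x| <= e * (x + 1).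
Proof.
move=> mI hL x0 e0 he mr rh.
have mx : measurable (`[0, x] : set T) by [].
have ce : continuous (cst e : R -> R) by move=> ?; exact: cvg_cst.
have [_ _ hu] := (L2P _ mI).1 hL.
have hu1 : mu.-integrable `[0, x] (EFin \o ((fun t => sqabs (h t)) \_ I)).
  move/(integrable_mkcond _ mI): hu; rewrite restrict_EFin => hu1.
  by apply: integrableS hu1 => //; exact: measurableT.
have ie := integrable_itv_continuous 0 x ce.
have he1 := integrableZl mx e^-1 hu1.
have hi := integrableD mx ie he1.
have le1 t : `|(r \_ I) t| <= e + e^-1 * ((fun t => sqabs (h t)) \_ I) t.
  rewrite !patchE; case: ifPn => _; last by rewrite normr0 mulr0 addr0 ltW.
  rewrite -(ler_pM2l e0) mulrDr mulrA divff ?gt_eqF// mul1r.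
  apply: le_trans (_ : e * e + r t ^+ 2 <= _); last by rewrite lerD2l.
  rewrite -[r t ^+ 2]real_normK ?num_real//; have := sqr_ge0 (e - `|r t|).
  rewrite -{2}[e]gtr0_norm//; have := normr_ge0 (r t).
  have := mulr_ge0 (ltW e0) (normr_ge0 (r t)); rewrite sqrrB gtr0_norm//; nra.
have ri : mu.-integrable `[0, x] (EFin \o (r \_ I)).
  apply: le_integrable hi => //.
    by apply/measurable_EFinP; apply: measurable_funTS; apply/(measurable_restrictT _ mI).
  by move=> t _; rewrite /= lee_fin (le_trans (le1 t))// ler_norm.
apply: le_trans (le_normr_Rintegral mx ri) _.
apply: le_trans (le_Rintegral mx (integrable_abse ri) hi (fun t _ => le1 t)) _.
rewrite RintegralD// RintegralZl// Rintegral_cst//.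
have := lebesgue_measure_itv (`[0, x] : interval R).
rewrite /= lte_fin x0 => ->; rewrite /= subr0 mulrDr mulr1 lerD2l.
rewrite ler_pdivrMl// -expr2.
rewrite -Rintegral_mkcondr -lee_fin.
apply: le_trans he; rewrite /Rintegral fineK.
  apply: ge0_subset_integral => //.
  - exact: measurableI.
  - by have [a b _] := hL; exact: measurable_sqabs.
  - by move=> t _; rewrite lee_fin sqabs_ge0.
apply: integrable_fin_num; first exact: measurableI.
apply: integrableS hu => //; exact: measurableI.
Qed.

Lemma cprim_small I h x e : measurable (I : set T) -> L2 I h -> 0 < x -> 0 < e ->
  (L2_sqr I h <= (e ^+ 2)%:E)%E ->
  `|complex.Re (cprim I h x)| <= e * (x + 1) /\ `|complex.Im (cprim I h x)| <= e * (x + 1).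
Proof.
move=> mI hL x0 e0 he; have [mr mi _] := hL; split; apply: rprim_small he _ _ => // t.
  by rewrite lerDl sqr_ge0.
by rewrite lerDr sqr_ge0.
Qed.

Lemma endpoint_value_cprim I J x g : measurable (I : set T) -> I `<=` `]0, +oo[ -> L2 I g ->
  has_limit I x (cprim I g) J -> endpoint_value I x (cprim I g) J.
Proof.
move=> mI I0 gL h; exists (cprim I g); split => //; last exact: nearW.
by move=> t /I0; rewrite /= in_itv /= andbT => t0; exact: cprim_limit.
Qed.

(** The displacement takes the same value at both ends of the loop, so its derivative has integral
    zero. This closed condition is what a limit must keep in order to come from a function on the
    graph. *)
Lemma comp_mean0 U : cprim (edge2 L) (comp false true U) L = 0.
Proof.
have m2 := measurable_edge L true; have c2 := comp_L2 false true U.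
set g := comp false true U in c2 *.
have [uL _] := Hdot1_Hdot (repr U.1) true; have [_ wd] := wderivP (repr U.1) true.
have p2 := edge2_pos (L := L).
have dL := weak_deriv_lin (-1) m2 (L2loc_cprim m2 p2 c2) uL (L2_L2loc m2 c2) (L2_L2loc m2 c2)
  (weak_deriv_cprim m2 p2 c2) wd.
have d0 : (fun x => -1 * g x + g x) = 0 :> (R -> C).
  by apply/funext => x; rewrite mulN1r addNr.
rewrite d0 in dL.
have [c hc] := weak_deriv1_ae_cst m2 (open_interval_edge L_gt0 true)
  (L2loc_lin (-1) (L2loc_cprim m2 p2 c2) uL) dL.
have uE : {ae mu, forall x, edge2 L x -> 1 * cprim (edge2 L) g x + cst c x = on_edge true (Hdot1_val (repr U.1)) x}.
  by apply: filterS hc => x hx /hx; rewrite /cst mulN1r mul1r => <-; rewrite addNKr.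
have [v [_ v2 v3]] := Hdot1_vertex (repr U.1).
have vc a := endpoint_value_cst (edge2 L) a c.
have e0 := endpoint_value_cprim m2 p2 c2 (cprim_limit0 (edge2 L) m2 c2).
have eL := endpoint_value_cprim m2 p2 c2 (cprim_limit (edge2 L) m2 c2 L_gt0).
have h0 := endpoint_value_unique (endpoint_edge2_0 L_gt0) v2
  (endpoint_value_ae (endpoint_value_lin 1 e0 (vc 0)) uE).
have hL := endpoint_value_unique (endpoint_edge2_L L_gt0) v3
  (endpoint_value_ae (endpoint_value_lin 1 eL (vc L)) uE).
by move: hL; rewrite h0 mulr0 add0r mul1r => /esym/eqP; rewrite -subr_eq0 addrK => /eqP.
Qed.

Lemma compB i j U V :
  {ae mu, forall x, edge L j x -> comp i j (U - V) x = comp i j U x - comp i j V x}.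
Proof.
have := comp_lin L_gt0 i j (-1) V U; rewrite scaleN1r addrC.
by apply: filterS => x h /h ->; rewrite mulN1r addrC.
Qed.

Lemma L2_sqr_ae I f g : measurable (I : set T) -> L2 I f -> L2 I g ->
  {ae mu, forall x, I x -> f x = g x} -> L2_sqr I f = L2_sqr I g.
Proof. by move=> mI fL gL fg; rewrite !L2_sqrE// (@L2dot_ae _ I f g f g). Qed.

(** The four components converge separately in L^2; the displacement is then rebuilt as a primitive
    of the limit derivatives. *)
Lemma energy_complete : complete_dot (energy_dot L).
Proof.
move=> u uC.
have mj := measurable_edge L; have pj := edge_pos (L := L).
have uL i j n : L2 (edge L j) (comp i j (u n)) by exact: comp_L2.
have lim (p : bool * bool) : exists g, L2 (edge L p.2) g /\ forall e : R, 0 < e -> exists N, forall n, (N <= n)%N ->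
     (L2_sqr (edge L p.2) (fun x => comp p.1 p.2 (u n) x - g x)%R <= e%:E)%E.
  case: p => i j /=; suff [g gL gc] : exists2 g, L2 (edge L j) g & forall e : R, 0 < e ->
    exists N, forall n, (N <= n)%N -> (L2_sqr (edge L j) (fun x => comp i j (u n) x - g x)%R <= e%:E)%E
    by exists g.
  apply: L2_complete => // e e0.
  have se : 0 < Num.sqrt e by rewrite sqrtr_gt0.
  have [N NC] := uC _ se; exists N => m n Nm Nn.
  rewrite -(@L2_sqr_ae _ (comp i j (u m - u n)))//; last 3 first.
  - exact: comp_L2.
  - exact: L2B.
  - exact: compB.
  rewrite L2_sqrE//; last exact: comp_L2.
  rewrite lee_fin; apply: le_trans (comp_dot_le L_gt0 _ _ _) _.
  rewrite -[leRHS]sqr_sqrtr ?(ltW e0)// ler_pXn2r ?nnegrE ?hnorm_ge0 ?sqrtr_ge0//.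
  by apply/ltW/NC.
have [g0 hg0] := choice lim.
pose g i j := g0 (i, j).
have gL i j : L2 (edge L j) (g i j) := (hg0 (i, j)).1.
have gcvg i j := (hg0 (i, j)).2; rewrite /= in gcvg.
(* The integral over the loop is continuous for the L^2 norm, so the mean-zero condition passes to
   the limit. *)
have mean : cprim (edge2 L) (g false true) L = 0.
  have small e : 0 < e -> `|complex.Re (cprim (edge2 L) (g false true) L)| <= e * (L + 1) /\
                          `|complex.Im (cprim (edge2 L) (g false true) L)| <= e * (L + 1).
    move=> e0; have [N /(_ N (leqnn N)) NC] := gcvg false true _ (exprn_gt0 2 e0).
    have := cprim_small (mj true) (L2B (mj true) (uL false true N) (gL false true)) L_gt0 e0 NC.
    rewrite (cprimB _ (mj true) (uL false true N) (gL false true)) comp_mean0 sub0r.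
    by rewrite cReN cImN !normrN.
  have L1 : 0 < L + 1 by rewrite addr_gt0.
  by apply: complex_ext; apply/eqP; rewrite -normr_le0; apply/ler_addgt0Pr => e e0;
    have [] := small (e / (L + 1)) (divr_gt0 e0 L1); rewrite divfK ?gt_eqF// add0r.
(* The primitives vanish at 0, and the loop primitive also at L by [mean]; the vertex value is thus
   normalized to 0, as classes modulo constants allow. *)
pose w : (R -> C) * (R -> C) := (cprim (edge1) (g false false), cprim (edge2 L) (g false true)).
have wP : w \in Hdot1_pred L.
  apply/asboolP; split.
  - split; first exact: (L2loc_cprim (mj false) (pj false) (gL false false)).
    exists (g false false); first exact: (gL false false).
    exact: (weak_deriv_cprim (mj false) (pj false) (gL false false)).
  - split; first exact: (L2loc_cprim (mj true) (pj true) (gL false true)).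
    exists (g false true); first exact: (gL false true).
    exact: (weak_deriv_cprim (mj true) (pj true) (gL false true)).
  - exists 0; split.
    + apply: (endpoint_value_cprim (mj false) (pj false) (gL false false)).
      exact: (cprim_limit0 _ (mj false) (gL false false)).
    + apply: (endpoint_value_cprim (mj true) (pj true) (gL false true)).
      exact: (cprim_limit0 _ (mj true) (gL false true)).
    + apply: (endpoint_value_cprim (mj true) (pj true) (gL false true)).
      rewrite -mean; exact: (cprim_limit _ (mj true) (gL false true) L_gt0).
have vP : (g true false, g true true) \in L2_pred L.
  by apply/asboolP; split; [exact: (gL true false)|exact: (gL true true)].
pose l : energy L := (Hhat1_class (Hdot1Fun wP), L2_class (L2Fun vP)).
have lE i j : {ae mu, forall x, edge L j x -> comp i j l x = g i j x}.
  case: i.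
    have h := comp_velocity j (Hhat1_class (Hdot1Fun wP)) (L2Fun vP).
    by apply: filterS h => x h /h ->; case: j {h}.
  apply: (@comp_derivative _ _ L_gt0 j (Hdot1Fun wP) (L2_class (L2Fun vP)) _ (gL false j)).
  by case: j; [exact: (weak_deriv_cprim (mj true) (pj true) (gL false true))|
               exact: (weak_deriv_cprim (mj false) (pj false) (gL false false))].
exists l; apply/cvgrPdist_le => e e0.
have e4 : 0 < e ^+ 2 / 4 by rewrite divr_gt0// exprn_gt0.
have hN i j : \forall n \near \oo, complex.Re (L2dot (edge L j) (comp i j (u n - l)) (comp i j (u n - l))) <= e ^+ 2 / 4.
  have [N NC] := gcvg i j _ e4; exists N => // n /NC h.
  rewrite -lee_fin -L2_sqrE//; last exact: comp_L2.
  apply: le_trans h; rewrite (@L2_sqr_ae _ _ (fun x => comp i j (u n) x - g i j x))//.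
  - exact: comp_L2.
  - exact: L2B.
  - by apply: filterS2 (compB i j (u n) l) (lE i j) => x h1 h2 Ix; rewrite h1// h2.
near=> n.
rewrite sub0r normrN ger0_norm ?hnorm_ge0//.
rewrite -(@ler_pXn2r _ 2)// ?nnegrE ?hnorm_ge0 ?(ltW e0)// hnorm_sqr; last exact: (energy_semi_inner L_gt0).
rewrite energy_dotE !cReD.
have le4 (a b c d q : R) : a <= q / 4 -> b <= q / 4 -> c <= q / 4 -> d <= q / 4 ->
  (a + b) + (c + d) <= q by lra.
by apply: le4; near: n; exact: hN.
Unshelve. all: by end_near. Qed.

End EnergyComplete.

(** * Generalized eigenvectors *)

Section WaveOp.
Context {R : realType} (L : R).
Hypothesis L_gt0 : 0 < L.
Local Notation C := R[i].
Local Notation mu := (@lebesgue_measure R).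
Implicit Types (U V W X : energy L) (f g : R -> C).

Lemma ae_sym I f g : {ae mu, forall x, I x -> f x = g x} -> {ae mu, forall x, I x -> g x = f x}.
Proof. by apply: filterS => x fg Ix; rewrite fg. Qed.

Lemma ae_trans I f g h : {ae mu, forall x, I x -> f x = g x} ->
  {ae mu, forall x, I x -> g x = h x} -> {ae mu, forall x, I x -> f x = h x}.
Proof. by move=> fg gh; apply: filterS2 fg gh => x fg gh Ix; rewrite fg// gh. Qed.

(** Turns the second-order operator on classes into a first-order system for (u', v), with the
    vertex conditions as endpoint values, free of the choice of representatives. *)
Lemma wave_op_comp alpha U W : wave_op L alpha U W ->
  [/\ forall j, weak_deriv 1 (edge L j) (comp false j U) (comp true j W),
      forall j, weak_deriv 1 (edge L j) (comp true j U) (comp false j W) &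
      exists d1 d0 dL c, [/\ [/\ endpoint_value edge1 0 (comp false false U) d1,
        endpoint_value (edge2 L) 0 (comp false true U) d0 &
        endpoint_value (edge2 L) L (comp false true U) dL],
        [/\ endpoint_value edge1 0 (comp true false U) c,
            endpoint_value (edge2 L) 0 (comp true true U) c &
            endpoint_value (edge2 L) L (comp true true U) c] &
        d1 + d0 - dL = alpha%:C%C * c]].
Proof.
move=> [u [v [v' [w [vv' [UE WE] [w1 w2] [d1 [d0 [dL [c [e1 e0 eL [vc1 vc2 vc3] dc]]]]]]]]]].
have mj := measurable_edge L.
have uw j : weak_deriv 2 (edge L j) (on_edge j (Hdot1_val u)) (on_edge j (L2_val w)) by case: j.
have vE j : on_edge j (L2_val v') = on_edge j (Hdot1_val v) by rewrite vv'.
have l2 i j V : L2loc (edge L j) (comp i j V) := L2_L2loc (mj j) (comp_L2 i j V).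
have cU j g : L2 (edge L j) g -> weak_deriv 1 (edge L j) (on_edge j (Hdot1_val u)) g ->
    {ae mu, forall x, edge L j x -> comp false j U x = g x}.
  by move=> gL gd; rewrite UE; exact: (comp_derivative L_gt0 _ gL gd).
have cV j : {ae mu, forall x, edge L j x -> comp true j U x = on_edge j (Hdot1_val v) x}.
  have := comp_velocity j (Hhat1_class u) v'; rewrite -UE.
  by apply: filterS => x h /h ->; rewrite vE.
have cW j : {ae mu, forall x, edge L j x -> comp true j W x = on_edge j (L2_val w) x}.
  by rewrite WE; exact: comp_velocity.
split.
- move=> j; have [gL gd] := wderivP u j.
  have dw := weak_deriv21 gd (uw j).
  apply: (weak_deriv_ae (mj j) (L2_L2loc (mj j) gL) (l2 _ _ _)
    (L2_L2loc (mj j) (L2_fun_L2 w j)) (l2 _ _ _) (ae_sym (cU j _ gL gd)) (ae_sym (cW j)) dw).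
- move=> j; have [gL gd] := wderivP v j; have [vL _] := Hdot1_Hdot v j.
  have cf : {ae mu, forall x, edge L j x -> comp false j W x = wderiv (edge L j) (on_edge j (Hdot1_val v)) x}.
    by rewrite WE; exact: (comp_derivative L_gt0 _ gL gd).
  exact: (weak_deriv_ae (mj j) vL (l2 _ _ _) (L2_L2loc (mj j) gL) (l2 _ _ _)
    (ae_sym (cV j)) (ae_sym cf) gd).
- have ed j a d : endpoint_deriv (edge L j) a (on_edge j (Hdot1_val u)) d ->
      endpoint_value (edge L j) a (comp false j U) d.
    move=> [g [gL gd ge]]; exact: (endpoint_value_ae ge (ae_sym (cU j g gL gd))).
  exists d1, d0, dL, c; split => //.
    split; [exact: (ed false)|exact: (ed true)|exact: (ed true)].
  split; [exact: (endpoint_value_ae vc1 (ae_sym (cV false)))|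
    exact: (endpoint_value_ae vc2 (ae_sym (cV true)))|
    exact: (endpoint_value_ae vc3 (ae_sym (cV true)))].
Qed.

Lemma endpoint_value_ode I a f (l k c d : C) : endpoint_of I a ->
  {ae mu, forall x, I x -> f x = (c + k * x%:C%C) * cexp l x} ->
  endpoint_value I a f d -> d = (c + k * a%:C%C) * cexp l a.
Proof.
move=> ea fE fd; apply: (endpoint_value_unique ea (endpoint_value_ae fd fE)).
have [cr ci] := continuous_parts_cexp l.
have cl (p q : R) : continuous (fun x : R => p + q * x).
  by move=> x; apply: cvgD; [exact: cvg_cst|apply: cvgM; [exact: cvg_cst|exact: cvg_id]].
apply: (@endpoint_value_continuous R I a (fun x => (c + k * x%:C%C) * cexp l x)); split=> x.
  under eq_fun do rewrite cReM cReD cImD Re_mulr Im_mulr.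
  by apply: cvgB; apply: cvgM; [exact: cl|exact: cr|exact: cl|exact: ci].
under eq_fun do rewrite cImM cReD cImD Re_mulr Im_mulr.
by apply: cvgD; apply: cvgM; [exact: cl|exact: ci|exact: cl|exact: cr].
Qed.

(* In terms of the first components (u1', u2') and the velocities (v1, v2), a
   solution of A U = l U has v1 = u1' = A e^{lx}, v2 = a e^{lx} + b e^{-lx} and
   u2' = a e^{lx} - b e^{-lx}. *)
Definition eigenform (l A a b : C) (k : C) U : Prop :=
  forall i, {ae mu, forall x, edge1 x -> comp i false U x = k * A * cexp l x} /\
    {ae mu, forall x, edge2 L x -> comp i true U x =
       k * (a * cexp l x + (if i then b else - b) * cexp (- l) x)}.

Lemma comp0 i j : {ae mu, forall x, edge L j x -> comp i j (0 : energy L) x = 0}.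
Proof.
have := comp_lin L_gt0 i j (-1) 0 0; rewrite scaler0 addr0.
by apply: filterS => x h /h ->; rewrite mulN1r addNr.
Qed.

Lemma eigenform0 l A a b : eigenform l A a b 0 0.
Proof.
move=> i; split; [apply: filterS (comp0 i false)|apply: filterS (comp0 i true)];
  by move=> x h /h ->; rewrite !mul0r.
Qed.

Lemma eigenform_eq l A a b k U V : eigenform l A a b k U -> eigenform l A a b k V -> U = V.
Proof.
move=> hU hV; apply/eqP; rewrite -subr_eq0; apply/eqP/(energy_eq0 L_gt0) => i j.
have [u1 u2] := hU i; have [v1 v2] := hV i; have h := compB L_gt0 i j U V.
case: j h => h.
  by apply: filterS3 h u2 v2 => x h u2 v2 Ix; rewrite h// u2// v2// subrr.
by apply: filterS3 h u1 v1 => x h u1 v1 Ix; rewrite h// u1// v1// subrr.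
Qed.

Lemma eigenformZ l A a b k c U : eigenform l A a b k U -> eigenform l A a b (c * k) (c *: U).
Proof.
move=> hU i; have [u1 u2] := hU i.
have hl j := comp_lin L_gt0 i j c U 0; rewrite addr0 in hl.
split.
  by apply: filterS3 (hl false) u1 (comp0 i false) => x h u1 z Ix; rewrite h// u1// z// addr0 !mulrA.
by apply: filterS3 (hl true) u2 (comp0 i true) => x h u2 z Ix; rewrite h// u2// z// addr0 !mulrA.
Qed.

(** Here y = v + s u' solves y' = s l y + k e^{s l x}; writing s^2 = 1 handles both directions of
    propagation at once. *)
Lemma characteristic_ode j (l s k : C) U W : s * s = 1 ->
  weak_deriv 1 (edge L j) (comp false j U) (comp true j W) ->
  weak_deriv 1 (edge L j) (comp true j U) (comp false j W) ->
  {ae mu, forall x, edge L j x ->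
    (comp false j W x - l * comp false j U x) + s * (comp true j W x - l * comp true j U x) =
    k * cexp (s * l) x} ->
  exists c, {ae mu, forall x, edge L j x ->
    s * comp false j U x + comp true j U x = (c + k * x%:C%C) * cexp (s * l) x}.
Proof.
move=> s1 d1 d2 h; have mj := measurable_edge L j.
have l2 i V : L2loc (edge L j) (comp i j V) := L2_L2loc mj (comp_L2 i j V).
have dp := weak_deriv_lin s mj (l2 _ _) (l2 _ _) (l2 _ _) (l2 _ _) d1 d2.
have U1 := L2loc_lin s (l2 false U) (l2 true U).
have ce : L2loc (edge L j) (cexp (s * l)).
  by have := L2loc_cexp (s * l) (@L2loc_cst _ (edge L j) 1); congr L2loc; apply/funext => x; rewrite /cst mulr1.
have G1 := L2loc_lin (s * l) U1 (L2loc_lin k ce (@L2loc_cst _ (edge L j) 0)).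
have g0 : (fun x => s * l * (s * comp false j U x + comp true j U x) + (k * cexp (s * l) x + cst 0 x)) =
    (fun x => s * l * (s * comp false j U x + comp true j U x) + k * cexp (s * l) x).
  by apply/funext => x; rewrite /cst addr0.
rewrite g0 in G1.
have := weak_deriv_ae mj U1 U1 (L2loc_lin s (l2 true W) (l2 false W)) G1 _ _ dp.
move=> /(_ _ _)/(weak_deriv_ode mj (open_interval_edge L_gt0 j) U1); apply; first exact: nearW.
apply: filterS h => x h Ix; rewrite -h//.
set p := comp false j W x; set q := comp true j W x.
set u := comp false j U x; set v := comp true j U x.
have -> : s * l * (s * u + v) = (s * s) * (l * u) + s * (l * v) by ring.
rewrite s1; ring.
Qed.

(** One link of a Jordan chain: k is the amplitude of (A - l) U, c the velocity at the vertex, p and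
    q the amplitudes of v + u' and v - u' on the loop. The three relations are twice the continuity
    at 0, the continuity at L and the derivative condition. *)
Lemma eigenform_step alpha (l A a b k : C) U W : complex.Re l <= 0 ->
  wave_op L alpha U W -> eigenform l A a b k (W - l *: U) ->
  exists c p q, let z := cexp l L in
  [/\ [/\ forall i, {ae mu, forall x, edge1 x -> comp i false U x = (c + k * A * x%:C%C) * cexp l x},
      {ae mu, forall x, edge2 L x -> comp false true U x =
        ((p + 2 * k * a * x%:C%C) * cexp l x - (q - 2 * k * b * x%:C%C) * cexp (- l) x) / 2} &
      {ae mu, forall x, edge2 L x -> comp true true U x =
        ((p + 2 * k * a * x%:C%C) * cexp l x + (q - 2 * k * b * x%:C%C) * cexp (- l) x) / 2}],
      2 * c = p + q,
      2 * c = (p + 2 * k * a * L%:C%C) * z + (q - 2 * k * b * L%:C%C) / z &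
      2 * c + (p - q) - ((p + 2 * k * a * L%:C%C) * z - (q - 2 * k * b * L%:C%C) / z) =
        2 * alpha%:C%C * c].
Proof.
move=> l0 /wave_op_comp[d1 d2 [e1 [e0 [eL [c [[he1 he0 heL] [hc1 hc0 hcL] hv]]]]]] hX.
have two : (2 : C) != 0 by rewrite pnatr_eq0.
have X i j : {ae mu, forall x, edge L j x -> comp i j (W - l *: U) x = comp i j W x - l * comp i j U x}.
  have := comp_lin L_gt0 i j (- l) U W; rewrite scaleNr addrC.
  by apply: filterS => x h /h ->; rewrite mulNr addrC.
have Y1 i : {ae mu, forall x, edge L false x -> comp i false W x - l * comp i false U x = k * A * cexp l x}.
  exact: ae_trans (ae_sym (X i false)) (hX i).1.
have Y2 i : {ae mu, forall x, edge L true x -> comp i true W x - l * comp i true U x =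
    k * (a * cexp l x + (if i then b else - b) * cexp (- l) x)}.
  exact: ae_trans (ae_sym (X i true)) (hX i).2.
have sP : (1 : C) * 1 = 1 by rewrite mulr1.
have sN : (-1 : C) * -1 = 1 by rewrite mulrNN mulr1.
have [p1 hp1] : exists c, {ae mu, forall x, edge L false x ->
    1 * comp false false U x + comp true false U x = (c + (2 * k * A) * x%:C%C) * cexp (1 * l) x}.
  apply: (characteristic_ode sP (d1 false) (d2 false)).
  apply: filterS2 (Y1 false) (Y1 true) => x g1 g2 Ix; rewrite g1// g2// !mul1r /=; ring.
have [q1 hq1] : exists c, {ae mu, forall x, edge L false x ->
    -1 * comp false false U x + comp true false U x = (c + 0 * x%:C%C) * cexp (-1 * l) x}.
  apply: (characteristic_ode sN (d1 false) (d2 false)).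
  apply: filterS2 (Y1 false) (Y1 true) => x g1 g2 Ix; rewrite g1// g2//; ring.
have [p hp] : exists c, {ae mu, forall x, edge L true x ->
    1 * comp false true U x + comp true true U x = (c + (2 * k * a) * x%:C%C) * cexp (1 * l) x}.
  apply: (characteristic_ode sP (d1 true) (d2 true)).
  apply: filterS2 (Y2 false) (Y2 true) => x g1 g2 Ix; rewrite g1// g2// !mul1r /=; ring.
have [q hq] : exists c, {ae mu, forall x, edge L true x ->
    -1 * comp false true U x + comp true true U x = (c + (- (2 * k * b)) * x%:C%C) * cexp (-1 * l) x}.
  apply: (characteristic_ode sN (d1 true) (d2 true)).
  apply: filterS2 (Y2 false) (Y2 true) => x g1 g2 Ix; rewrite g1// g2// mulN1r /=; set e := cexp (- l) x; rewrite ?(mulN1r l) -?/e; ring.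
rewrite !mul1r in hp1 hp; rewrite !mulN1r in hq1 hq.
have m1 := @measurable_edge1 R.
(* On the half-line v - u' is a multiple of e^{- l x}, which does not decay; square integrability
   kills it, so v = u' there. *)
have q10 : q1 = 0.
  have qL : L2 (@edge1 R) (fun x => -1 * comp false false U x + comp true false U x).
    by apply: L2_lin => //; [exact: (comp_L2 false false U)|exact: (comp_L2 true false U)].
  apply: (L2_edge1_growing _ qL (m := - l)); first by rewrite cReN oppr_ge0.
  by apply: filterS hq1 => x h /h ->; rewrite mul0r addr0.
have E1 i : {ae mu, forall x, edge1 x -> comp i false U x = (p1 / 2 + k * A * x%:C%C) * cexp l x}.
  apply: filterS2 hp1 hq1 => x h1 h2 Ix; have r1 := h1 Ix; have r2 := h2 Ix.
  rewrite mul1r in r1; rewrite mulN1r q10 mul0r addr0 mul0r in r2.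
  move/eqP: r2; rewrite addrC subr_eq0 => /eqP r2.
  have -> : comp i false U x = comp false false U x by case: i.
  rewrite r2 in r1.
  apply: (mulfI two); have -> : 2 * comp false false U x = comp false false U x + comp false false U x by ring.
  by rewrite r1; field.
have ep1 : e1 = p1 / 2.
  by rewrite (endpoint_value_ode (@endpoint_edge1 R) (E1 false) he1) mulr0 addr0 cexp0r mulr1.
have cp1 : c = p1 / 2.
  by rewrite (endpoint_value_ode (@endpoint_edge1 R) (E1 true) hc1) mulr0 addr0 cexp0r mulr1.
have a1 := endpoint_value_ode (endpoint_edge2_0 L_gt0) hp (endpoint_value_lin 1 he0 hc0).
have a2 := endpoint_value_ode (endpoint_edge2_0 L_gt0) hq (endpoint_value_lin (-1) he0 hc0).
have a3 := endpoint_value_ode (endpoint_edge2_L L_gt0) hp (endpoint_value_lin 1 heL hcL).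
have a4 := endpoint_value_ode (endpoint_edge2_L L_gt0) hq (endpoint_value_lin (-1) heL hcL).
rewrite mulr0 addr0 cexp0r mulr1 mul1r in a1; rewrite mulr0 addr0 cexp0r mulr1 mulN1r in a2.
rewrite mul1r in a3; rewrite cexpN mulN1r in a4.
rewrite mulNr in a4.
exists c, p, q => z; rewrite {}/z; split.
- split.
  + by move=> i; rewrite cp1; exact: E1.
  + apply: filterS2 hp hq => x h1 h2 Ix.
    have -> : q - 2 * k * b * x%:C%C = q + - (2 * k * b) * x%:C%C by rewrite mulNr.
    by rewrite -h1// -h2//; field.
  + apply: filterS2 hp hq => x h1 h2 Ix.
    have -> : q - 2 * k * b * x%:C%C = q + - (2 * k * b) * x%:C%C by rewrite mulNr.
    by rewrite -h1// -h2//; field.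
- by rewrite -a1 -a2; ring.
- by rewrite -a3 -a4; ring.
- by rewrite -a3 -a4 -a1 -a2 -mulrA -hv ep1 cp1; ring.
Qed.

End WaveOp.

(** * The characteristic equation and the absence of Jordan chains *)

Section Eigenvalues.
Context {R : realType} (L alpha : R).
Hypothesis L_gt0 : 0 < L.
Hypothesis alpha_range : 1 < alpha < 3 \/ 3 < alpha.
Local Notation C := R[i].

(* The common value of e^{lambda L} for lambda in Sigma_pa. *)
Definition zr : R := (3 - alpha) / (1 + alpha).
Local Notation z := (zr%:C%C : C).

Lemma alpha_gt1 : 1 < alpha.
Proof. by case: alpha_range => [/andP[]//|]; lra. Qed.

Lemma zr_bounds : -1 < zr < 1.
Proof.
have a1 := alpha_gt1; have a0 : 0 < 1 + alpha by lra.
by rewrite /zr ltr_pdivlMr// ltr_pdivrMr//; apply/andP; split; lra.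
Qed.

Lemma zr_neq0 : zr != 0.
Proof.
have a1 := alpha_gt1; have a0 : 1 + alpha != 0 by apply/eqP; lra.
rewrite /zr mulf_neq0 ?invr_eq0// subr_eq0; apply/eqP => h.
by case: alpha_range; rewrite -h; lra.
Qed.

Lemma zr_char : zr * (1 + alpha) = 3 - alpha.
Proof. by have a1 := alpha_gt1; rewrite /zr divfK//; apply/eqP; lra. Qed.

Lemma cexp_2pi_int (n : int) : cexp (Complex 0 1 : C) (2 * pi * n%:~R) = 1.
Proof.
have h : cexp (Complex 0 1 : C) (2 * pi) = 1.
  by apply: complex_ext; rewrite /= mul0r expR0 !mul1r mulr_natl ?cos2pi ?sin2pi.
have hn (k : nat) : cexp (Complex 0 1 : C) (2 * pi * k%:R) = 1.
  by rewrite mulr_natr cexpM h expr1n.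
case: n => n; first exact: hn.
rewrite NegzE mulrNz mulrN.
have := cexpDr (Complex 0 1 : C) (2 * pi * n.+1%:R) (- (2 * pi * n.+1%:R)).
by rewrite hn mul1r subrr cexp0r => <-.
Qed.

(** The absolute value merges the two cases of [eig_pa]: [zr] is positive for alpha < 3 and negative
    for alpha > 3. *)
Definition abscissa : R := ln `|zr| / L.

Lemma Re_eig_pa n : complex.Re (eig_pa L alpha n) = abscissa.
Proof.
have a1 := alpha_gt1; have a0 : 0 < 1 + alpha by lra.
rewrite /eig_pa /abscissa /zr; case: ltP => a3 /=; congr (ln _ / L).
  by rewrite ger0_norm// divr_ge0 ?ltW// subr_gt0.
by rewrite normrM normfV (gtr0_norm a0) ler0_norm ?opprB// subr_le0.
Qed.

Lemma abscissa_lt0 : abscissa < 0.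
Proof.
rewrite /abscissa pmulr_llt0 ?invr_gt0// -ltr_expR expR0 lnK ?posrE ?normr_gt0 ?zr_neq0//.
by rewrite ltr_norml zr_bounds.
Qed.

Lemma expR_abscissa : expR (abscissa * L) = `|zr|.
Proof. by rewrite /abscissa divfK ?gt_eqF// lnK// posrE normr_gt0 zr_neq0. Qed.

Lemma cexp_Im (l : C) t : cexp l t = (expR (complex.Re l * t))%:C%C * cexp (Complex 0 1) (complex.Im l * t).
Proof. by apply: complex_ext; rewrite ?cReM ?cImM /= !mul0r expR0 !mul1r ?subr0 ?addr0. Qed.

Lemma cexp_eig_pa n : cexp (eig_pa L alpha n) L = z.
Proof.
have Ln : L != 0 by rewrite gt_eqF.
have a1 := alpha_gt1; have a0 : 0 < 1 + alpha by lra.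
rewrite cexp_Im Re_eig_pa expR_abscissa /eig_pa; case: ltP => a3 /=.
  rewrite divfK// cexp_2pi_int mulr1 ger0_norm// /zr divr_ge0 ?ltW// subr_gt0//.
have z0 : zr <= 0 by rewrite /zr mulr_le0_ge0 ?invr_ge0 ?(ltW a0)// subr_le0.
(* In this case the odd multiple of pi in the imaginary part supplies the negative sign of [zr]. *)
rewrite divfK// mulrDl mul1r [2 * _ * pi]mulrAC cexpDr cexp_2pi_int mul1r ler0_norm//.
have -> : cexp (Complex 0 1) pi = -1 :> C.
  by apply: complex_ext; rewrite /= mul0r expR0 !mul1r ?cospi ?sinpi ?oppr0.
by rewrite mulrN1 rmorphN opprK.
Qed.

Lemma real_complex_eq0 (r : R) : (r%:C%C == 0 :> C) = (r == 0).
Proof. by rewrite -(rmorph0 (real_complex R)) (inj_eq (@complexI R)). Qed.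

Lemma z_neq0 : z != 0. Proof. by rewrite real_complex_eq0 zr_neq0. Qed.

Lemma oneBz_neq0 : 1 - z != 0.
Proof.
have /andP[_ h] := zr_bounds.
have -> : 1 - z = (1 - zr)%:C%C by rewrite rmorphB rmorph1.
by rewrite real_complex_eq0 subr_eq0 gt_eqF.
Qed.

Lemma L_neq0 : (L%:C)%C != 0 :> C. Proof. by rewrite real_complex_eq0 gt_eqF. Qed.

(** The two continuity relations factor as (1 - z) (z (p + 2 k L) - q) = 0. Substituting q in the
    derivative condition, the terms in p cancel by z (1 + alpha) = 3 - alpha and 2 k L z (1 + alpha)
    = 0 remains: the chain has no further link. *)
Lemma pa_algebra (c p q k : C) :
  2 * c = p + q ->
  2 * c = (p + 2 * k * 1 * L%:C%C) * z + (q - 2 * k * z * L%:C%C) / z ->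
  2 * c + (p - q) - ((p + 2 * k * 1 * L%:C%C) * z - (q - 2 * k * z * L%:C%C) / z) =
        2 * alpha%:C%C * c ->
  k = 0 /\ q = z * p.
Proof.
have zn := z_neq0; have z1 := oneBz_neq0; have ln := L_neq0.
have an : (1 + alpha%:C%C : C) != 0.
  have -> : (1 + alpha%:C%C : C) = (1 + alpha)%:C%C by rewrite rmorphD rmorph1.
  by have a1 := alpha_gt1; rewrite real_complex_eq0; apply/eqP; lra.
have two : (2 : C) != 0 by rewrite pnatr_eq0.
have zc : z * (1 + alpha%:C%C) = 3 - alpha%:C%C.
  have := congr1 (real_complex R) zr_char; rewrite /= rmorphM rmorphD rmorphB rmorph1 => ->.
  by congr (_ - _); rewrite rmorph_nat.
set l := (L%:C)%C in ln *; set a := alpha%:C%C in an zc *.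
move=> e1 e2 e3.
have eq : q = z * (p + 2 * k * l).
  apply/esym/eqP; rewrite -subr_eq0 -(mulrI_eq0 _ (lregP z1)).
  have -> : (1 - z) * (z * (p + 2 * k * l) - q) =
    z * ((p + q) - ((p + 2 * k * 1 * l) * z + (q - 2 * k * z * l) / z)) by field.
  by rewrite -e2 e1 subrr mulr0.
have k0 : k = 0.
  have h : 2 * k * l * z * (1 + a) = 0.
    have -> : 2 * k * l * z * (1 + a) = p * (3 - a - z * (1 + a)) -
      ((p + q) + (p - q) - ((p + 2 * k * 1 * l) * z - (q - 2 * k * z * l) / z) - a * (p + q)).
      by rewrite eq; field.
    by rewrite zc subrr mulr0 -e1 e3; ring.
  move/eqP: h; rewrite !mulf_eq0 (negbTE two) (negbTE ln) (negbTE zn) (negbTE an) !orbF /=.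
  by move/eqP.
by split=> //; rewrite eq k0 mulr0 mul0r addr0.
Qed.

(** By induction (A - l) x is a multiple of the eigenfunction, and the algebra forces that multiple
    to be zero: generalized eigenspaces are at most lines. *)
Lemma ker_power_eigenform_pa (l : C) k (x : energy L) : complex.Re l <= 0 -> cexp l L = z ->
  in_ker_power (wave_op L alpha) l k x -> exists c, eigenform l (1 + z) 1 z c x.
Proof.
move=> l0 lz; elim: k x => [|k IH] x /=; first by move=> ->; exists 0; exact: eigenform0.
move=> [y [xy /IH [c hc]]].
have [d [p [q [[h1 h2 h3] e1 e2 e3]]]] := eigenform_step L_gt0 l0 xy hc.
rewrite lz in e2 e3; have [c0 qp] := pa_algebra e1 e2 e3.
have two : (2 : C) != 0 by rewrite pnatr_eq0.
have dE : d = p / 2 * (1 + z).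
  by apply: (mulfI two); rewrite e1 qp; field.
exists (p / 2) => i; split.
  by apply: filterS (h1 i) => t h /h ->; rewrite dE c0 !mul0r addr0.
case: i.
  by apply: filterS h3 => t h /h ->; rewrite qp c0; field.
by apply: filterS h2 => t h /h ->; rewrite qp c0; field.
Qed.

Lemma Sigma_pP (l : C) : Sigma_p L l -> complex.Re l = 0 /\ cexp l L = 1.
Proof.
move=> [n _ <-]; split => //=.
by rewrite cexp_Im /= mul0r expR0 mul1r divfK ?gt_eqF// cexp_2pi_int.
Qed.

(** With e^{l L} = 1 the factorization used for Sigma_pa degenerates; instead the half-line
    component vanishes, hence q = - p, and continuity at L leaves 4 c L = 0. *)
Lemma ker_power_eigenform_p (l : C) k (x : energy L) : complex.Re l = 0 -> cexp l L = 1 ->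
  in_ker_power (wave_op L alpha) l k x -> exists c, eigenform l 0 1 (-1) c x.
Proof.
move=> l0 lz; elim: k x => [|k IH] x /=; first by move=> ->; exists 0; exact: eigenform0.
move=> [y [xy /IH [c hc]]].
have l0' : complex.Re l <= 0 by rewrite l0.
have [d [p [q [[h1 h2 h3] e1 e2 e3]]]] := eigenform_step L_gt0 l0' xy hc.
have two : (2 : C) != 0 by rewrite pnatr_eq0.
(* On the half-line e^{l x} has modulus 1, hence is not square integrable. *)
have d0 : d = 0.
  apply: (@L2_edge1_growing _ l d (comp false false x)); first by rewrite l0.
    exact: (comp_L2 false false x).
  by apply: filterS (h1 false) => t h /h ->; rewrite mulr0 mul0r addr0.
rewrite lz d0 mulr0 in e1 e2.
have qp : q = - p by apply/eqP; rewrite -addr_eq0 addrC -e1.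
have ln := L_neq0.
have c0 : c = 0.
  have : 4 * c * L%:C%C = 0 by rewrite [RHS]e2 qp; field.
  by move/eqP; rewrite !mulf_eq0 (negbTE ln) pnatr_eq0 orbF /= => /eqP.
exists (p / 2) => i; split.
  by apply: filterS (h1 i) => t h /h ->; rewrite d0 c0 !mulr0 !mul0r addr0 mul0r.
case: i.
  by apply: filterS h3 => t h /h ->; rewrite qp c0; field.
by apply: filterS h2 => t h /h ->; rewrite qp c0; field.
Qed.

End Eigenvalues.

Section ExponentialPairs.
Context {R : realType}.
Local Notation C := R[i].
Local Notation T := (measurableTypeR R).
Implicit Types (I : set R) (f g : R -> C).

Definition exp_pair (a b l : C) (x : R) : C := a * cexp l x + b * cexp (- l) x.

Lemma exp_pair_continuous a b l : continuous_parts (exp_pair a b l).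
Proof.
by apply: continuous_partsD; apply: continuous_partsZ; exact: continuous_parts_cexp.
Qed.

Lemma exp_pair_L2 a b l (L : R) : L2 (edge2 L) (exp_pair a b l).
Proof. exact: L2_edge2_continuous (exp_pair_continuous a b l). Qed.

Lemma exp_pair_L2loc I a b l : L2loc I (exp_pair a b l).
Proof. move=> c d _; exact: continuous_L2 (exp_pair_continuous a b l). Qed.

Lemma weak_deriv_exp_pair I a b l : measurable (I : set T) ->
  weak_deriv 1 I (exp_pair a b l) (exp_pair (a * l) (- (b * l)) l).
Proof.
move=> mI.
have z0 : weak_deriv 1 I 0 (0 : R -> C) by exact: weak_deriv0.
have cl m : L2loc I (fun x => m * cexp m x : C).
  by have := @exp_pair_L2loc I m 0 m; congr L2loc; apply/funext => x; rewrite /exp_pair mul0r addr0.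
have c1 m : L2loc I (cexp m : R -> C).
  by have := @exp_pair_L2loc I 1 0 m; congr L2loc; apply/funext => x; rewrite /exp_pair mul0r addr0 mul1r.
have zl : L2loc I (0 : R -> C) := @L2loc_cst _ I 0.
have d1 := weak_deriv_lin b mI (c1 (- l)) zl (cl (- l)) zl (weak_deriv_cexp (- l) mI) z0.
have d2 := weak_deriv_lin a mI (c1 l) (L2loc_lin b (c1 (- l)) zl) (cl l) (L2loc_lin b (cl (- l)) zl)
  (weak_deriv_cexp l mI) d1.
by move: d2; congr weak_deriv; apply/funext => x; rewrite /exp_pair /= ?addr0//; ring.
Qed.

Lemma endpoint_value_exp_pair I x a b l :
  endpoint_value I x (exp_pair a b l) (exp_pair a b l x).
Proof. exact: endpoint_value_continuous (exp_pair_continuous a b l). Qed.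

Lemma exp_pair_edge1_L2 (A l : C) : complex.Re l < 0 -> L2 (@edge1 R) (exp_pair A 0 l).
Proof.
move=> l0; have := L2_edge1_cexp A l0.
by congr L2; apply/funext => x; rewrite /exp_pair mul0r addr0.
Qed.

Lemma exp_pairZ c a b l x : exp_pair (c * a) (c * b) l x = c * exp_pair a b l x.
Proof. by rewrite /exp_pair; ring. Qed.

End ExponentialPairs.

(** * Construction of eigenvectors *)

Section Eigenvector.
Context {R : realType} (L alpha : R).
Hypothesis L_gt0 : 0 < L.
Local Notation C := R[i].
Variables (l A a b : C).
Hypothesis Re_l : complex.Re l < 0.
Hypothesis A0 : A = a + b.
Hypothesis AL : A = a * cexp l L + b / cexp l L.
Hypothesis vertex : A + (a - b) - (a * cexp l L - b / cexp l L) = alpha%:C%C * A.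

Let l_neq0 : l != 0.
Proof. by apply/eqP => l0; move: Re_l; rewrite l0 ltxx. Qed.

(** Displacement, velocity and second derivative of the displacement all belong to this family, with
    c equal to l^-1, 1 and l. *)
Let graph c : (R -> C) * (R -> C) := (exp_pair (c * A) 0 l, exp_pair (c * a) (c * b) l).

Let graph_L2 c : graph c \in L2_pred L.
Proof. by apply/asboolP; split; [exact: exp_pair_edge1_L2|exact: exp_pair_L2]. Qed.

Let graph_vertex c : vertex_value L (graph c) (c * A).
Proof.
have e1 := @endpoint_value_exp_pair R edge1 0 (c * A) 0 l.
have e2 := @endpoint_value_exp_pair R (edge2 L) 0 (c * a) (c * b) l.
have e3 := @endpoint_value_exp_pair R (edge2 L) L (c * a) (c * b) l.
split.
- by move: e1; congr endpoint_value; rewrite /exp_pair cexp0r mulr1 mul0r addr0.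
- by move: e2; congr endpoint_value; rewrite /exp_pair !cexp0r A0; ring.
- by move: e3; congr endpoint_value; rewrite /exp_pair AL cexpN; ring.
Qed.

Let graph_Hdot1 c : graph c \in Hdot1_pred L.
Proof.
apply/asboolP; split.
- split; first exact: exp_pair_L2loc.
  exists (exp_pair (c * A * l) (- (0 * l)) l).
    by rewrite mul0r oppr0; exact: exp_pair_edge1_L2.
  exact: (weak_deriv_exp_pair _ _ _ (@measurable_edge1 R)).
- split; first exact: exp_pair_L2loc.
  exists (exp_pair (c * a * l) (- (c * b * l)) l); first exact: exp_pair_L2.
  exact: (weak_deriv_exp_pair _ _ _ (measurable_edge2 L)).
- by exists (c * A); exact: graph_vertex.
Qed.

Let hfun c : Hdot1 L := Hdot1Fun (graph_Hdot1 c).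
Let lfun c : L2_fun L := L2Fun (graph_L2 c).

Let hfunZ c : Hhat1_class (hfun (l * c)) = l *: Hhat1_class (hfun c).
Proof.
rewrite -Hhat1_classZ; congr Hhat1_class; apply: val_inj => /=.
congr pair; apply/funext => x.
  by transitivity (l * exp_pair (c * A) 0 l x) => //; rewrite -exp_pairZ; congr exp_pair; ring.
by transitivity (l * exp_pair (c * a) (c * b) l x) => //; rewrite -exp_pairZ; congr exp_pair; ring.
Qed.

Let lfunZ c : L2_class (lfun (l * c)) = l *: L2_class (lfun c).
Proof.
rewrite -L2_classZ; congr L2_class; apply: val_inj => /=.
congr pair; apply/funext => x.
  by transitivity (l * exp_pair (c * A) 0 l x) => //; rewrite -exp_pairZ; congr exp_pair; ring.
by transitivity (l * exp_pair (c * a) (c * b) l x) => //; rewrite -exp_pairZ; congr exp_pair; ring.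
Qed.

Lemma eigenvector_exists : exists U : energy L,
  wave_op L alpha U (l *: U) /\ eigenform l A a b 1 U.
Proof.
pose U : energy L := (Hhat1_class (hfun l^-1), L2_class (lfun 1)).
have m1 := @measurable_edge1 R; have m2 := measurable_edge2 L.
have lV : l * l^-1 = 1 by rewrite mulfV.
have d1 : weak_deriv 1 edge1 (exp_pair (l^-1 * A) 0 l) (exp_pair A 0 l).
  by have := weak_deriv_exp_pair (l^-1 * A) 0 l m1; rewrite mul0r oppr0 mulrAC mulVf// mul1r.
have d2 : weak_deriv 1 (edge2 L) (exp_pair (l^-1 * a) (l^-1 * b) l) (exp_pair a (- b) l).
  have := weak_deriv_exp_pair (l^-1 * a) (l^-1 * b) l m2.
  by rewrite [l^-1 * a * l]mulrAC mulVf// [l^-1 * b * l]mulrAC mulVf// !mul1r.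
have d11 : weak_deriv 1 edge1 (exp_pair A 0 l) (exp_pair (l * A) 0 l).
  by have := weak_deriv_exp_pair A 0 l m1; rewrite mul0r oppr0 (mulrC A l).
have d22 : weak_deriv 1 (edge2 L) (exp_pair a (- b) l) (exp_pair (l * a) (l * b) l).
  have := weak_deriv_exp_pair a (- b) l m2.
  by rewrite mulNr opprK (mulrC b l) (mulrC a l).
exists U; split.
  exists (hfun l^-1), (hfun 1), (lfun 1), (lfun l); split.
  - by [].
  - split=> //; rewrite /U; congr pair.
      by rewrite /= -hfunZ lV.
    by rewrite /= -lfunZ mulr1.
  - by split; [exact: weak_deriv11 d1 d11|exact: weak_deriv11 d2 d22].
  - have e1 := @endpoint_value_exp_pair R edge1 0 A 0 l.
    have e2 := @endpoint_value_exp_pair R (edge2 L) 0 a (- b) l.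
    have e3 := @endpoint_value_exp_pair R (edge2 L) L a (- b) l.
    exists A, (a - b), (a * cexp l L - b / cexp l L), A; split => //.
    + exists (exp_pair A 0 l); split=> //; first exact: exp_pair_edge1_L2.
      by move: e1; congr endpoint_value; rewrite /exp_pair cexp0r mulr1 mul0r addr0.
    + exists (exp_pair a (- b) l); split=> //; first exact: exp_pair_L2.
      by move: e2; congr endpoint_value; rewrite /exp_pair !cexp0r; ring.
    + exists (exp_pair a (- b) l); split=> //; first exact: exp_pair_L2.
      by move: e3; congr endpoint_value; rewrite /exp_pair cexpN; ring.
    + by have := graph_vertex 1; rewrite mul1r.
move=> [].
  have v j := comp_velocity j (Hhat1_class (hfun l^-1)) (lfun 1).
  split.
    by apply: filterS (v false) => x h /h ->; rewrite /= /exp_pair; ring.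
  by apply: filterS (v true) => x h /h ->; rewrite /= /exp_pair; ring.
have f1 := @comp_derivative R L L_gt0 false (hfun l^-1) (L2_class (lfun 1)) _
  (exp_pair_edge1_L2 A Re_l) d1.
have f2 := @comp_derivative R L L_gt0 true (hfun l^-1) (L2_class (lfun 1)) _
  (exp_pair_L2 a (- b) l L) d2.
split.
  by apply: filterS f1 => x h /h ->; rewrite /= /exp_pair; ring.
by apply: filterS f2 => x h /h ->; rewrite /= /exp_pair; ring.
Qed.

End Eigenvector.

(** * Pairings of eigenfunctions *)

Section Pairings.
Context {R : realType} (L : R).
Hypothesis L_gt0 : 0 < L.
Local Notation C := R[i].
Local Notation mu := (@lebesgue_measure R).
Implicit Types (U V : energy L) (f g : R -> C).

Local Notation J := (fun m : C => cintegral (edge2 L) (cexp m)).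

Lemma edge2_dot_cexp (c c' l l' : C) :
  L2dot (edge2 L) (fun x => c * cexp l x) (fun x => c' * cexp l' x) = c * c'^* * J (l + l'^*).
Proof.
have c0 : continuous_parts (fun=> 0 : C) by split=> x; exact: cvg_cst.
have := cintegral_continuous_lin L (c * c'^*) (continuous_parts_cexp (l + l'^*)) c0.
rewrite cintegral0 addr0 => <-; congr cintegral; apply/funext => x.
by rewrite addr0 rmorphM /= cexpDl cexp_conj; ring.
Qed.

Lemma edge2_dot_exp_pair (a b a' b' l l' : C) :
  L2dot (edge2 L) (exp_pair a b l) (exp_pair a' b' l') =
  a * a'^* * J (l + l'^*) + a * b'^* * J (l - l'^*) +
  b * a'^* * J (- l + l'^*) + b * b'^* * J (- l - l'^*).
Proof.
have cc := @continuous_parts_cexp R.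
have c0 : continuous_parts (fun=> 0 : C) by split=> x; exact: cvg_cst.
have c1 := continuous_partsD (continuous_partsZ (b * b'^*) (cc (- l - l'^*))) c0.
have c2 := continuous_partsD (continuous_partsZ (b * a'^*) (cc (- l + l'^*))) c1.
have c3 := continuous_partsD (continuous_partsZ (a * b'^*) (cc (l - l'^*))) c2.
have h := cintegral_continuous_lin L (a * a'^*) (cc (l + l'^*)) c3.
rewrite (cintegral_continuous_lin L (a * b'^*) (cc (l - l'^*)) c2) in h.
rewrite (cintegral_continuous_lin L (b * a'^*) (cc (- l + l'^*)) c1) in h.
rewrite (cintegral_continuous_lin L (b * b'^*) (cc (- l - l'^*)) c0) cintegral0 addr0 !addrA in h.
rewrite -h; congr cintegral; apply/funext => x.
have cN : cexp (- l'^*) x = (cexp (- l') x)^* by rewrite -cexp_conj rmorphN.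
by rewrite /exp_pair rmorphD !rmorphM /= !cexpDl cN cexp_conj; ring.
Qed.

(** The mixed terms in a conj b' and b conj a' cancel between derivative and velocity, where b
    enters with opposite signs. *)
Lemma edge2_dot_eigenform (l l' A A' a a' b b' k k' : C) U V :
  eigenform l A a b k U -> eigenform l' A' a' b' k' V ->
  L2dot (edge L true) (comp false true U) (comp false true V) +
  L2dot (edge L true) (comp true true U) (comp true true V) =
  k * k'^* * (2 * (a * a'^* * J (l + l'^*) + b * b'^* * J (- (l + l'^*)))).
Proof.
move=> hU hV; have m2 := measurable_edge L true.
have e i : L2dot (edge L true) (comp i true U) (comp i true V) =
    L2dot (edge2 L) (exp_pair (k * a) (k * (if i then b else - b)) l)
      (exp_pair (k' * a') (k' * (if i then b' else - b')) l').
  apply: (L2dot_ae m2 (comp_L2 i true U) (exp_pair_L2 _ _ _ _) (comp_L2 i true V) (exp_pair_L2 _ _ _ _)).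
    by have [_ h] := hU i; apply: filterS h => x h /h ->; rewrite exp_pairZ.
  by have [_ h] := hV i; apply: filterS h => x h /h ->; rewrite exp_pairZ.
rewrite (e false) (e true) !edge2_dot_exp_pair opprD.
set j1 := J _; set j2 := J _; set j3 := J _; set j4 := J _.
by rewrite !rmorphM !rmorphN; ring.
Qed.

Lemma edge1_dot_eigenform (l l' A A' a a' b b' k k' : C) i U V :
  complex.Re l < 0 -> complex.Re l' < 0 ->
  eigenform l A a b k U -> eigenform l' A' a' b' k' V ->
  L2dot (edge L false) (comp i false U) (comp i false V) =
  k * A * (k' * A')^* * (- (l + l'^*)^-1).
Proof.
move=> l0 l0' hU hV; have m1 := measurable_edge L false.
have L1 := L2_edge1_cexp (k * A) l0; have L1' := L2_edge1_cexp (k' * A') l0'.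
have [u1 _] := hU i; have [v1 _] := hV i.
rewrite (L2dot_ae m1 (comp_L2 i false U) L1 (comp_L2 i false V) L1' u1 v1).
have m0 : complex.Re (l + l'^*) < 0 by rewrite cReD conjE /=; lra.
have mn0 : l + l'^* != 0 by apply/eqP => h; move: m0; rewrite h ltxx.
have hm : cintegral edge1 (cexp (l + l'^*)) = - (l + l'^*)^-1.
  by apply: (mulfI mn0); rewrite cexp_integral_edge1_mul// mulrN mulfV.
have e1 := L2_edge1_cexp 1 l0; have e1' := L2_edge1_cexp 1 l0'.
have [i1 i2] := L2_mul_integrable m1 e1 e1'.
have eq1 : (fun x : R => 1 * cexp l x * (1 * cexp l' x)^*) = cexp (l + l'^*).
  by apply/funext => x; rewrite !mul1r cexpDl cexp_conj.
have z0 := integrable0 mu (edge L false).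
have := @cintegral_lin R edge1 (k * A * (k' * A')^*) (fun x => 1 * cexp l x * (1 * cexp l' x)^*)
  (fun=> 0) m1 i1 i2 z0 z0.
rewrite cintegral0 addr0 eq1 hm => <-; congr cintegral; apply/funext => x.
by rewrite addr0 !mul1r !rmorphM /=; ring.
Qed.

Lemma edge1_dot_eigenform0 (l l' A a a' b b' k k' : C) i U V :
  eigenform l A a b k U -> eigenform l' 0 a' b' k' V ->
  L2dot (edge L false) (comp i false U) (comp i false V) = 0.
Proof.
move=> hU hV; have m1 := measurable_edge L false.
have [v1 _] := hV i.
have v0 : {ae mu, forall x, edge L false x -> comp i false V x = (fun=> 0 : C) x}.
  by apply: filterS v1 => x h /h ->; rewrite mulr0 mul0r.
have u0 : {ae mu, forall x, edge L false x -> comp i false U x = comp i false U x} by exact: nearW.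
rewrite (L2dot_ae m1 (comp_L2 i false U) (comp_L2 i false U) (comp_L2 i false V) (L2_0 m1) u0 v0).
rewrite /L2dot; under eq_fun do rewrite rmorph0 mulr0.
exact: cintegral0.
Qed.

Lemma energy_dotE' U V : energy_dot L U V =
  (L2dot (edge L false) (comp false false U) (comp false false V) +
   L2dot (edge L false) (comp true false U) (comp true false V)) +
  (L2dot (edge L true) (comp false true U) (comp false true V) +
   L2dot (edge L true) (comp true true U) (comp true true V)).
Proof. by rewrite (energy_dotE U V) addrACA. Qed.

Lemma J_neq0 (m : C) : m != 0 -> J m = (cexp m L - 1) / m.
Proof. by move=> m0; apply: (mulfI m0); rewrite cexp_integral_mul// mulrCA mulfV// mulr1. Qed.

Definition outgoing U (x : R) : C := comp false true U x + comp true true U x.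

Lemma outgoing_L2 U : L2 (edge2 L) (outgoing U).
Proof.
have := L2_lin 1 (measurable_edge L true) (comp_L2 false true U) (comp_L2 true true U).
by congr L2; apply/funext => x; rewrite mul1r.
Qed.

(** The factor e^{r x} on both sides gives the weight e^{2 r x}: r = 0 is the form proportional to
    the energy, and r = - s is the form diagonal on eigenfunctions. *)
Definition weighted_dot (r : R) U V : C :=
  L2dot (edge2 L) (fun x => cexp r%:C%C x * outgoing U x) (fun x => cexp r%:C%C x * outgoing V x).

Lemma weighted_L2 r U : L2 (edge2 L) (fun x => cexp r%:C%C x * outgoing U x).
Proof.
apply: (@L2_mul _ _ _ _ (expR (2 * `|r| * L))).
- exact: measurable_edge2.
- exact: measurable_Re_cexp.
- exact: measurable_Im_cexp.
- move=> x; rewrite /edge2 /= in_itv /= => /andP[x0 xL]; rewrite sqabs_cexp /= ler_expR.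
  rewrite -!mulrA ler_wpM2l//.
  by rewrite (le_trans (ler_norm _))// normrM (gtr0_norm x0) ler_wpM2l// ltW.
- exact: outgoing_L2.
Qed.

Lemma outgoing_lin c U V : {ae mu, forall x, edge2 L x ->
  outgoing (c *: U + V) x = c * outgoing U x + outgoing V x}.
Proof.
have h1 := comp_lin L_gt0 false true c U V; have h2 := comp_lin L_gt0 true true c U V.
apply: filterS2 h1 h2 => x h1 h2 Ix; rewrite /outgoing h1// h2//; ring.
Qed.

Lemma weighted_semi_inner r : semi_inner (weighted_dot r).
Proof.
have m2 := measurable_edge2 L; have w := weighted_L2 r.
split.
- move=> a x y v; rewrite -(L2dot_lin a m2 (w x) (w y) (w v)).
  have h : {ae mu, forall t, edge2 L t -> cexp r%:C%C t * outgoing (a *: x + y) t =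
      a * (cexp r%:C%C t * outgoing x t) + cexp r%:C%C t * outgoing y t}.
    by apply: filterS (outgoing_lin a x y) => t h /h ->; ring.
  have hv : {ae mu, forall t, edge2 L t -> cexp r%:C%C t * outgoing v t = cexp r%:C%C t * outgoing v t}.
    exact: nearW.
  exact: (L2dot_ae m2 (w _) (L2_lin a m2 (w x) (w y)) (w v) (w v) h hv).
- by move=> x y; exact: (L2dot_conj m2 (w x) (w y)).
- by move=> x; exact: L2dot_ge0.
Qed.

Lemma weighted_dot_eigenform (r : R) (l l' A A' b b' k k' : C) U V :
  eigenform l A 1 b k U -> eigenform l' A' 1 b' k' V ->
  weighted_dot r U V = 4 * k * k'^* * J (l + l'^* + (2 * r)%:C%C).
Proof.
move=> hU hV; have m2 := measurable_edge2 L.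
have aux (l0 A0 b0 k0 : C) W : eigenform l0 A0 1 b0 k0 W ->
    {ae mu, forall x, edge2 L x -> cexp r%:C%C x * outgoing W x = (2 * k0) * cexp (r%:C%C + l0) x}.
  move=> hW; have [_ h1] := hW false; have [_ h2] := hW true.
  by apply: filterS2 h1 h2 => x h1 h2 Ix; rewrite /outgoing h1// h2// cexpDl; ring.
have LL c m : L2 (edge2 L) (fun x => c * cexp m x : C).
  exact: L2_edge2_continuous (continuous_partsZ c (continuous_parts_cexp m)).
have := L2dot_ae m2 (weighted_L2 r U) (LL _ _) (weighted_L2 r V) (LL _ _) (aux _ _ _ _ _ hU) (aux _ _ _ _ _ hV).
rewrite /weighted_dot => ->; rewrite edge2_dot_cexp.
have -> : (r%:C%C + l) + (r%:C%C + l')^* = l + l'^* + (2 * r)%:C%C.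
  have -> : (r%:C%C + l')^* = r%:C%C + l'^* :> C.
    by rewrite !conjE; apply: complex_ext; rewrite ?(cReD, cImD) /= ?(opprD, oppr0).
  have -> : (2 * r)%:C%C = r%:C%C + r%:C%C :> C by rewrite -rmorphD; congr (_%:C%C); ring.
  ring.
have -> : (2 * k')^* = 2 * k'^* :> C by rewrite rmorphM; congr (_ * _); rewrite rmorph_nat.
ring.
Qed.

Lemma weighted_dot_mono r r' (M : R) U : r' <= r ->  0 <= M -> expR (2 * (r - r') * L) <= M ->
  complex.Re (weighted_dot r' U U) <= complex.Re (weighted_dot r U U) /\
  complex.Re (weighted_dot r U U) <= M * complex.Re (weighted_dot r' U U).
Proof.
move=> rr M0 hM; have m2 := measurable_edge2 L.
have [_ _ i1] := (L2P _ m2).1 (weighted_L2 r U).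
have [_ _ i2] := (L2P _ m2).1 (weighted_L2 r' U).
rewrite /weighted_dot !L2dot_self /=.
have pt x : edge2 L x -> expR (2 * r' * x) <= expR (2 * r * x) /\
    expR (2 * r * x) <= M * expR (2 * r' * x).
  rewrite /edge2 /= in_itv /= => /andP[x0 xL]; split.
    by rewrite ler_expR ler_wpM2r ?(ltW x0)// ler_wpM2l.
  rewrite -ler_pdivrMr ?expR_gt0// -expRN -expRD; apply: le_trans hM.
  rewrite ler_expR -mulrBl -mulrBr ler_wpM2l ?(ltW xL)//.
  by rewrite mulr_ge0// subr_ge0.
split.
  apply: le_Rintegral => // x /pt[h _]; rewrite !sqabsM !sqabs_cexp /=.
  by rewrite ler_wpM2r ?sqabs_ge0.
rewrite -RintegralZl//; apply: le_Rintegral => //.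
  exact: (integrableZl m2 M i2).
move=> x /pt[_ h]; rewrite !sqabsM !sqabs_cexp /= mulrA.
by rewrite ler_wpM2r ?sqabs_ge0.
Qed.

(** From |u' + v|^2 <= 2 |u'|^2 + 2 |v|^2, each of the two integrals being at most the energy. *)
Lemma weighted_dot0_le U : complex.Re (weighted_dot 0 U U) <= 4 * hnorm (energy_dot L) U ^+ 2.
Proof.
have m2 := measurable_edge2 L.
have h1 := comp_dot_le L_gt0 false true U; have h2 := comp_dot_le L_gt0 true true U.
have [_ _ i0] := (L2P _ m2).1 (weighted_L2 0 U).
have [_ _ i1] := (L2P _ m2).1 (comp_L2 false true U).
have [_ _ i2] := (L2P _ m2).1 (comp_L2 true true U).
move: h1 h2; rewrite /weighted_dot !L2dot_self /= => h1 h2.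
have z1 := integrableZl m2 2 i1; have z2 := integrableZl m2 2 i2.
apply: (@le_trans _ _ (\int[mu]_(x in edge2 L) (2 * sqabs (comp false true U x) + 2 * sqabs (comp true true U x)))).
  apply: le_Rintegral => //; first exact: (integrableD m2 z1 z2).
  move=> x _; rewrite sqabsM sqabs_cexp /= mulr0 mul0r expR0 mul1r /outgoing.
  by have := sqabs_lin 1 (comp false true U x) (comp true true U x); rewrite mul1r sqabs1 mulr1.
rewrite RintegralD// RintegralZl// RintegralZl//.
set N := hnorm _ _ ^+ 2 in h1 h2 *; move: h1 h2.
move: (Rintegral _ _ _) (Rintegral _ _ _) => p q; lra.
Qed.

End Pairings.

Section Proportional.
Context {R : realType}.
Local Notation C := R[i].
Context {V : lmodType C} (d dN : V -> V -> C).
Hypothesis (sd : semi_inner d) (sN : semi_inner dN).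

Lemma semi_innerM (k : R) : 0 <= k -> semi_inner (fun x y => k%:C%C * d x y).
Proof.
move=> k0; split=> [a x y v|x y|x].
- by rewrite (semi_lin sd); ring.
- by rewrite [d x y](semi_herm sd) -[k%:C%C in LHS]conjc_real -rmorphM.
- by rewrite mulr_ge0 ?(semi_ge0 sd)// lecR.
Qed.

Lemma hnormM (k : R) x : 0 <= k -> hnorm (fun x y => k%:C%C * d x y) x = Num.sqrt k * hnorm d x.
Proof. by move=> k0; rewrite /hnorm cReM /= mul0r subr0 sqrtrM. Qed.

(** Proportionality extends from A to its span by sesquilinearity. The bound of [dN] by d controls
    the approximation error, so the norm inequality reaches the closure. *)
Lemma hnorm_proportional (A : set V) (K B : R) : 0 <= K ->
  (forall x y, A x -> A y -> d x y = K%:C%C * dN x y) ->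
  (forall x, hnorm dN x <= B * hnorm d x) ->
  forall x, closed_span d A x -> hnorm d x <= Num.sqrt K * hnorm dN x.
Proof.
move=> K0 dA dNB x xA.
have h1 a y : A a -> lin_span A y -> d y a = K%:C%C * dN y a.
  move=> Aa; move: y; apply: lin_span_ind => /=; first by rewrite !semi0l// mulr0.
  by move=> c u v Au h; rewrite (semi_lin sd) (semi_lin sN) h dA//; ring.
have h2 y v : lin_span A y -> lin_span A v -> d v y = K%:C%C * dN v y.
  move=> yA; move: v; apply: lin_span_ind => /=; first by rewrite !semi0l// mulr0.
  move=> c u v Au h; rewrite (semi_lin sd) (semi_lin sN) h.
  have -> : d u y = K%:C%C * dN u y.
    by rewrite (semi_herm sd) (h1 u y)// [dN u y](semi_herm sN) -[in RHS](conjc_real K) -rmorphM.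
  ring.
apply/ler_addgt0Pr => e e0.
have q0 : 0 < 1 + Num.sqrt K * `|B| by rewrite ltr_wpDr// mulr_ge0 ?sqrtr_ge0.
have [y yA xy] := xA _ (divr_gt0 e0 q0).
have yK : hnorm d y = Num.sqrt K * hnorm dN y.
  by rewrite {1}/hnorm (h2 _ _ yA yA) cReM /= mul0r subr0 sqrtrM.
have t1 := hnormB_trans sd x y 0; have t2 := hnormB_trans sN y x 0.
rewrite !subr0 in t1 t2.
have t3 : hnorm dN (y - x) <= `|B| * hnorm d (x - y).
  rewrite (hnormBC sN); apply: le_trans (dNB _) _.
  by rewrite ler_wpM2r ?hnorm_ge0// ler_norm.
move: xy; rewrite ltr_pdivlMr// => xy.
have := ler_wpM2l (sqrtr_ge0 K) t2; have := ler_wpM2l (sqrtr_ge0 K) t3.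
move: t1 xy; rewrite yK.
move: (hnorm _ _) (hnorm _ _) (hnorm _ _) (hnorm _ _) (hnorm _ _) (Num.sqrt K) `|B|.
by move=> a1 a2 a3 a4 a5 q b; lra.
Qed.

End Proportional.

(** * Energy pairings of the two spectral families *)

Section Spectral.
Context {R : realType} (L alpha : R).
Hypothesis L_gt0 : 0 < L.
Hypothesis alpha_range : 1 < alpha < 3 \/ 3 < alpha.
Local Notation C := R[i].
Local Notation zr := (zr alpha).
Local Notation z := (zr%:C%C : C).
Local Notation s := (abscissa L alpha).
Local Notation J := (fun m : C => cintegral (edge2 L) (cexp m)).
Implicit Types (U V : energy L).

(** The energy product divided by the unweighted form on eigenfunctions: the loop contributes 1, and
    the half-line contributes the fraction, namely 2 (1 + z)^2 / (4 (1 - z^2)). *)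
Definition outgoing_ratio : R := 1 + (1 + zr) / (2 * (1 - zr)).
Local Notation K := outgoing_ratio.

Lemma outgoing_ratio_gt0 : 0 < K.
Proof.
have /andP[z1 z2] := zr_bounds alpha_range.
by rewrite /K ltr_wpDr// divr_ge0; lra.
Qed.

Lemma conj_z : z^* = z.
Proof. by rewrite conjE /= oppr0. Qed.

Lemma add_conj_neq0 (l l' : C) : complex.Re l < 0 -> complex.Re l' < 0 -> l + l'^* != 0.
Proof.
move=> l0 l0'; have : complex.Re (l + l'^*) < 0 by rewrite cReD conjE /=; lra.
by apply: contraTneq => ->; rewrite ltxx.
Qed.

Lemma energy_dot_pa (l l' k k' : C) U V : complex.Re l < 0 -> complex.Re l' < 0 ->
  cexp l L = z -> cexp l' L = z ->
  eigenform l (1 + z) 1 z k U -> eigenform l' (1 + z) 1 z k' V ->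
  energy_dot L U V = K%:C%C * weighted_dot 0 U V /\
  weighted_dot 0 U V = 4 * k * k'^* * ((z ^+ 2 - 1) / (l + l'^*)).
Proof.
move=> l0 l0' lz lz' hU hV; have m0 := add_conj_neq0 l0 l0'.
have mL : cexp (l + l'^*) L = z ^+ 2 by rewrite cexpDl cexp_conj lz lz' conj_z.
have Jm : J (l + l'^*) = (z ^+ 2 - 1) / (l + l'^*) by rewrite J_neq0// mL.
have zn := z_neq0 alpha_range.
(* The reflected waves, of relative amplitude z, contribute on the loop exactly as much as the
   direct ones. *)
have JNm : z * z * J (- (l + l'^*)) = (z ^+ 2 - 1) / (l + l'^*).
  rewrite J_neq0 ?oppr_eq0// cexpN mL; field.
  by rewrite m0.
have w : weighted_dot 0 U V = 4 * k * k'^* * ((z ^+ 2 - 1) / (l + l'^*)).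
  by rewrite (weighted_dot_eigenform 0 hU hV) mulr0 addr0 Jm.
split=> //; rewrite energy_dotE' (edge2_dot_eigenform hU hV).
rewrite !(edge1_dot_eigenform _ l0 l0' hU hV) rmorph1 !mulr1 !mul1r Jm conj_z JNm w.
have KE : (K%:C%C : C) = 1 + (1 + z) / (2 * (1 - z)).
  by rewrite /K rmorphD rmorphM fmorphV rmorphM rmorphB rmorphD rmorph1 rmorph_nat.
have z1 := oneBz_neq0 alpha_range.
have c1z : (1 + z)^* = 1 + z by rewrite conjE; apply: complex_ext; rewrite ?(cReD, cImD) /= ?addr0 ?oppr0.
have kz : (k' * (1 + z))^* = k'^* * (1 + z) by rewrite -[in RHS]c1z; exact: rmorphM.
rewrite KE kz; field.
by rewrite m0.
Qed.

(** The half-line does not contribute. On the loop, with m = l + conj l' and e^{m L} = z, the direct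
    term (z - 1) / m cancels against the reflected one, whose coefficient is - z. *)
Lemma energy_dot_pa_p (l l' k k' : C) U V : complex.Re l < 0 -> complex.Re l' = 0 ->
  cexp l L = z -> cexp l' L = 1 ->
  eigenform l (1 + z) 1 z k U -> eigenform l' 0 1 (- 1) k' V -> energy_dot L U V = 0.
Proof.
move=> l0 l0' lz lz' hU hV.
have m0 : l + l'^* != 0.
  have : complex.Re (l + l'^*) < 0 by rewrite cReD conjE /= l0' addr0.
  by apply: contraTneq => ->; rewrite ltxx.
have mL : cexp (l + l'^*) L = z by rewrite cexpDl cexp_conj lz lz' rmorph1 mulr1.
have zn := z_neq0 alpha_range.
rewrite energy_dotE' (edge2_dot_eigenform hU hV) !(edge1_dot_eigenform0 _ hU hV).
rewrite !J_neq0 ?oppr_eq0// cexpN mL rmorphN rmorph1 /=; field.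
by rewrite zn m0.
Qed.

Lemma orthogonal_H_pa_H_p : orthogonal_sets (energy_dot L) (H_pa L alpha) (H_p L alpha).
Proof.
apply: (orthogonal_closed_spans (energy_semi_inner L_gt0)).
move=> U V [_ [n _ <-] [_ [i hU]]] [l' lp [_ [j hV]]].
have [r' c'] := Sigma_pP L_gt0 lp.
have lz := cexp_eig_pa L_gt0 alpha_range n.
have l0 : complex.Re (eig_pa L alpha n) < 0 by rewrite (Re_eig_pa L alpha_range) abscissa_lt0.
have [k kU] := ker_power_eigenform_pa L_gt0 alpha_range (ltW l0) lz hU.
have [k' kV] := ker_power_eigenform_p L_gt0 r' c' hV.
exact: energy_dot_pa_p l0 r' lz c' kU kV.
Qed.

(** The squared energy norm at amplitude 1. It does not depend on n because l_n + conj l_n = 2 s,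
    and it is positive since zr^2 - 1 and s are both negative. *)
Definition eigenfunction_weight : R := K * (4 * ((zr ^+ 2 - 1) / (2 * s))).
Local Notation G := eigenfunction_weight.

Lemma eigenfunction_weight_gt0 : 0 < G.
Proof.
have /andP[z1 z2] := zr_bounds alpha_range; have s0 := abscissa_lt0 L_gt0 alpha_range.
rewrite mulr_gt0 ?outgoing_ratio_gt0// mulr_gt0// -mulrNN -invrN divr_gt0//; first by nra.
by lra.
Qed.

Section OneEigenvalue.
Variable n : int.
Local Notation l := (eig_pa L alpha n).

Lemma Re_eig_pa_lt0 : complex.Re l < 0.
Proof. by rewrite (Re_eig_pa L alpha_range) abscissa_lt0. Qed.

Lemma hnorm_eigenform k U : eigenform l (1 + z) 1 z k U ->
  hnorm (energy_dot L) U ^+ 2 = G * sqabs k.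
Proof.
move=> hU; have lz := cexp_eig_pa L_gt0 alpha_range n; have l0 := Re_eig_pa_lt0.
rewrite (hnorm_sqr (energy_semi_inner L_gt0)).
have [-> ->] := energy_dot_pa l0 l0 lz lz hU hU.
have -> : l + l^* = (2 * s)%:C%C.
  by rewrite conjE; apply: complex_ext; rewrite ?cReD ?cImD /= ?(Re_eig_pa L alpha_range); ring.
have -> : 4 * k * k^* * ((z ^+ 2 - 1) / (2 * s)%:C%C) =
   (4 * sqabs k * ((zr ^+ 2 - 1) / (2 * s)))%:C%C.
  have cast (p q r : R) : 4 * p%:C%C * ((q%:C%C ^+ 2 - 1) / (2 * r)%:C%C) =
      (4 * p * ((q ^+ 2 - 1) / (2 * r)))%:C%C.
    by rewrite [in RHS]rmorphM [in RHS]rmorphM [X in _ = _ * X]rmorphM fmorphV rmorphB rmorphXn rmorph1 rmorph_nat.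
  by rewrite -[4 * k * _]mulrA -sqabsE cast.
by rewrite -rmorphM /= /G; ring.
Qed.

Lemma normalized_eigenvector : exists U, exists2 k, eigenform l (1 + z) 1 z k U &
  wave_op L alpha U (l *: U) /\ hnorm (energy_dot L) U = 1.
Proof.
(* The amplitude that makes the energy norm equal to 1. *)
pose c : C := ((Num.sqrt G)^-1)%:C%C.
have lz := cexp_eig_pa L_gt0 alpha_range n.
have zn := z_neq0 alpha_range.
have e1 : c * (1 + z) = c + c * z by ring.
have e2 : c * (1 + z) = c * cexp l L + c * z / cexp l L by rewrite lz mulfK//; ring.
have e3 : c * (1 + z) + (c - c * z) - (c * cexp l L - c * z / cexp l L) = alpha%:C%C * (c * (1 + z)).
  have zc : z * (1 + alpha%:C%C) = 3 - alpha%:C%C.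
    have := congr1 (real_complex R) (zr_char alpha_range).
    rewrite /= rmorphM rmorphD rmorphB rmorph1 => ->.
    by congr (_ - _); rewrite rmorph_nat.
  rewrite lz mulfK//; apply/eqP; rewrite -subr_eq0; apply/eqP.
  transitivity (c * (3 - alpha%:C%C - z * (1 + alpha%:C%C))); first by ring.
  by rewrite zc; ring.
have [U [wU hU]] := eigenvector_exists L_gt0 Re_eig_pa_lt0 e1 e2 e3.
have hU' : eigenform l (1 + z) 1 z c U.
  move=> i; have [h1 h2] := hU i; rewrite mul1r in h1; split=> //.
  move: h2; congr ({ae _, _}); apply/funext => x; congr (_ -> _ = _).
  by case: i {h1}; ring.
exists U; exists c => //; split=> //.
have G0 := eigenfunction_weight_gt0.
have cG : sqabs c = G^-1 by rewrite sqabs_real exprVn sqr_sqrtr ?(ltW G0).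
have := hnorm_eigenform hU'; rewrite cG mulfV ?gt_eqF//.
by move=> /eqP; rewrite sqrp_eq1 ?hnorm_ge0// => /eqP.
Qed.

Lemma gen_eigenvector_eigenform U : gen_eigenvector (wave_op L alpha) l U ->
  exists k, eigenform l (1 + z) 1 z k U.
Proof.
move=> [_ [i hU]].
exact: (ker_power_eigenform_pa L_gt0 alpha_range (ltW Re_eig_pa_lt0) (cexp_eig_pa L_gt0 alpha_range n) hU).
Qed.

End OneEigenvalue.

Lemma eigenvector_gen (l : C) U : wave_op L alpha U (l *: U) -> hnorm (energy_dot L) U = 1 ->
  gen_eigenvector (wave_op L alpha) l U.
Proof.
move=> wU U1; split.
  apply/eqP => U0; move: U1; rewrite U0 hnorm0; last exact: energy_semi_inner.
  by move=> /esym/eqP; rewrite oner_eq0.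
by exists 1%N, (l *: U); rewrite subrr.
Qed.

Lemma eig_pa_Im_inj m n : complex.Im (eig_pa L alpha m) = complex.Im (eig_pa L alpha n) -> m = n.
Proof.
have Ln : L != 0 by rewrite gt_eqF.
have pn : pi != 0 :> R by rewrite gt_eqF ?pi_gt0.
have L' := invr_neq0 Ln.
have t : 2 != 0 :> R by rewrite pnatr_eq0.
rewrite /eig_pa; case: ifP => _ /= /(mulIf L').
  by move=> /(mulfI (mulf_neq0 t pn))/intr_inj.
by move=> /(mulIf pn)/addIr/(mulfI t)/intr_inj.
Qed.

(** * The orthonormal form on H_pa and its equivalence with the energy *)

Section Basis.
Variables (Psi : int -> energy L) (k : int -> C).
Hypothesis Psi_eigenform : forall n, eigenform (eig_pa L alpha n) (1 + z) 1 z (k n) (Psi n).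
Hypothesis Psi_norm : forall n, hnorm (energy_dot L) (Psi n) = 1.

Let sqabs_k n : G * sqabs (k n) = 1.
Proof. by rewrite -(hnorm_eigenform (Psi_eigenform n)) Psi_norm expr1n. Qed.

(** The weighted form equals 4 L |k n|^2 on the n-th eigenfunction, and normalization gives G |k
    n|^2 = 1; hence the scale G / (4 L). *)
Definition basis_dot U V : C := (G / (4 * L))%:C%C * weighted_dot (- s) U V.

Let basis_scale_gt0 : 0 < G / (4 * L).
Proof. by rewrite divr_gt0 ?eigenfunction_weight_gt0 ?mulr_gt0. Qed.

Lemma basis_semi_inner : semi_inner basis_dot.
Proof.
apply: (semi_innerM (weighted_semi_inner L_gt0 (- s))).
exact: ltW.
Qed.

(* The weight e^{-2sx} turns the exponents l_m + conj l_n into the frequencies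
   2 i pi (m - n) / L of the Fourier basis of (0, L). *)
Lemma basis_orthonormal m n : basis_dot (Psi m) (Psi n) = (m == n)%:R.
Proof.
rewrite /basis_dot (weighted_dot_eigenform (- s) (Psi_eigenform m) (Psi_eigenform n)).
set e := _ + _ + _.
have Ree : complex.Re e = 0.
  by rewrite /e !cReD conjE /= !(Re_eig_pa L alpha_range); ring.
have Ime : complex.Im e = complex.Im (eig_pa L alpha m) - complex.Im (eig_pa L alpha n).
  by rewrite /e !cImD conjE /= addr0.
have [mn|mn] := eqVneq m n.
  have -> : e = 0 by apply: complex_ext; rewrite // Ime mn subrr.
  rewrite (cexp_integral0 L_gt0) mn.
  have -> : 4 * k n * (k n)^* * L%:C%C = (4 * sqabs (k n) * L)%:C%C.
    by rewrite -[4 * k n * _]mulrA -sqabsE !rmorphM rmorph_nat.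
  rewrite -rmorphM; transitivity ((1 : R)%:C%C : C); last by rewrite rmorph1.
  congr (_%:C%C); rewrite -[RHS](sqabs_k n).
  move: G (sqabs _) => g k2; have Ln : L != 0 by rewrite gt_eqF.
  by field.
have e0 : e != 0.
  apply: contra_neq mn => e0; apply: eig_pa_Im_inj; apply/eqP.
  by rewrite -subr_eq0 -Ime e0.
rewrite J_neq0//.
have -> : cexp e L = 1.
  rewrite /e !cexpDl cexp_conj !(cexp_eig_pa L_gt0 alpha_range) conj_z.
  have zn := zr_neq0 alpha_range.
  (* Over the length L the weight contributes |zr|^-2, which compensates the product of the two
     factors e^{l L} = z. *)
  have -> : cexp (2 * - s)%:C%C L = ((zr ^+ 2)^-1)%:C%C.
    apply: complex_ext; rewrite /= mul0r ?cos0 ?sin0 ?mulr1 ?mulr0//.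
    rewrite (_ : 2 * - s * L = - (s * L) + - (s * L)); last by ring.
    by rewrite expRD expRN (expR_abscissa L_gt0 alpha_range) -expr2 exprVn real_normK ?num_real.
  by rewrite -!rmorphM -expr2 mulfV ?rmorph1// expf_neq0.
by rewrite subrr mul0r !mulr0.
Qed.

(** On the closed span the energy is controlled by the unweighted form, and passing to the weighted
    one costs nothing since e^{-2 s x} >= 1 for s < 0. *)
Lemma hnorm_le_basis U : closed_span (energy_dot L) (range Psi) U ->
  hnorm (energy_dot L) U <= Num.sqrt K / Num.sqrt (G / (4 * L)) * hnorm basis_dot U.
Proof.
move=> UW; have sd := energy_semi_inner L_gt0; have sw := weighted_semi_inner L_gt0.
have h : hnorm (energy_dot L) U <= Num.sqrt K * hnorm (weighted_dot 0) U.
  apply: (hnorm_proportional (B := 2) sd (sw 0) (ltW outgoing_ratio_gt0) _ _ UW).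
    move=> _ _ [m _ <-] [n _ <-].
    have lz := cexp_eig_pa L_gt0 alpha_range.
    by have [] := energy_dot_pa (Re_eig_pa_lt0 m) (Re_eig_pa_lt0 n) (lz m) (lz n) (Psi_eigenform m) (Psi_eigenform n).
  move=> V; rewrite -(@ler_pXn2r _ 2)// ?nnegrE ?mulr_ge0 ?hnorm_ge0//.
  rewrite exprMn (hnorm_sqr (sw 0)).
  apply: le_trans (weighted_dot0_le L_gt0 V) _; rewrite ler_wpM2r ?sqr_ge0//.
  by rewrite -natrX.
have k0 := basis_scale_gt0.
rewrite (hnormM (weighted_dot (- s)) U (ltW k0)).
have cancel (p q w : R) : 0 < q -> p / Num.sqrt q * (Num.sqrt q * w) = p * w.
  by move=> q0; rewrite mulrA divfK// gt_eqF ?sqrtr_gt0.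
rewrite (cancel _ _ _ k0).
apply: le_trans h _; apply: (ler_wpM2l (sqrtr_ge0 K)); apply: ler_wsqrtr.
have s0 := abscissa_lt0 L_gt0 alpha_range.
have [] // := @weighted_dot_mono R L (- s) 0 (expR (2 * (- s - 0) * L)) U.
by rewrite oppr_ge0 ltW.
Qed.

(** Valid on the whole energy space: the weight is at most e^{-2 s L} on the loop, and the
    unweighted form is at most four times the energy. *)
Lemma basis_le_hnorm U :
  hnorm basis_dot U <= Num.sqrt (G / (4 * L)) * Num.sqrt (4 * expR (2 * - s * L)) * hnorm (energy_dot L) U.
Proof.
have sd := energy_semi_inner L_gt0; have sw := weighted_semi_inner L_gt0.
have k0 := basis_scale_gt0; have s0 := abscissa_lt0 L_gt0 alpha_range.
rewrite (hnormM (weighted_dot (- s)) U (ltW k0)) -mulrA ler_wpM2l ?sqrtr_ge0//.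
rewrite -(@ler_pXn2r _ 2)// ?nnegrE ?mulr_ge0 ?hnorm_ge0 ?sqrtr_ge0//.
rewrite exprMn (hnorm_sqr (sw (- s))) sqr_sqrtr ?mulr_ge0 ?expR_ge0//.
have := @weighted_dot_mono R L (- s) 0 (expR (2 * - s * L)) U.
rewrite subr0 => /(_ _ _ _)[]//; first by rewrite oppr_ge0 ltW.
move=> _ h; apply: le_trans h _.
apply: le_trans (ler_wpM2l (expR_ge0 _) (weighted_dot0_le L_gt0 U)) _.
by rewrite mulrA [expR _ * 4]mulrC.
Qed.

(** Each generalized eigenspace is a line, so every normalized choice of eigenvectors spans the same
    closed subspace. *)
Lemma H_pa_closed_span :
  (forall n, gen_eigenvector (wave_op L alpha) (eig_pa L alpha n) (Psi n)) ->
  H_pa L alpha = closed_span (energy_dot L) (range Psi).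
Proof.
move=> gP; have sd := energy_semi_inner L_gt0; apply/seteqP; split.
  apply: (closed_span_min sd) => U [_ [n _ <-] /gen_eigenvector_eigenform[c hU]].
  have kn : k n != 0.
    apply/eqP => kn.
    by have := sqabs_k n; rewrite kn /sqabs /= expr0n addr0 mulr0 => /esym/eqP; rewrite oner_eq0.
  have h := eigenformZ L_gt0 (c / k n) (Psi_eigenform n); rewrite divfK// in h.
  rewrite (eigenform_eq L_gt0 hU h); apply: closed_spanZ => //.
  by apply: (closed_span_sub sd); exists n.
apply: (closed_span_min sd) => _ [n _ <-]; apply: (closed_span_sub sd).
by exists (eig_pa L alpha n) => //; exists n.
Qed.

End Basis.

End Spectral.

(** Existence of normalized generalized eigenvectors accompanies the Riesz property so that
    quantifying over all such families is not vacuous; the last clause makes the decay rate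
    sharp. *)
Theorem theorem2p2 (R : realType) (L alpha : R) (L_gt0 : 0 < L)
    (alpha_range : 1 < alpha < 3 \/ 3 < alpha) :
  [/\ (forall n : int, exists Psi : energy L,
         gen_eigenvector (wave_op L alpha) (eig_pa L alpha n) Psi /\
         hnorm (energy_dot L) Psi = 1) /\
      (forall Psi : int -> energy L,
         (forall n : int,
            gen_eigenvector (wave_op L alpha) (eig_pa L alpha n) (Psi n) /\
            hnorm (energy_dot L) (Psi n) = 1) ->
         riesz_basis (energy_dot L) (H_pa L alpha) Psi),
      orthogonal_sets (energy_dot L) (H_pa L alpha) (H_p L alpha) &
      let s := sup [set complex.Re l | l in Sigma_pa L alpha] in
      s < 0 /\
      forall S : R -> energy L -> energy L,
        contraction_semigroup (energy_dot L) S ->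
        is_generator (energy_dot L) S (wave_op L alpha) ->
        decays_at_rate (energy_dot L) S (H_pa L alpha) (H_p L alpha) s /\
        forall omega : R,
          decays_at_rate (energy_dot L) S (H_pa L alpha) (H_p L alpha) omega ->
          s <= omega].
Proof.
have sd := energy_semi_inner L_gt0.
have definite := @energy_definite R L L_gt0.
have sE := basis_semi_inner L_gt0 alpha_range.
have orth := orthogonal_H_pa_H_p L_gt0 alpha_range.
split=> //.
- split=> [n|Psi hPsi].
    have [U [k _ [wU U1]]] := normalized_eigenvector L_gt0 alpha_range n.
    by exists U; split=> //; exact: eigenvector_gen.
  have /choice[k hk] n := gen_eigenvector_eigenform L_gt0 alpha_range (hPsi n).1.
  have hn n := (hPsi n).2.
  rewrite (H_pa_closed_span L_gt0 alpha_range hk hn (fun n => (hPsi n).1)).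
  apply: (riesz_basis_orthonormal_form sd sE (energy_complete L_gt0) definite).
  - exact: (hnorm_le_basis L_gt0 alpha_range hk).
  - by move=> U _; exact: basis_le_hnorm.
  - exact: (basis_orthonormal L_gt0 alpha_range hk hn).
- move=> s; have sE' : s = abscissa L alpha.
    (* All eigenvalues in Sigma_pa have the same real part, so the supremum is that of a
       singleton. *)
    rewrite /s (_ : [set _ | _ in _] = [set abscissa L alpha]) ?sup1//.
    apply/seteqP; split=> [_ [_ [n _ <-] <-]|_ ->]; first exact: Re_eig_pa.
    by exists (eig_pa L alpha 0); [exists 0|exact: Re_eig_pa].
  rewrite sE'; split=> [|S cS gS]; first exact: abscissa_lt0.
  (* The decay estimate is carried out on one normalized family, whose closed span is H_pa. *)
  have /choice[Psi /choice[k hk]] n : exists U k, eigenform (eig_pa L alpha n)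
      (1 + (zr alpha)%:C%C) 1 (zr alpha)%:C%C k U /\
      (wave_op L alpha U (eig_pa L alpha n *: U) /\ hnorm (energy_dot L) U = 1).
    by have [U [k hU h]] := normalized_eigenvector L_gt0 alpha_range n; exists U, k.
  have hf n := (hk n).1; have hw n := (hk n).2.1; have hn n := (hk n).2.2.
  have gP n := eigenvector_gen L_gt0 (hw n) (hn n).
  have HE := H_pa_closed_span L_gt0 alpha_range hf hn gP.
  have S_Psi t n : 0 <= t -> S t (Psi n) = cexp (eig_pa L alpha n) t *: Psi n.
    apply: (semigroup_eigenvector sd definite cS (ltW (Re_eig_pa_lt0 L_gt0 alpha_range n))).
    exact/gS.
  have leb := hnorm_le_basis L_gt0 alpha_range hf.
  have ble U (_ : closed_span (energy_dot L) (range Psi) U) := basis_le_hnorm L_gt0 alpha_range U.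
  have on := basis_orthonormal L_gt0 alpha_range hf hn.
  have re := Re_eig_pa L alpha_range.
  rewrite HE in orth *; split.
    exact: (decays_at_common_rate sd sE definite leb ble on orth cS re S_Psi).
  move=> omega; exact: (decay_rate_optimal sd sE definite on orth cS re S_Psi).
Qed.
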